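(* Let $\mathfrak g$ be a complex semisimple Lie algebra with fixed Cartan subalgebra $\mathfrak h$, triangular decomposition $\mathfrak g=\mathfrak n_-\oplus\mathfrak h\oplus\mathfrak n_+$ and non-degenerate $\mathrm{ad}$-invariant symmetric bilinear form $(\,,\,)$, and let $\Phi\colon \mathrm{Cl}(\mathfrak g)\to \mathrm{Cl}(\mathfrak h)$ be the Harish-Chandra map. Then the restriction of $\Phi$ to the subalgebra $\mathrm{Cl}(\mathfrak g)^{\mathfrak g}$ of $\mathfrak g$-invariants is a superalgebra isomorphism $\Phi\colon \mathrm{Cl}(\mathfrak g)^{\mathfrak g}\to \mathrm{Cl}(\mathfrak h)$.
   Context: $\mathfrak g$ is a finite-dimensional semisimple Lie algebra over $\mathbb C$; a Cartan subalgebra $\mathfrak h$ and a Borel subalgebra containing it are fixed, and $\mathfrak n_+$ (resp. $\mathfrak n_-$) is the span of the root vectors for positive (resp. negative) roots. $(\,,\,)$ is a non-degenerate $\mathrm{ad}$-invariant symmetric bilinear form on $\mathfrak g$. For a finite-dimensional complex vector space $V$ with symmetric bilinear form $(\,,\,)$, $\mathrm{Cl}(V)$ is the quotient of the tensor algebra $T(V)$ by the two-sided ideal generated by $x\otimes x-(x,x)$, $x\in V$ (so $xy+yx=2(x,y)$); it is a superalgebra ($\mathbb Z/2$-graded) with $V$ odd. The adjoint action of $x\in\mathfrak g$ on $\mathfrak g$ extends uniquely to an even derivation $\theta(x)$ of $\mathrm{Cl}(\mathfrak g)$, and $\mathrm{Cl}(\mathfrak g)^{\mathfrak g}=\{u\in\mathrm{Cl}(\mathfrak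 g)\mid \theta(x)u=0\ \forall x\in\mathfrak g\}$. Let $\mathrm{Cl}(\mathfrak n_\pm)$, $\mathrm{Cl}(\mathfrak h)$ be the Clifford algebras of the restricted forms, identified with the subalgebras of $\mathrm{Cl}(\mathfrak g)$ generated by $\mathfrak n_\pm$, $\mathfrak h$. Multiplication gives a linear isomorphism $\mathrm{Cl}(\mathfrak n_-)\otimes\mathrm{Cl}(\mathfrak h)\otimes\mathrm{Cl}(\mathfrak n_+)\to\mathrm{Cl}(\mathfrak g)$. As $(\,,\,)$ vanishes on $\mathfrak n_\pm$, $\mathrm{Cl}(\mathfrak n_\pm)=\bigwedge\mathfrak n_\pm$; let $\varepsilon_\pm\colon\mathrm{Cl}(\mathfrak n_\pm)\to\mathbb C$ be the algebra homomorphism with $\varepsilon_\pm(\mathfrak n_\pm)=0$. The Harish-Chandra map is the linear map $\Phi=\varepsilon_-\otimes\mathrm{id}\otimes\varepsilon_+\colon\mathrm{Cl}(\mathfrak g)\to\mathrm{Cl}(\mathfrak h)$ with respect to this factorisation. *)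

(* Defs.v *)
From HB Require Import structures.
From mathcomp Require Import all_boot all_order all_algebra.
From mathcomp Require Import boolp classical_sets reals.
From mathcomp Require Import complex finmap monalg.

Set Implicit Arguments.
Unset Strict Implicit.
Unset Printing Implicit Defensive.

Import GRing.Theory.

Local Open Scope ring_scope.
Local Open Scope quotient_scope.

HB.mixin Record Vector_isLie (F : fieldType) g of Vector F g := {
  lie : g -> g -> g;
  lie_linearl : forall y, linear (lie^~ y);
  lie_linearr : forall x, linear (lie x);
  liexx : forall x, lie x x = 0;
  lie_jacobi : forall x y z,
    lie x (lie y z) + lie y (lie z x) + lie z (lie x y) = 0
}.

#[short(type="lieAlgType")]
HB.structure Definition LieAlgebra (F : fieldType) :=
  {g of Vector_isLie F g & Vector F g}.

HB.instance Definition _ (F : fieldType) (g : lieAlgType F) :=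
  bilinear_isBilinear.Build F g g g *:%R *:%R (@lie F g)
    (@lie_linearl F g, @lie_linearr F g).

Section LieTheory.
Variables (F : fieldType) (g : lieAlgType F).
Implicit Types (U V h b I : {vspace g}) (x y z : g).

Definition lie_prod U V : {vspace g} :=
  <<allpairs (@lie F g) (vbasis U) (vbasis V)>>%VS.

Definition lie_subalgebra U := (lie_prod U U <= U)%VS.

Definition lie_ideal I := (lie_prod fullv I <= I)%VS.

Definition lie_solvable U :=
  exists n, iter n (fun W => lie_prod W W) U = 0%VS.

Definition lie_nilpotent U := exists n, iter n (lie_prod U) U = 0%VS.

Definition lie_semisimple :=
  forall I, lie_ideal I -> lie_solvable I -> I = 0%VS.

Definition cartan_subalgebra h :=
  [/\ lie_subalgebra h, lie_nilpotent h &
      forall x, (forall y, y \in h -> lie x y \in h) -> x \in h].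

Definition borel_subalgebra b :=
  [/\ lie_subalgebra b, lie_solvable b &
      forall V, lie_subalgebra V -> lie_solvable V -> (b <= V)%VS -> V = b].

Definition ad_invariant (B : g -> g -> F) :=
  forall x y z, B (lie x y) z = B x (lie y z).

Section Roots.
Variables h b : {vspace g}.
Implicit Type alpha : 'Hom(subvs_of h, F^o).

Definition weight_vector alpha x :=
  forall t : subvs_of h, lie (vsval t) x = (alpha t : F) *: x.

Definition is_root alpha :=
  alpha != 0 /\ exists2 x, x != 0 & weight_vector alpha x.

(* The positive system attached to a Borel subalgebra containing h. *)
Definition positive_root alpha :=
  is_root alpha /\ forall x, weight_vector alpha x -> x \in b.

Definition pos_root_vector x :=
  exists2 alpha, positive_root alpha & weight_vector alpha x.

Definition neg_root_vector x :=
  exists2 alpha, positive_root alpha & weight_vector (- alpha) x.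

End Roots.
End LieTheory.

Section LinearSpan.
Variables (F : fieldType) (V : vectType F).

Definition is_linear_span (S : V -> Prop) (U : {vspace V}) :=
  (forall x, S x -> x \in U) /\
  (forall W : {vspace V}, (forall x, S x -> x \in W) -> (U <= W)%VS).

Definition linear_span (S : V -> Prop) : {vspace V} :=
  xget 0%VS [set U | is_linear_span S U]%classic.

Lemma linear_spanP (S : V -> Prop) : is_linear_span S (linear_span S).
Proof.
suff [U SU] : exists U, is_linear_span S U.
  by rewrite /linear_span; case: xgetP => [W _ //|/(_ U)].
pose ok d := `[< exists2 s : seq V, (forall x, x \in s -> S x) &
                  \dim <<s>>%VS = d >].
have ex_ok : exists d, ok d.
  by exists (\dim <<[::] : seq V>>%VS); apply/asboolP; exists [::].
have ok_le d : ok d -> (d <= \dim {:V})%N.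
  by move=> /asboolP[s _ <-]; rewrite dimvS ?subvf.
have [_ /asboolP[s sS <-] s_max] := ex_maxnP ex_ok ok_le.
exists <<s>>%VS; split=> [x Sx|W SW]; last by apply/span_subvP => x /sS/SW.
have := s_max _ (introT (asboolP _) (ex_intro2 _ _ (x :: s) _ erefl)).
rewrite span_cons => le_dim.
have /eqP -> : (<<s>> == <[x]> + <<s>>)%VS.
  rewrite eqEdim addvSr le_dim// => y.
  by rewrite inE => /predU1P[->//|/sS].
by rewrite memvE addvSl.
Qed.

End LinearSpan.

Section Nilradicals.
Variables (F : fieldType) (g : lieAlgType F) (h b : {vspace g}).

Definition nplus : {vspace g} := linear_span (pos_root_vector h b).
Definition nminus : {vspace g} := linear_span (neg_root_vector h b).

End Nilradicals.

Fact malg_scaleAr (F : fieldType) (K : monomType) (a : F) (s t : {malg F[K]}) :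
  a *: (s * t) = s * (a *: t).
Proof.
apply/malgP => k; rewrite mcoeffZ (mcoeffMl s t).
rewrite (mcoeffMlw _ (fsubset_refl _) (msuppZ_le a t)) mulr_sumr.
apply: eq_bigr => i _; rewrite mulr_sumr; apply: eq_bigr => j _.
by rewrite mcoeffZ mulrCA mulrnAr.
Qed.

(* T(V), as the algebra of noncommutative polynomials in the vectors of the   *)
(* basis [vbasis fullv] of V; the embedding of V is [tgen]. The operations    *)
(* are those of {malg _}, locked to keep unification from unfolding them.     *)
Definition tensor_alg (F : fieldType) (V : vectType F) : Type :=
  {malg F[{fmonom 'I_(\dim {:V})}]}.
HB.instance Definition _ F V := Choice.on (@tensor_alg F V).

Section LockedOperations.
Variables (F : fieldType) (V : vectType F).

Local Notation malgV := {malg F[{fmonom 'I_(\dim {:V})}]}.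

Fact tensor_key : unit. Proof. by []. Qed.

Definition tensor_opp : tensor_alg V -> tensor_alg V :=
  locked_with tensor_key (-%R : malgV -> malgV).
Definition tensor_add : tensor_alg V -> tensor_alg V -> tensor_alg V :=
  locked_with tensor_key (+%R : malgV -> malgV -> malgV).
Definition tensor_mul : tensor_alg V -> tensor_alg V -> tensor_alg V :=
  locked_with tensor_key ( *%R : malgV -> malgV -> malgV).
Definition tensor_scale : F -> tensor_alg V -> tensor_alg V :=
  locked_with tensor_key ( *:%R : F -> malgV -> malgV).
Canonical tensor_opp_unlockable := [unlockable fun tensor_opp].
Canonical tensor_add_unlockable := [unlockable fun tensor_add].
Canonical tensor_mul_unlockable := [unlockable fun tensor_mul].
Canonical tensor_scale_unlockable := [unlockable fun tensor_scale].

Fact tensor_addA : associative tensor_add.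
Proof. by rewrite unlock; exact: addrA. Qed.
Fact tensor_addC : commutative tensor_add.
Proof. by rewrite unlock; exact: addrC. Qed.
Fact tensor_add0 : left_id (0 : malgV) tensor_add.
Proof. by rewrite unlock; exact: add0r. Qed.
Fact tensor_addN : left_inverse (0 : malgV) tensor_opp tensor_add.
Proof. by rewrite !unlock; exact: addNr. Qed.
HB.instance Definition _ := GRing.isZmodule.Build (tensor_alg V)
  tensor_addA tensor_addC tensor_add0 tensor_addN.

Fact tensor_mulA : associative tensor_mul.
Proof. by rewrite unlock; exact: mulrA. Qed.
Fact tensor_mul1 : left_id (1 : malgV) tensor_mul.
Proof. by rewrite unlock; exact: mul1r. Qed.
Fact tensor_mulr1 : right_id (1 : malgV) tensor_mul.
Proof. by rewrite unlock; exact: mulr1. Qed.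
Fact tensor_mulDl : left_distributive tensor_mul tensor_add.
Proof. by rewrite !unlock; exact: mulrDl. Qed.
Fact tensor_mulDr : right_distributive tensor_mul tensor_add.
Proof. by rewrite !unlock; exact: mulrDr. Qed.
Fact tensor_1neq0 : (1 : malgV) != 0 :> tensor_alg V.
Proof. exact: oner_neq0. Qed.
HB.instance Definition _ := GRing.Zmodule_isNzRing.Build (tensor_alg V)
  tensor_mulA tensor_mul1 tensor_mulr1 tensor_mulDl tensor_mulDr tensor_1neq0.

Fact tensor_scaleA a b t :
  tensor_scale a (tensor_scale b t) = tensor_scale (a * b) t.
Proof. by rewrite unlock; exact: scalerA. Qed.
Fact tensor_scale1 : left_id 1 tensor_scale.
Proof. by rewrite unlock; exact: scale1r. Qed.
Fact tensor_scaleDr : right_distributive tensor_scale tensor_add.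
Proof. by rewrite !unlock; exact: scalerDr. Qed.
Fact tensor_scaleDl t :
  {morph tensor_scale^~ t : a b / a + b >-> tensor_add a b}.
Proof. by rewrite !unlock => a b; exact: scalerDl. Qed.
HB.instance Definition _ := GRing.Zmodule_isLmodule.Build F (tensor_alg V)
  tensor_scaleA tensor_scale1 tensor_scaleDr tensor_scaleDl.

Fact tensor_scaleAl a s t :
  tensor_scale a (tensor_mul s t) = tensor_mul (tensor_scale a s) t.
Proof. by rewrite !unlock; exact: scalerAl. Qed.
HB.instance Definition _ := GRing.Lmodule_isLalgebra.Build F (tensor_alg V)
  tensor_scaleAl.

Fact tensor_scaleAr a s t :
  tensor_scale a (tensor_mul s t) = tensor_mul s (tensor_scale a t).
Proof. by rewrite !unlock; exact: malg_scaleAr. Qed.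
HB.instance Definition _ := GRing.Lalgebra_isAlgebra.Build F (tensor_alg V)
  tensor_scaleAr.

Lemma tensor_mulE (s t : tensor_alg V) : s * t = (s : malgV) * t.
Proof. by rewrite [LHS]/(tensor_mul s t) unlock. Qed.

Lemma mcoeff_tensorD m (s t : tensor_alg V) :
  mcoeff m (s + t) = mcoeff m s + mcoeff m t.
Proof. by rewrite [s + t]/(tensor_add s t) unlock mcoeffD. Qed.

Lemma mcoeff_tensorZ m a (t : tensor_alg V) : mcoeff m (a *: t) = a * mcoeff m t.
Proof. by rewrite [a *: t]/(tensor_scale a t) unlock mcoeffZ. Qed.

Lemma mcoeff_tensor_sum m (I : Type) (r : seq I) (P : pred I)
    (E : I -> tensor_alg V) :
  mcoeff m (\sum_(i <- r | P i) E i) = \sum_(i <- r | P i) mcoeff m (E i).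
Proof.
by elim/big_rec2: _ => [|i a t _ <-]; rewrite ?mcoeff0 ?mcoeff_tensorD.
Qed.

End LockedOperations.

Section TensorAlgebra.
Variables (F : fieldType) (V : vectType F).

Local Notation tensor_alg := (tensor_alg V).
Local Notation basisV := (vbasis {:V}).
Local Notation word := {fmonom 'I_(\dim {:V})}.

Definition tmon (m : word) : tensor_alg := << m >>.

Definition tgen (v : V) : tensor_alg :=
  \sum_i coord basisV i v *: tmon (fmu i).

Fact tgen_is_linear : linear tgen.
Proof.
move=> a u v; rewrite /tgen scaler_sumr -big_split; apply: eq_bigr => i _ /=.
by rewrite linearP scalerDl scalerA.
Qed.
HB.instance Definition _ := GRing.isLinear.Build F V tensor_alg _ tgen
  tgen_is_linear.

Lemma tmonM m n : tmon (mmul m n) = tmon m * tmon n.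
Proof. by rewrite [RHS]tensor_mulE malgM_def fgmulUU mulr1. Qed.

Lemma tmon1 : tmon mone = 1.
Proof. by []. Qed.

Lemma tgen_basis (i : 'I_(\dim {:V})) : tgen basisV`_i = tmon (fmu i).
Proof.
rewrite /tgen (bigD1 i) //= big1 => [|j ji].
  by rewrite coord_free ?eqxx ?scale1r ?addr0// (basis_free (vbasisP _)).
by rewrite coord_free ?(basis_free (vbasisP _))// eq_sym (negbTE ji) scale0r.
Qed.

Lemma tensor_expand (t : tensor_alg) :
  t = \sum_(m <- msupp t) mcoeff m t *: tmon m.
Proof.
apply/malgP => k; rewrite [in LHS](monalgE t) raddf_sum mcoeff_tensor_sum.
apply: eq_bigr => m _.
by rewrite mcoeff_tensorZ /= !mcoeffU mulr_natr.
Qed.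

Lemma tensor_ind (P : tensor_alg -> Prop) :
  P 0 -> (forall a m t, P t -> P (a *: tmon m + t)) -> forall t, P t.
Proof.
move=> P0 PS t; rewrite [t in P t]tensor_expand.
elim: (enum_fset (msupp t)) => [|m s IH]; first by rewrite big_nil.
by rewrite big_cons; apply: PS.
Qed.

End TensorAlgebra.

HB.lock Definition tensor_ext (F : fieldType) (V : vectType F) (W : lmodType F)
    (k : {fmonom 'I_(\dim {:V})} -> W) (t : tensor_alg V) : W :=
  \sum_(m <- msupp t) mcoeff m t *: k m.
Canonical tensor_ext_unlockable := Unlockable tensor_ext.unlock.

Section TensorUniversality.
Variables (F : fieldType) (V : vectType F).

Local Notation tensor_alg := (tensor_alg V).
Local Notation basisV := (vbasis {:V}).
Local Notation word := {fmonom 'I_(\dim {:V})}.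

Section LinearExtension.
Variables (W : lmodType F) (k : word -> W).

Local Notation tensor_ext := (tensor_ext k).

Lemma tensor_extEw (d : {fset word}) t : (msupp t `<=` d)%fset ->
  tensor_ext t = \sum_(m <- d) mcoeff m t *: k m.
Proof.
move=> le; rewrite unlock (big_fset_incl _ le) //= => m _ /mcoeff_outdom ->.
by rewrite scale0r.
Qed.

Fact tensor_ext_is_linear : linear tensor_ext.
Proof.
move=> a s t; pose d := (msupp (a *: s + t) `|` (msupp s `|` msupp t))%fset.
rewrite !(@tensor_extEw d) ?fsubsetUl//.
- rewrite scaler_sumr -big_split; apply: eq_bigr => m _ /=.
  by rewrite mcoeff_tensorD mcoeff_tensorZ scalerDl scalerA.
- exact: fsubset_trans (fsubsetUr _ _) (fsubsetUr _ _).
- exact: fsubset_trans (fsubsetUl _ _) (fsubsetUr _ _).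
Qed.
HB.instance Definition _ := GRing.isLinear.Build F tensor_alg W _ tensor_ext
  tensor_ext_is_linear.

Lemma tensor_ext_mon m : tensor_ext (tmon m) = k m.
Proof.
rewrite (@tensor_extEw [fset m]%fset) ?msuppU_le// big_seq_fset1.
by rewrite mcoeffUU scale1r.
Qed.

End LinearExtension.

(* The algebra morphism T(V) -> A extending the linear map f : V -> A. *)
Section Lift.
Variables (A : algType F) (f : V -> A).

Definition tensor_lift : tensor_alg -> A :=
  tensor_ext (fun m => \prod_(i <- m) f basisV`_i).
HB.instance Definition _ := GRing.Linear.on tensor_lift.

Fact tensor_lift_is_monoid_morphism : monoid_morphism tensor_lift.
Proof.
split; first by rewrite -tmon1 /tensor_lift tensor_ext_mon fm1 big_nil.
move=> s t; elim/tensor_ind: s => [|a m s IH].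
  by rewrite mul0r linear0 mul0r.
rewrite mulrDl !linearD /= IH mulrDl; congr (_ + _).
rewrite -scalerAl !linearZ /= -scalerAl; congr (_ *: _).
elim/tensor_ind: t {IH} => [|b n t IHt]; first by rewrite mulr0 linear0 mulr0.
rewrite mulrDr !linearD /= IHt mulrDr; congr (_ + _).
rewrite -scalerAr !linearZ /= -scalerAr -tmonM; congr (_ *: _).
by rewrite /tensor_lift !tensor_ext_mon fmM big_cat.
Qed.
HB.instance Definition _ :=
  GRing.isMonoidMorphism.Build tensor_alg A tensor_lift
    tensor_lift_is_monoid_morphism.

End Lift.

Lemma tensor_lift_gen (A : algType F) (f : {linear V -> A}) v :
  tensor_lift f (tgen v) = f v.
Proof.
rewrite [v in RHS](coord_vbasis (memvf v)) linear_sum /tgen linear_sum.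
apply: eq_bigr => i _; rewrite !linearZ /= /tensor_lift tensor_ext_mon.
by rewrite fmU big_seq1.
Qed.

Lemma tensor_lift_uniq (A : algType F) (f : V -> A)
    (k : {lrmorphism tensor_alg -> A}) :
  (forall v, k (tgen v) = f v) -> k =1 tensor_lift f.
Proof.
move=> kf t; elim/tensor_ind: t => [|a m t IH]; first by rewrite !linear0.
rewrite !linearD /= IH !linearZ /=; congr (_ *: _ + _).
rewrite /tensor_lift tensor_ext_mon /=; case: m => s.
elim: s => [|i s IHs]; first by rewrite big_nil -(rmorph1 k) -tmon1 /mone/= fmoneE.
rewrite big_cons -IHs -kf tgen_basis -rmorphM -tmonM; congr (k (tmon _)).
by apply/eqP; rewrite fmP fmM fmU.
Qed.

(* The derivation of T(V) extending the endomorphism f of V. *)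
Section Derivation.
Variable f : V -> V.

Fixpoint der_word (s : seq 'I_(\dim {:V})) : tensor_alg :=
  if s is i :: s' then
    tgen (f basisV`_i) * \prod_(j <- s') tgen basisV`_j
      + tgen basisV`_i * der_word s'
  else 0.

Definition tensor_der : tensor_alg -> tensor_alg := tensor_ext der_word.
HB.instance Definition _ := GRing.Linear.on tensor_der.

Lemma der_word_cat s1 s2 : der_word (s1 ++ s2) =
  der_word s1 * \prod_(j <- s2) tgen basisV`_j
    + (\prod_(j <- s1) tgen basisV`_j) * der_word s2.
Proof.
elim: s1 => [|i s IH] /=; first by rewrite big_nil mul0r mul1r add0r.
by rewrite IH big_cat big_cons /= mulrDl !mulrDr !mulrA addrA.
Qed.

Lemma tmonE (m : word) : tmon m = \prod_(j <- m) tgen basisV`_j.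
Proof.
case: m => s; elim: s => [|i s IH]; first by rewrite big_nil -tmon1 /mone/= fmoneE.
rewrite big_cons -IH tgen_basis -tmonM; congr tmon.
by apply/eqP; rewrite fmP fmM fmU.
Qed.

Lemma tensor_derM s t :
  tensor_der (s * t) = tensor_der s * t + s * tensor_der t.
Proof.
elim/tensor_ind: s => [|a m s IH]; first by rewrite mul0r linear0 !mul0r addr0.
rewrite mulrDl !linearD /= IH !mulrDl addrACA; congr (_ + _).
rewrite -!scalerAl !linearZ /= -!scalerAl -scalerDr; congr (_ *: _).
elim/tensor_ind: t {IH} => [|b n t IHt].
  by rewrite mulr0 linear0 !mulr0 addr0.
rewrite mulrDr !linearD /= IHt !mulrDr addrACA; congr (_ + _).
rewrite -!scalerAr !linearZ /= -!scalerAr -scalerDr; congr (_ *: _).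
by rewrite -tmonM /tensor_der !tensor_ext_mon fmM der_word_cat !tmonE.
Qed.

Lemma tensor_der1 : tensor_der 1 = 0.
Proof.
have /eqP := tensor_derM 1 1.
by rewrite !mul1r mulr1 addrC -subr_eq subrr eq_sym => /eqP.
Qed.

End Derivation.

Lemma tensor_der_gen (f : {linear V -> V}) v :
  tensor_der f (tgen v) = tgen (f v).
Proof.
rewrite [v in RHS](coord_vbasis (memvf v)) !linear_sum.
apply: eq_bigr => i _; rewrite !linearZ /= /tensor_der tensor_ext_mon.
by rewrite fmU /= big_nil mulr1 mulr0 addr0.
Qed.

End TensorUniversality.

Section Ideal.
Variables (F : fieldType) (T : algType F) (S : T -> Prop).

Inductive two_sided_ideal : T -> Prop :=
| Ideal0 : two_sided_ideal 0
| IdealD a s b u : S s -> two_sided_ideal u -> two_sided_ideal (a * s * b + u).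

Definition in_ideal (u : T) : bool := `[< two_sided_ideal u >].

Lemma in_idealP u : reflect (two_sided_ideal u) (u \in in_ideal).
Proof. exact: asboolP. Qed.

Lemma in_ideal0 : 0 \in in_ideal. Proof. exact/in_idealP/Ideal0. Qed.

Lemma in_idealD u v : u \in in_ideal -> v \in in_ideal -> u + v \in in_ideal.
Proof.
move=> /in_idealP Iu /in_idealP Iv; apply/in_idealP.
by elim: Iu => [|a s b w Ss _ IH]; rewrite ?add0r// -addrA; apply: IdealD.
Qed.

Lemma in_ideal_gen s : S s -> s \in in_ideal.
Proof.
move=> Ss; apply/in_idealP; rewrite -[s]mul1r -[1 * s]mulr1 -[_ * 1]addr0.
exact/IdealD/Ideal0.
Qed.

Lemma in_idealM a b u : u \in in_ideal -> a * u * b \in in_ideal.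
Proof.
move=> /in_idealP Iu; apply/in_idealP.
elim: Iu => [|a' s b' w Ss _ IH]; first by rewrite mulr0 mul0r; apply: Ideal0.
by rewrite mulrDr mulrDl !mulrA -!(mulrA _ b' b); apply: IdealD.
Qed.

Lemma in_idealMl a u : u \in in_ideal -> a * u \in in_ideal.
Proof. by move=> Iu; rewrite -[_ * _]mulr1 in_idealM. Qed.

Lemma in_idealMr a u : u \in in_ideal -> u * a \in in_ideal.
Proof. by move=> Iu; rewrite -[u]mul1r in_idealM. Qed.

Lemma in_idealZ a u : u \in in_ideal -> a *: u \in in_ideal.
Proof. by move=> Iu; rewrite -mulr_algl in_idealMl. Qed.

Fact in_ideal_zmod_closed : zmod_closed in_ideal.
Proof.
split=> [|u v Iu Iv]; first exact: in_ideal0.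
by rewrite in_idealD// -scaleN1r in_idealZ.
Qed.
HB.instance Definition _ := GRing.isZmodClosed.Build T in_ideal
  in_ideal_zmod_closed.

Lemma in_ideal_morph (A : algType F) (k : {lrmorphism T -> A}) :
  (forall s, S s -> k s = 0) -> forall u, u \in in_ideal -> k u = 0.
Proof.
move=> kS u /in_idealP; elim=> [|a s b v Ss _ IH]; first by rewrite rmorph0.
by rewrite rmorphD !rmorphM /= (kS _ Ss) IH mulr0 mul0r add0r.
Qed.

End Ideal.

(* Creation and annihilation matrices; they ensure that 1 != 0 in Cl(V).     *)
Lemma fermion_matrices (F : fieldType) n :
  exists m (a b : nat -> 'M[F]_m.+1),
    forall i j, (i < n)%N -> (j < n)%N ->
    [/\ a i *m a j + a j *m a i = 0, b i *m b j + b j *m b i = 0,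
        a i *m b j + b j *m a i = (i == j)%:R%:M,
        a i *m a i = 0 & b i *m b i = 0].
Proof.
elim: n => [|n [m [a [b ab]]]]; first by exists 0%N, (fun=> 0), (fun=> 0).
pose D (x : 'M[F]_m.+1) : 'M_(m.+1 + m.+1) := block_mx x 0 0 (- x).
pose U : 'M[F]_(m.+1 + m.+1) := block_mx 0 1%:M 0 0.
pose L : 'M[F]_(m.+1 + m.+1) := block_mx 0 0 1%:M 0.
have DD x y c : x *m y + y *m x = c%:M -> D x *m D y + D y *m D x = c%:M.
  move=> xy; rewrite !mulmx_block !(mul0mx, mulmx0, addr0, add0r).
  by rewrite add_block_mx !mulmxN !mulNmx !opprK addr0 xy scalar_mx_block.
have DD0 x y : x *m y + y *m x = 0 -> D x *m D y + D y *m D x = 0.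
  by move=> xy; rewrite (DD _ _ 0) ?xy ?raddf0.
have D20 x : x *m x = 0 -> D x *m D x = 0.
  move=> xx; rewrite mulmx_block !(mul0mx, mulmx0, addr0, add0r).
  by rewrite mulmxN mulNmx opprK xx block_mx0.
have DU x : D x *m U + U *m D x = 0.
  rewrite !mulmx_block !(mul0mx, mulmx0, addr0, add0r) add_block_mx.
  by rewrite mulmx1 mul1mx !addr0 subrr block_mx0.
have DL x : D x *m L + L *m D x = 0.
  rewrite !mulmx_block !(mul0mx, mulmx0, addr0, add0r) add_block_mx.
  by rewrite mulmx1 mul1mx !addr0 addNr block_mx0.
have UU : U *m U = 0.
  by rewrite mulmx_block !(mul0mx, mulmx0, addr0) block_mx0.
have LL : L *m L = 0.
  by rewrite mulmx_block !(mul0mx, mulmx0, addr0) block_mx0.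
have UL : U *m L + L *m U = 1%:M.
  rewrite !mulmx_block !(mul0mx, mulmx0, addr0, add0r) add_block_mx.
  by rewrite !mulmx1 !addr0 !add0r scalar_mx_block.
exists (m + m.+1)%N, (fun i => if (i < n)%N then D (a i) else U),
  (fun i => if (i < n)%N then D (b i) else L) => i j.
rewrite !ltnS => le_in le_jn.
case: (ltnP i n) => lt_in; case: (ltnP j n) => lt_jn.
- have [aa bb abij ai bi] := ab i j lt_in lt_jn.
  by split; auto.
- have [_ _ _ ai bi] := ab i i lt_in lt_in.
  rewrite (ltn_eqF (leq_trans lt_in lt_jn)) raddf0; split; auto.
- rewrite (gtn_eqF (leq_trans lt_jn lt_in)) raddf0.
  split; rewrite // addrC; auto.
- have -> : i = n by apply/eqP; rewrite eqn_leq le_in.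
  have -> : j = n by apply/eqP; rewrite eqn_leq le_jn.
  by rewrite eqxx; split; rewrite ?UU ?LL ?addr0.
Qed.

Section Clifford.
Variables (F : fieldType) (V : vectType F) (B : {symmetric V}).

Definition clifford_rel (t : tensor_alg V) :=
  exists x : V, t = tgen x * tgen x - (B x x)%:A.

Definition clifford_ideal : zmodClosed (tensor_alg V) :=
  Algebra.ZmodClosed.clone _ (in_ideal clifford_rel) _.

Definition clifford : Type := Quotient.quot clifford_ideal.
HB.instance Definition _ := GRing.Zmodule.on clifford.
HB.instance Definition _ := EqQuotient.on clifford.

Local Notation T := (tensor_alg V).
Local Notation I := (in_ideal clifford_rel).

Definition cl_proj : T -> clifford := \pi_clifford.

Lemma cl_projE s t : (cl_proj s == cl_proj t) = (s - t \in I).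
Proof. by rewrite /cl_proj -Quotient.idealrBE. Qed.

Lemma cl_proj_eq s t : s - t \in I -> cl_proj s = cl_proj t.
Proof. by move=> ?; apply/eqP; rewrite cl_projE. Qed.

Lemma cl_reprK u : cl_proj (repr u) = u.
Proof. exact: reprK. Qed.

Lemma cl_repr_proj t : repr (cl_proj t) - t \in I.
Proof. by rewrite -cl_projE cl_reprK. Qed.

Lemma cl_projD s t : cl_proj (s + t) = cl_proj s + cl_proj t.
Proof. by rewrite /cl_proj !piE. Qed.

Definition cl_one : clifford := cl_proj 1.
Definition cl_mul (u v : clifford) : clifford := cl_proj (repr u * repr v).
Definition cl_scale (a : F) (u : clifford) : clifford := cl_proj (a *: repr u).

Lemma cl_mulE s t : cl_mul (cl_proj s) (cl_proj t) = cl_proj (s * t).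
Proof.
apply: cl_proj_eq; set s' := repr _; set t' := repr _.
have -> : s' * t' - s * t = (s' - s) * t' + s * (t' - t).
  by rewrite mulrBl mulrBr addrA subrK.
by apply: in_idealD; [apply: in_idealMr|apply: in_idealMl]; apply: cl_repr_proj.
Qed.

Lemma cl_scaleE a t : cl_scale a (cl_proj t) = cl_proj (a *: t).
Proof. by apply: cl_proj_eq; rewrite -scalerBr in_idealZ// cl_repr_proj. Qed.

Lemma cl_ind (P : clifford -> Prop) : (forall t, P (cl_proj t)) -> forall u, P u.
Proof. by move=> PP u; rewrite -(cl_reprK u). Qed.

Fact cl_mulA : associative cl_mul.
Proof.
elim/cl_ind=> s; elim/cl_ind=> t; elim/cl_ind=> w.
by rewrite !cl_mulE mulrA.
Qed.

Fact cl_mul1 : left_id cl_one cl_mul.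
Proof. by elim/cl_ind=> t; rewrite cl_mulE mul1r. Qed.

Fact cl_mulr1 : right_id cl_one cl_mul.
Proof. by elim/cl_ind=> t; rewrite cl_mulE mulr1. Qed.

Fact cl_mulDl : left_distributive cl_mul +%R.
Proof.
elim/cl_ind=> s; elim/cl_ind=> t; elim/cl_ind=> w.
by rewrite -cl_projD !cl_mulE mulrDl cl_projD.
Qed.

Fact cl_mulDr : right_distributive cl_mul +%R.
Proof.
elim/cl_ind=> s; elim/cl_ind=> t; elim/cl_ind=> w.
by rewrite -cl_projD !cl_mulE mulrDr cl_projD.
Qed.

Fact cl_1neq0 : cl_one != 0.
Proof.
have -> : 0 = cl_proj 0 by rewrite /cl_proj piE.
rewrite cl_projE subr0; apply/negP => I1.
pose n := \dim {:V}; pose e (i : 'I_n) := (vbasis {:V})`_i.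
have [m [a [b ab]]] := fermion_matrices F n.
pose c (x : V) : 'M[F]_m.+1 := \sum_(i < n) coord (vbasis {:V}) i x *: b i.
pose d (x : V) : 'M[F]_m.+1 := \sum_(i < n) B x (e i) *: a i.
have c_lin : linear (fun x => c x + d x).
  move=> k x y; rewrite /c /d -!big_split scaler_sumr -big_split.
  apply: eq_bigr => i _ /=; rewrite linearP linearPl /= !scalerDl -!scalerA.
  by rewrite scalerDr addrACA.
have [f fE] : exists f : {linear V -> 'M[F]_m.+1}, forall x, f x = c x + d x.
  by exists (HB.pack_for {linear V -> 'M[F]_m.+1} (fun x => c x + d x)
               (GRing.isLinear.Build F V 'M[F]_m.+1 _ _ c_lin)).
have sum0 (G : 'I_n -> 'M[F]_m.+1) (p : 'I_n -> F) :
    (forall i j, G i * G j + G j * G i = 0) -> (forall i, G i * G i = 0) ->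
    (\sum_i p i *: G i) * (\sum_i p i *: G i) = 0.
  move=> GG G2; elim: (index_enum _) => [|i r IH]; first by rewrite big_nil mul0r.
  rewrite big_cons; set X := \sum_(j <- r) _ in IH *.
  have GX : G i * X + X * G i = 0.
    rewrite mulr_sumr mulr_suml -big_split big1 // => k _ /=.
    by rewrite -scalerAr -scalerAl -scalerDr GG scaler0.
  rewrite mulrDl !mulrDr IH addr0 -!scalerAl -!scalerAr G2 !scaler0 add0r.
  by rewrite -scalerDr GX scaler0.
suff: tensor_lift f 1 = 0 by rewrite rmorph1; apply/eqP/oner_neq0.
apply: in_ideal_morph I1 => _ [x ->].
rewrite rmorphB rmorphM /= linearZ /= rmorph1 tensor_lift_gen fE.
have ab' (i j : 'I_n) := ab i j (ltn_ord i) (ltn_ord j).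
rewrite mulrDl !mulrDr sum0 => [|i j|i]; last 2 first.
- by have [] := ab' i j.
- by have [] := ab' i i.
rewrite sum0 => [|i j|i]; last 2 first.
- by have [] := ab' i j.
- by have [] := ab' i i.
have bd (i : 'I_n) : b i * d x + d x * b i = (B x (e i))%:A.
  rewrite /d mulr_sumr mulr_suml -big_split (bigD1 i) //= big1 ?addr0 => [|j ji].
    rewrite -scalerAr -scalerAl -scalerDr addrC.
    by have [_ _ + _ _] := ab' i i; rewrite eqxx => ->.
  rewrite -scalerAr -scalerAl -scalerDr addrC.
  have [_ _ + _ _] := ab' j i; rewrite (inj_eq val_inj) (negbTE ji) => ->.
  by rewrite -scalemx1 scale0r scaler0.
have Bxx : B x x = \sum_i coord (vbasis {:V}) i x * B x (e i).
  rewrite [X in B x X](coord_vbasis (memvf x)) linear_sumr.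
  by apply: eq_bigr => i _; rewrite linearZr_LR.
rewrite add0r addr0 Bxx scaler_suml /c mulr_suml mulr_sumr -big_split -sumrB.
rewrite big1 // => i _ /=; rewrite -scalerAl -scalerAr -scalerDr bd scalerA.
by rewrite subrr.
Qed.

HB.instance Definition _ := GRing.Zmodule_isNzRing.Build clifford
  cl_mulA cl_mul1 cl_mulr1 cl_mulDl cl_mulDr cl_1neq0.

Fact cl_scaleA a b u : cl_scale a (cl_scale b u) = cl_scale (a * b) u.
Proof. by elim/cl_ind: u => t; rewrite !cl_scaleE scalerA. Qed.

Fact cl_scale1 : left_id 1 cl_scale.
Proof. by elim/cl_ind=> t; rewrite cl_scaleE scale1r. Qed.

Fact cl_scaleDr : right_distributive cl_scale +%R.
Proof.
move=> a; elim/cl_ind=> s; elim/cl_ind=> t.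
by rewrite -cl_projD !cl_scaleE scalerDr cl_projD.
Qed.

Fact cl_scaleDl u : {morph cl_scale^~ u : a b / a + b}.
Proof.
by elim/cl_ind: u => t a b; rewrite !cl_scaleE scalerDl cl_projD.
Qed.
HB.instance Definition _ := GRing.Zmodule_isLmodule.Build F clifford
  cl_scaleA cl_scale1 cl_scaleDr cl_scaleDl.

Fact cl_scaleAl a u v : cl_scale a (cl_mul u v) = cl_mul (cl_scale a u) v.
Proof.
elim/cl_ind: u => s; elim/cl_ind: v => t.
by rewrite cl_mulE 2!cl_scaleE cl_mulE scalerAl.
Qed.
HB.instance Definition _ := GRing.Lmodule_isLalgebra.Build F clifford cl_scaleAl.

Fact cl_scaleAr a u v : cl_scale a (cl_mul u v) = cl_mul u (cl_scale a v).
Proof.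
elim/cl_ind: u => s; elim/cl_ind: v => t.
by rewrite cl_mulE 2!cl_scaleE cl_mulE scalerAr.
Qed.
HB.instance Definition _ := GRing.Lalgebra_isAlgebra.Build F clifford cl_scaleAr.

Fact cl_proj_is_linear : linear cl_proj.
Proof. by move=> a s t; rewrite cl_projD -cl_scaleE. Qed.
Fact cl_proj_is_monoid_morphism : monoid_morphism cl_proj.
Proof. by split=> // s t; rewrite -cl_mulE. Qed.
HB.instance Definition _ := GRing.isLinear.Build F T clifford _ cl_proj
  cl_proj_is_linear.
HB.instance Definition _ := GRing.isMonoidMorphism.Build T clifford cl_proj
  cl_proj_is_monoid_morphism.

Definition cl_gen (x : V) : clifford := cl_proj (tgen x).

Fact cl_gen_is_linear : linear cl_gen.
Proof. by move=> a x y; rewrite /cl_gen !linearP. Qed.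
HB.instance Definition _ := GRing.isLinear.Build F V clifford _ cl_gen
  cl_gen_is_linear.

Lemma cl_gen_sqr x : cl_gen x * cl_gen x = (B x x)%:A.
Proof.
rewrite /cl_gen -rmorphM -(rmorph1 cl_proj) -linearZ; apply: cl_proj_eq.
by apply: in_ideal_gen; exists x.
Qed.

Lemma cl_gen_anticomm x y :
  cl_gen x * cl_gen y + cl_gen y * cl_gen x = (B x y + B y x)%:A.
Proof.
have := cl_gen_sqr (x + y); rewrite linearD mulrDl !mulrDr !cl_gen_sqr.
rewrite linearDl !linearDr !scalerDl -!addrA => /addrI.
by rewrite !addrA => /addIr.
Qed.

(* [cl_parity false] and [cl_parity true] are the even and the odd part.      *)
Definition cl_parity (p : bool) (u : clifford) : Prop :=
  exists2 t : T, (forall m, m \in msupp t -> odd (size m) = p) & u = cl_proj t.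

(* The algebra morphism Cl(V) -> A extending f : V -> A; it is well defined,  *)
(* hence a morphism, when f satisfies the Clifford relations (see below).     *)
Section Lift.
Variable A : algType F.

Definition cl_lift (f : V -> A) (u : clifford) : A := tensor_lift f (repr u).

Variable f : {linear V -> A}.
Hypothesis fB : forall x, f x * f x = (B x x)%:A.

Lemma cl_lift_proj t : cl_lift f (cl_proj t) = tensor_lift f t.
Proof.
apply/eqP; rewrite -subr_eq0 -linearB; apply/eqP.
apply: in_ideal_morph (cl_repr_proj t) => _ [x ->].
by rewrite rmorphB rmorphM /= linearZ /= rmorph1 tensor_lift_gen fB subrr.
Qed.

Lemma cl_lift_gen x : cl_lift f (cl_gen x) = f x.
Proof. by rewrite cl_lift_proj tensor_lift_gen. Qed.

Lemma cl_lift_is_linear : linear (cl_lift f).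
Proof.
move=> a; elim/cl_ind=> s; elim/cl_ind=> t.
by rewrite -linearP !cl_lift_proj linearP.
Qed.

Lemma cl_lift_is_monoid_morphism : monoid_morphism (cl_lift f).
Proof.
split=> [|]; first by rewrite -(rmorph1 cl_proj) cl_lift_proj rmorph1.
elim/cl_ind=> s; elim/cl_ind=> t.
by rewrite -rmorphM !cl_lift_proj rmorphM.
Qed.

End Lift.

Lemma cl_lift_uniq (A : algType F) (f : V -> A) (k : {lrmorphism clifford -> A}) :
  (forall x, k (cl_gen x) = f x) -> k =1 cl_lift f.
Proof.
move=> kf u; rewrite -[in LHS](cl_reprK u).
exact: (@tensor_lift_uniq _ _ _ f (k \o cl_proj)).
Qed.

(* The derivation of Cl(V) extending f : V -> V; it is well defined, hence a  *)
(* derivation, when f is skew-symmetric for B (see below).                    *)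
Section Derivation.

Definition cl_der (f : V -> V) (u : clifford) : clifford :=
  cl_proj (tensor_der f (repr u)).

Variable f : {linear V -> V}.
Hypothesis f_skew : forall x y, B (f x) y = - B x (f y).

Lemma cl_der_proj t : cl_der f (cl_proj t) = cl_proj (tensor_der f t).
Proof.
apply/eqP; rewrite -subr_eq0 -!linearB; apply/eqP.
have /in_idealP := cl_repr_proj t.
elim=> [|a _ b u [x ->] Iu IH]; first by rewrite !linear0.
have r0 : cl_proj (tgen x * tgen x - (B x x)%:A) = 0.
  rewrite linearB rmorphM linearZ rmorph1 /=.
  by apply/eqP; rewrite subr_eq0 -cl_gen_sqr.
have dr0 : cl_proj (tensor_der f (tgen x * tgen x - (B x x)%:A)) = 0.
  rewrite linearB /= tensor_derM linearZ /= tensor_der1 scaler0 subr0.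
  rewrite tensor_der_gen linearD !rmorphM /=.
  by rewrite -!/(cl_gen _) cl_gen_anticomm f_skew addNr scale0r.
move: (_ - _) r0 dr0 => r r0 dr0.
rewrite !linearD /= IH addr0 !tensor_derM linearD /= !rmorphM /=.
by rewrite ?linearD /= ?rmorphM /= r0 dr0 !(mulr0, mul0r, addr0).
Qed.

Lemma cl_der_gen x : cl_der f (cl_gen x) = cl_gen (f x).
Proof. by rewrite cl_der_proj tensor_der_gen. Qed.

Lemma cl_der_is_linear : linear (cl_der f).
Proof.
move=> a; elim/cl_ind=> s; elim/cl_ind=> t.
by rewrite -linearP !cl_der_proj !linearP.
Qed.

Lemma cl_derM u v : cl_der f (u * v) = cl_der f u * v + u * cl_der f v.
Proof.
elim/cl_ind: u => s; elim/cl_ind: v => t.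
by rewrite -rmorphM !cl_der_proj tensor_derM linearD /= !rmorphM.
Qed.

End Derivation.

End Clifford.
Arguments cl_parity {F V} B p u.

Section Restriction.
Variables (F : fieldType) (V : vectType F) (B : {symmetric V}) (U : {vspace V}).

Definition restr_form (x y : subvs_of U) : F := B (vsval x) (vsval y).

Fact restr_form_zmodl y : zmod_morphism (restr_form^~ y).
Proof. by move=> x x'; rewrite /restr_form linearB linearBl. Qed.
Fact restr_form_zmodr x : zmod_morphism (restr_form x).
Proof. by move=> y y'; rewrite /restr_form !raddfB. Qed.
Fact restr_form_scalel y : scalable_for *%R (restr_form^~ y).
Proof. by move=> a x; rewrite /restr_form linearZ linearZl_LR. Qed.
Fact restr_form_scaler x : scalable_for (idfun \; *%R) (restr_form x).
Proof. by move=> a y; rewrite /restr_form !linearZ_LR. Qed.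
HB.instance Definition _ := isBilinear.Build F (subvs_of U) (subvs_of U) F
  *%R (idfun \; *%R) restr_form
  restr_form_zmodl restr_form_zmodr restr_form_scalel restr_form_scaler.

Fact restr_form_sym x y :
  restr_form x y = (-1) ^+ false * idfun (restr_form y x).
Proof. exact: hermC. Qed.
HB.instance Definition _ := isHermitianSesquilinear.Build F (subvs_of U)
  false idfun restr_form restr_form_sym.

(* The canonical morphism Cl(U) -> Cl(V).                                     *)
Definition cl_incl : clifford restr_form -> clifford B :=
  cl_lift (fun x => cl_gen B (vsval x)).

Lemma cl_incl_gen x : cl_incl (cl_gen restr_form x) = cl_gen B (vsval x).
Proof.
pose f := GRing.Linear.clone _ _ _ _ (cl_gen B \o @vsval F V U) _.
by apply: (@cl_lift_gen _ _ _ _ f) => y; apply: cl_gen_sqr.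
Qed.

End Restriction.
Arguments restr_form {F V} B U x y.

(* The algebra morphism Cl(V) -> F killing V, when the form of V vanishes.    *)
Definition cl_aug (F : fieldType) (V : vectType F) (B : {symmetric V}) :
  clifford B -> F^o := cl_lift (fun=> 0).

Section HarishChandra.
Variables (F : fieldType) (g : lieAlgType F) (B : {symmetric g}).

Definition cl_invariant (u : clifford B) := forall x : g, cl_der (lie x) u = 0.

Definition is_harish_chandra (h b : {vspace g})
    (Phi : clifford B -> clifford (restr_form B h)) :=
  forall (u : clifford (restr_form B (nminus h b)))
         (v : clifford (restr_form B h))
         (w : clifford (restr_form B (nplus h b))),
    Phi (cl_incl u * cl_incl v * cl_incl w) = (cl_aug u * cl_aug w : F) *: v.

End HarishChandra.
Arguments cl_invariant {F g} B u.
Arguments is_harish_chandra {F g B h} b Phi.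

(* f restricts to an isomorphism of superalgebras from the subalgebra D of A  *)
(* onto B; parA p and parB p are the homogeneous parts of parity p.           *)
Record superalgebra_iso_on (F : fieldType) (A B : algType F)
    (parA : bool -> A -> Prop) (parB : bool -> B -> Prop)
    (D : A -> Prop) (f : {linear A -> B}) : Prop := SuperalgebraIsoOn {
  superalgebra_iso1 : f 1 = 1;
  superalgebra_isoM : forall u v, D u -> D v -> f (u * v) = f u * f v;
  superalgebra_iso_parity :
    forall p u, D u -> (parA p u <-> parB p (f u));
  superalgebra_iso_inj : forall u v, D u -> D v -> f u = f v -> u = v;
  superalgebra_iso_surj : forall v, exists2 u, D u & f u = v
}.

(* Main.v *)
(* Let e_i, f_i be dual root vectors for the positive roots, and let p be the *)
(* product of the commuting idempotents e_i f_i / 2 of Cl(g). It commutes     *)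
(* with Cl(h), e_i p = p f_i = 0, and Phi(u) is the element w of Cl(h) such   *)
(* that p u p = w p.                                                          *)
(*                                                                            *)
(* The spin map s(x) = 1/4 sum_a [x, u_a] v_a (for dual bases u, v of g)      *)
(* implements the adjoint action, so that the invariants are the commutant    *)
(* of s(g). The vector p has highest weight rho for s, and the Casimir        *)
(* element of s commutes with Cl(g); comparing its values on p and on f_j p   *)
(* shows, by induction on the height of the root of f_j, that Cl(g) p is      *)
(* generated by Cl(h) p under s(g). If A is the algebra generated by s(g),    *)
(* then p A p consists of the scalar multiples of p. Hence an invariant u     *)
(* satisfies u p = p u p, which makes Phi multiplicative and injective on     *)
(* invariants. As Cl(g) is simple as a superalgebra, 1 = sum_ij x_ij a_i p a_j *)
(* with a_i in A, and sum_ij x_ij a_i w p a_j is an invariant mapped to w.    *)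
(*                                                                            *)
(* The root space decomposition needed for this is obtained from traces of    *)
(* commutators on sums of weight spaces, and the positive roots of a Borel    *)
(* subalgebra b containing h are those whose root space lies in b: no         *)
(* nonempty sum of them vanishes since b is solvable, and every root is       *)
(* positive or negative since b is maximal.                                   *)

Require Import Defs.
From HB Require Import structures.
From mathcomp Require Import all_boot all_order all_algebra.
From mathcomp Require Import boolp classical_sets reals.
From mathcomp Require Import complex finmap monalg.
From mathcomp Require Import ring.

Set Implicit Arguments.
Unset Strict Implicit.
Unset Printing Implicit Defensive.

Import GRing.Theory.

Local Open Scope ring_scope.

(** * The spin representation and the Casimir element *)

(** Let [e_i], [f_i] be dual root vectors for the positive and negative roots, p the product of the
    commuting idempotents [e_i f_i / 2], and s the spin map. The idempotent p turns the
    Harish-Chandra map into a compression: n_+ kills p on the left, n_- kills it on the right, and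
    Cl(h) commutes with it, so p u p = Phi(u) p, where w p determines w in Cl(h) ([jp_inj]). On the
    other side, commutation with s(x) is the derivation theta(x) ([cl_der_spin]), so the invariants
    are the commutant of the algebra A generated by s(g). The theorem compares this commutant with
    the compression by p.

    Three facts carry the comparison. First, Cl(g) p = A Cl(h) p and p Cl(g) = p Cl(h) A
    ([tri_gen_left], [tri_gen_right]). Indeed the Casimir element of s commutes with Cl(g)
    ([casimir_comm]), and its values on the weights rho and rho - alpha differ by 4 (rho, alpha) -
    (alpha, alpha), which is nonzero ([tri_regular]); so f_alpha p is recovered from the vectors
    s(f_i) s(e_i) f_alpha p, and s(e_i) f_alpha p involves only h and negative roots of smaller
    height ([gen_left_f]). Second, p A p consists of multiples of p, since p is a highest weight
    vector ([spin_alg_p]). Third, Cl(g) p Cl(g) contains 1 ([p_ideal1]), since a non-degenerate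
    Clifford algebra is simple as a superalgebra ([cl_supersimple]).

    If u is invariant, u p - p u p is killed on the left by p A, hence by p Cl(g), hence is 0. So u
    p = Phi(u) p ([commutes_wp]), which makes Phi multiplicative on invariants and, by the first and
    third facts, injective. For surjectivity, the pairing p a a' p on A has a Gram matrix; a
    generalized inverse x of it gives 1 = sum x_ij a_i p a_j, and sum x_ij a_i w p a_j is an
    invariant with image w ([commutes_surj]).

    The root data come from one trace identity: if x and y preserve a sum of weight spaces and t =
    [x, y] lies in h, the sum of alpha(t) times the dimension of the space of weight alpha is 0
    ([trace_formula]). It gives the real ratios of weights ([string_rational]), the vanishing of the
    radical of the Killing form ([radical0]), the commutativity of h, and one-dimensional root
    spaces ([root_dim1]). For the Borel subalgebra, solvability excludes vanishing sums of positive
    roots ([pos_sums0]), and maximality makes every root positive or negative ([pos_total]). *)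

Section LinearMaps.
Variables (F : fieldType) (U V : lmodType F) (f : U -> V).
Hypothesis lin_f : linear f.

Lemma lin0 : f 0 = 0.
Proof. by have := lin_f (-1) 0 0; rewrite scaler0 addr0 scaleN1r addNr. Qed.

Lemma lin_sum (I : finType) (k : I -> F) (x : I -> U) :
  f (\sum_a k a *: x a) = \sum_a k a *: f (x a).
Proof.
by elim/big_rec2: _ => [|a y1 y2 _ IH]; rewrite ?lin0 ?lin_f ?IH.
Qed.

Lemma lin_opp x : f (- x) = - f x.
Proof.
by have := lin_f (-1) x 0; rewrite !addr0 lin0 addr0 !scaleN1r.
Qed.

End LinearMaps.

Section CliffordRelation.
Variables (F : fieldType) (V : vectType F) (B : {symmetric V}).

Lemma Bsym x y : B x y = B y x.
Proof. by rewrite hermC /= expr0 mul1r. Qed.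

Variables (A : algType F) (c : {linear V -> A}).
Hypothesis cB : forall x y, c x * c y + c y * c x = (B x y *+ 2)%:A.

Lemma cl_swap x y : c x * c y = (B x y *+ 2)%:A - c y * c x.
Proof. by rewrite -cB addrK. Qed.

Lemma cl_swap0 x y : B x y = 0 -> c x * c y = - (c y * c x).
Proof. by move=> h; rewrite cl_swap h mul0rn scale0r sub0r. Qed.

End CliffordRelation.

Section CasimirTensor.
Variables (F : numFieldType) (g : lieAlgType F) (B : {symmetric g}).
Hypothesis Binv : ad_invariant B.

Lemma lieC (x y : g) : lie x y = - lie y x.
Proof.
apply/eqP; rewrite -subr_eq0 opprK; apply/eqP.
have := liexx (x + y); rewrite linearDl /= !linearDr /= !liexx.
by rewrite add0r addr0.
Qed.

Lemma lie0 (x : g) : lie x 0 = 0. Proof. by rewrite linear0r. Qed.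
Lemma lie0l (x : g) : lie 0 x = 0. Proof. by rewrite linear0l. Qed.

Lemma lie_lie (x y z : g) : lie x (lie y z) = lie (lie x y) z + lie y (lie x z).
Proof.
have := lie_jacobi x y z; rewrite (lieC z (lie x y)) (lieC z x) linearNr.
by move/eqP; rewrite -addrA addr_eq0 -opprD opprK addrC => /eqP.
Qed.

Lemma lie_lier (x y z : g) : lie (lie x y) z = lie (lie x z) y + lie x (lie y z).
Proof. by rewrite (lie_lie x y z) (lieC y) addrCA subrr addr0. Qed.

Lemma lie_skew x y z : B (lie x y) z = - B y (lie x z).
Proof. by rewrite lieC linearNl /= Binv. Qed.

Variables (I : finType) (u v : I -> g).
Hypothesis uvE : forall x, \sum_a B x (v a) *: u a = x.
Hypothesis vuE : forall x, \sum_a B x (u a) *: v a = x.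

Section Bilinear.
Variables (W : lmodType F) (G : g -> g -> W).
Hypotheses (Gl : forall y, linear (G^~ y)) (Gr : forall x, linear (G x)).

(** The canonical tensor, the sum of [u a] tensor [v a], is symmetric because [B] is; [G] evaluates
    it. *)
Lemma cas_swap : \sum_a G (u a) (v a) = \sum_a G (v a) (u a).
Proof.
under eq_bigr => a _ do rewrite -{1}(vuE (u a)) (lin_sum (Gl _)).
rewrite exchange_big /=; apply: eq_bigr => b _.
rewrite -[in RHS](vuE (u b)) (lin_sum (Gr _)).
by apply: eq_bigr => a _; rewrite (Bsym B (u a)).
Qed.

(** The canonical tensor is invariant because [ad x] is skew for [B]. This moves a bracket from one
    leg to the other. *)
Lemma cas_inv x : \sum_a G (lie x (u a)) (v a) = - \sum_a G (u a) (lie x (v a)).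
Proof.
under eq_bigr => a _ do rewrite -{1}(uvE (lie x (u a))) (lin_sum (Gl _)).
rewrite exchange_big /= -sumrN; apply: eq_bigr => b _.
rewrite -[in RHS](vuE (lie x (v b))) (lin_sum (Gr _)) -sumrN.
by apply: eq_bigr => a _; rewrite (lie_skew x (u a)) scaleNr (Bsym B (u a)).
Qed.

End Bilinear.

Section CliffordMap.
Variables (A : algType F) (c : {linear g -> A}).
Hypothesis cB : forall x y, c x * c y + c y * c x = (B x y *+ 2)%:A.

(** The factor 1/4 is forced by [spin_comm]: the commutator of a product of two generators with a
    third has two terms, each with a factor 2 from the Clifford relation, and after summation both
    equal [c (lie x y)]. *)
Definition spin (x : g) : A := 4^-1 *: \sum_a c (lie x (u a)) * c (v a).

Lemma spin_linear : linear spin.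
Proof.
move=> k x y; rewrite /spin scalerA (mulrC k) -scalerA -scalerDr; congr (_ *: _).
rewrite scaler_sumr -big_split; apply: eq_bigr => a _ /=.
by rewrite lie_linearl linearP mulrDl -scalerAl.
Qed.
HB.instance Definition _ := GRing.isLinear.Build F g A _ spin spin_linear.

Lemma cl_quadratic_comm x y z : c x * c y * c z - c z * (c x * c y) =
  (B y z *+ 2) *: c x - (B x z *+ 2) *: c y.
Proof.
rewrite -mulrA (cl_swap cB y z) mulrBr mulr_algr.
rewrite [c x * (c z * _)]mulrA (cl_swap cB x z) mulrBl mulr_algl.
by rewrite opprB !mulrA -addrA [_ - _ - _]addrAC subrr sub0r.
Qed.

Lemma spin_comm x y : spin x * c y - c y * spin x = c (lie x y).
Proof.
rewrite /spin -scalerAl -scalerAr -scalerBr mulr_suml mulr_sumr -sumrB.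
under eq_bigr => a _ do rewrite cl_quadratic_comm.
rewrite sumrB.
have -> : \sum_a (B (v a) y *+ 2) *: c (lie x (u a)) = c (lie x y) *+ 2.
  rewrite -{2}(uvE y) linear_sumr linear_sum -sumrMnl; apply: eq_bigr => a _ /=.
  by rewrite linearZr_LR linearZ /= (Bsym B y) scalerMnl.
have -> : \sum_a (B (lie x (u a)) y *+ 2) *: c (v a) = - (c (lie x y) *+ 2).
  rewrite -{1}(vuE (lie x y)) linear_sum -mulNrn -sumrN -sumrMnl.
  apply: eq_bigr => a _ /=.
  by rewrite linearZ /= lie_skew (Bsym B _ (u a)) -scalerMnl scaleNr.
rewrite opprK -mulrnDr -scaler_nat scalerA mulVf ?scale1r//.
by rewrite Num.Theory.pnatr_eq0.
Qed.

(** Bracketing with [spin x] is a derivation acting as [ad x] on generators. Apply it to both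
    factors of [spin y] and move [ad x] off the second factor by invariance; Jacobi finishes. *)
Lemma spin_lie x y : spin (lie x y) = spin x * spin y - spin y * spin x.
Proof.
have -> : spin x * spin y - spin y * spin x =
  4^-1 *: \sum_a (c (lie x (lie y (u a))) * c (v a)
                + c (lie y (u a)) * c (lie x (v a))).
  rewrite [spin y]/spin -(scalerAr _ (spin x)) -(scalerAl _ _ (spin x)) -scalerBr
    mulr_sumr mulr_suml -sumrB.
  congr (_ *: _); apply: eq_bigr => a _; rewrite -!(spin_comm x).
  by rewrite mulrBl mulrBr !mulrA addrA subrK.
rewrite /spin; congr (_ *: _); rewrite big_split /=.
set S := \sum_a c (lie y (u a)) * c (lie x (v a)).
have -> : S = - \sum_a c (lie y (lie x (u a))) * c (v a).
  rewrite (@cas_inv _ (fun p q => c (lie y p) * c q)) ?opprK//.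
    by move=> q k p p'; rewrite lie_linearr linearP mulrDl -scalerAl.
  by move=> p k q q'; rewrite linearP mulrDr -scalerAr.
rewrite -sumrB; apply: eq_bigr => a _.
by rewrite -mulrBl -linearB (lie_lie x) addrK.
Qed.

Definition casimir : A := \sum_a spin (u a) * spin (v a).

(** Three arrangements of one cubic expression. The commutator of the Casimir element with [c y] is
    a quarter of [cub_r y + cub_l y]; Jacobi makes this sum [- cyc y], while reordering factors
    makes it [2 cyc y], so everything vanishes. *)
Let cyc y := \sum_a \sum_b c (lie (u a) (u b)) * c (lie (v b) y) * c (v a).

Let cub_r y := \sum_a \sum_b c (lie (u a) (u b)) * c (v b) * c (lie (v a) y).
Let cub_l y := \sum_a \sum_b c (lie (v a) y) * (c (lie (u a) (u b)) * c (v b)).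

Lemma cub_sum y : cub_r y + cub_l y = - cyc y.
Proof.
(* Invariance in the index a carries the bracket with [u b] to the other leg, so that the nested
   bracket with [y] appears and Jacobi can split it. *)
have -> : cub_l y = \sum_a \sum_b c (lie (lie (u a) (u b)) y) * c (v b) * c (v a).
  rewrite /cub_l [LHS]exchange_big /=; apply: eq_bigr => b _.
  pose H p q := c (lie p y) * (c q * c (v b)).
  have Hl q : linear (H^~ q).
    by move=> k p p'; rewrite /H lie_linearl linearP mulrDl -scalerAl.
  have Hr p : linear (H p).
    by move=> k q q'; rewrite /H linearP mulrDl mulrDr -scalerAl -scalerAr.
  transitivity (- \sum_a H (v a) (lie (u b) (u a))).
    rewrite -sumrN; apply: eq_bigr => a _.
    by rewrite -(lin_opp (Hr _)) -lieC.
  rewrite -(@cas_swap _ (fun p q => H p (lie (u b) q))); first last.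
  - by move=> p k q q'; rewrite lie_linearr Hr.
  - by move=> q k p p'; rewrite Hl.
  rewrite -cas_inv //; apply: eq_bigr => a _.
  by rewrite /H mulrA.
rewrite [X in _ + X](_ : _ = (\sum_a \sum_b c (lie (lie (u a) y) (u b)) * c (v b) *
  c (v a))
   + \sum_a \sum_b c (lie (u a) (lie (u b) y)) * c (v b) * c (v a)); last first.
  rewrite -big_split; apply: eq_bigr => a _; rewrite -big_split.
  by apply: eq_bigr => b _ /=; rewrite -!mulrDl -linearD -lie_lier.
have -> : \sum_a \sum_b c (lie (u a) (lie (u b) y)) * c (v b) * c (v a) = - cyc y.
  rewrite /cyc -sumrN; apply: eq_bigr => a _.
  transitivity (- \sum_b c (lie (u a) (lie y (u b))) * c (v b) * c (v a)).
    rewrite -sumrN; apply: eq_bigr => b _.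
    by rewrite (lieC _ y) linearNr linearN !mulNr.
  rewrite (@cas_inv _ (fun p q => c (lie (u a) p) * c q * c (v a))); first last.
  - by move=> p k q q'; rewrite linearP mulrDr mulrDl -scalerAr -scalerAl.
  - by move=> q k p p'; rewrite lie_linearr linearP !mulrDl -!scalerAl.
  rewrite opprK -sumrN; apply: eq_bigr => b _.
  by rewrite (lieC y) linearN mulrN mulNr.
rewrite addrA -[RHS]add0r; congr (_ + _).
rewrite /cub_r exchange_big [X in _ + X]exchange_big -big_split big1 // => b _ /=.
under eq_bigr => a _ do rewrite (lieC (v a)) linearN mulrN.
under [X in _ + X]eq_bigr => a _ do
  rewrite (lieC (u a) y) linearNl linearN !mulNr.
rewrite !sumrN (@cas_inv _ (fun p q => c (lie p (u b)) * c (v b) * c q)) ?opprK ?addNr//.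
  by move=> q k p p'; rewrite lie_linearl linearP !mulrDl -!scalerAl.
by move=> p k q q'; rewrite linearP mulrDr -scalerAr.
Qed.

(** Interchanging the last two factors costs an anticommutator, which sums to the linear term. In
    [cub_l_cyc] the first two factors are interchanged, and the linear term is the opposite one. *)
Lemma cub_r_cyc y :
  cyc y = cub_r y + (\sum_b c (lie (lie (v b) y) (u b))) *+ 2.
Proof.
rewrite /cyc /cub_r [LHS]exchange_big /= -sumrMnl -big_split.
apply: eq_bigr => b _ /=.
rewrite -{3}(uvE (lie (v b) y)) linear_sumlz linear_sum -sumrMnl -big_split.
apply: eq_bigr => a _ /=.
rewrite -[LHS]mulrA (cl_swap cB (lie (v b) y)) mulrBr mulr_algr [RHS]addrC; congr (_ + _).
  by rewrite linearZl_LR linearZ /= scalerMnl.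
by rewrite (lieC (u a)) linearN mulNr opprK mulrA.
Qed.

Lemma cub_l_cyc y :
  cyc y = cub_l y + (\sum_b c (lie (u b) (lie (v b) y))) *+ 2.
Proof.
rewrite /cyc /cub_l exchange_big [X in X + _]exchange_big /= -sumrMnl.
rewrite [X in _ + X](_ : _ = \sum_a \sum_b
    (B (lie (u b) (u a)) (lie (v a) y) *+ 2) *: c (v b)); last first.
  apply: eq_bigr => a _.
  rewrite -{1}(vuE (lie (u a) (lie (v a) y))) linear_sum -sumrMnl.
  apply: eq_bigr => b _ /=.
  by rewrite linearZ /= scalerMnl (Binv (u b)) (Bsym B (u b)).
rewrite exchange_big [X in _ + X]exchange_big -big_split.
apply: eq_bigr => b _ /=; rewrite -big_split; apply: eq_bigr => a _ /=.
rewrite (cl_swap cB (lie (u b) (u a))) mulrBl mulr_algl addrC; congr (_ + _).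
by rewrite (lieC (u a)) linearN mulNr mulrN mulrA.
Qed.

Lemma cub0 y : cyc y = 0.
Proof.
have : cyc y *+ 3 = 0.
  rewrite mulrS mulr2n {2}cub_r_cyc {2}cub_l_cyc addrACA cub_sum addrA addrN add0r.
  rewrite -mulrnDl -big_split big1 ?mul0rn // => b _ /=.
  by rewrite (lieC (u b)) linearN addrN.
rewrite -scaler_nat => /eqP; rewrite scaler_eq0 Num.Theory.pnatr_eq0 /=.
by move/eqP.
Qed.

Lemma casimir_comm y : casimir * c y = c y * casimir.
Proof.
have Gl (q : g) : linear (fun p => c (lie p y) * spin q).
  by move=> k p p'; rewrite lie_linearl linearP mulrDl -scalerAl.
have Gr (p : g) : linear (fun q => c (lie p y) * spin q).
  by move=> k q q'; rewrite linearP mulrDr -scalerAr.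
apply/eqP; rewrite -subr_eq0; apply/eqP.
transitivity (\sum_a (spin (u a) * c (lie (v a) y) + c (lie (v a) y) * spin (u a))).
  rewrite /casimir mulr_suml mulr_sumr -sumrB [in RHS]big_split /=.
  have /= <- := cas_swap Gl Gr; rewrite -big_split; apply: eq_bigr => a _ /=.
  by rewrite -!spin_comm mulrBr mulrBl !mulrA addrA subrK.
transitivity (4^-1 *: (cub_r y + cub_l y)); last first.
  by rewrite cub_sum cub0 oppr0 scaler0.
rewrite big_split /= scalerDr; congr (_ + _).
  rewrite /cub_r scaler_sumr; apply: eq_bigr => a _.
  by rewrite /spin -scalerAl mulr_suml.
rewrite /cub_l scaler_sumr; apply: eq_bigr => a _.
by rewrite /spin -scalerAr mulr_sumr.
Qed.

End CliffordMap.
End CasimirTensor.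

(** * Generation of the left ideal of p by the spin action *)

Section Generation.
Variables (F : numFieldType) (g : lieAlgType F) (B : {symmetric g}).
Variables (A : algType F) (c s : {linear g -> A}).
Variables (n : nat) (e f : 'I_n -> g) (ht : 'I_n -> nat).
Variables (h : {vspace g}) (J : finType) (hu hv : J -> g).
Variables (H : A -> Prop) (p : A).

Local Notation t i := (lie (e i) (f i)).
Let r : g := 2^-1 *: \sum_i t i.

Hypotheses (huh : forall j, hu j \in h) (hvh : forall j, hv j \in h).
Hypothesis huv : forall x y, x \in h -> y \in h ->
  \sum_j B x (hu j) * B y (hv j) = B x y.
Hypothesis th : forall i, t i \in h.
Hypothesis lie_tf : forall x i, x \in h -> lie x (f i) = - B (t i) x *: f i.
Hypothesis lie_ef : forall i j, i != j ->
  [\/ lie (e i) (f j) = 0,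
      exists l k, (ht l < ht j)%N /\ lie (e i) (f j) = k *: f l |
      exists l k, (ht l < ht i)%N /\ lie (e i) (f j) = k *: e l].
Hypothesis g_span : forall x,
  exists a b z, z \in h /\ x = \sum_i a i *: e i + \sum_i b i *: f i + z.

Hypothesis sc : forall x y, s x * c y - c y * s x = c (lie x y).
Hypothesis ss : forall x y, s (lie x y) = s x * s y - s y * s x.
Let cas := \sum_i (s (e i) * s (f i) + s (f i) * s (e i))
  + \sum_j s (hu j) * s (hv j).
Hypothesis cas_comm : forall y, cas * c y = c y * cas.

Hypothesis Hp : forall w, H w -> w * p = p * w.
Hypothesis cH : forall x w, x \in h -> H w -> H (c x * w).
Hypothesis cep : forall i, c (e i) * p = 0.
Hypothesis sep : forall i, s (e i) * p = 0.
Hypothesis stp : forall x, x \in h -> s x * p = B r x *: p.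
Hypothesis regular : forall j, B r (t j) *+ 4 != B (t j) (t j).

(** The submodule generated by [H p] under [s]. The algebra and both maps are abstract so that the
    argument serves Cl(g) and also its opposite algebra, with [e] and [f] exchanged and [s]
    negated. *)
Inductive gen_left : A -> Prop :=
| GenBase w : H w -> gen_left (w * p)
| GenAdd m m' : gen_left m -> gen_left m' -> gen_left (m + m')
| GenScale a m : gen_left m -> gen_left (a *: m)
| GenAct x m : gen_left m -> gen_left (s x * m).

(** Normal ordering: [s (e i) * s (f i)] is [s (f i) * s (e i)] plus [s] of the bracket, and the
    brackets add up to [2 r]. *)
Lemma weight_casimir mu m : mu \in h ->
  (forall x, x \in h -> s x * m = B mu x *: m) ->
  cas * m = (\sum_i s (f i) * (s (e i) * m)) *+ 2 + (B mu r *+ 2 + B mu mu) *: m.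
Proof.
move=> muh mu_m; rewrite /cas mulrDl !mulr_suml scalerDl addrA; congr (_ + _).
  transitivity (\sum_i ((s (f i) * (s (e i) * m)) *+ 2 + B mu (t i) *: m)).
    apply: eq_bigr => i _; rewrite mulrDl -mu_m // ss mulrBl -!mulrA mulr2n.
    by rewrite -addrA [RHS]addrC -!addrA addNr addr0 addrC.
  rewrite big_split /= sumrMnl; congr (_ + _).
  have half2 (z : F) : 2^-1 * z *+ 2 = z by field.
  rewrite /r linearZr_LR /= half2.
  by rewrite linear_sumr scaler_suml.
rewrite -huv // scaler_suml; apply: eq_bigr => j _.
by rewrite -mulrA mu_m // -scalerAr mu_m // scalerA mulrC.
Qed.

Lemma gen_left0 w : H w -> gen_left 0.
Proof. by move=> Hw; rewrite -(scale0r (w * p)); apply/GenScale/GenBase. Qed.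

(** [w * p] has weight [r] and is killed by the raising operators, while [c (f j) * (w * p)] has
    weight [r - t j]. As the Casimir element commutes with [c (f j)], the discrepancy of its two
    values expresses [c (f j) * (w * p)] by the elements [s (f i) * (s (e i) * _)], where [s (e i)]
    only leaves [c (lie (e i) (f j))] on [w * p]. Induction on the height of j. *)
Lemma gen_left_f j w : H w -> gen_left (c (f j) * (w * p)).
Proof.
have [m] := ubnP (ht j); elim: m => // m IH in j w * => jm Hw.
have G0 := gen_left0 Hw.
have s_wp x : x \in h -> s x * (w * p) = B r x *: (w * p).
  by move=> xh; rewrite Hp // mulrA stp // scalerAl.
have se_wp i : s (e i) * (w * p) = 0 by rewrite Hp // mulrA sep mul0r.
have rh : r \in h by rewrite memvZ // memv_suml.
pose v := c (f j) * (w * p).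
have s_v x : x \in h -> s x * v = B (r - t j) x *: v.
  move=> xh; rewrite /v mulrA -[s x * _](subrK (c (f j) * s x)) sc mulrDl.
  rewrite lie_tf // -mulrA s_wp // linearZ /= -scalerAl -scalerAr -scalerDl.
  by rewrite linearBl addrC.
have := cas_comm (f j) => /(congr1 ( *%R^~ (w * p))).
rewrite -!mulrA (weight_casimir rh s_wp) (weight_casimir _ s_v) ?memvB //.
rewrite [X in c (f j) * (X *+ 2 + _)]big1 => [|i _]; last by rewrite se_wp mulr0.
rewrite mul0rn add0r -scalerAr -/v => /(canRL (addrK _)).
rewrite -scalerBl; set k := (X in X *: v); set E := (X in X *+ 2) => vE.
(* [k] is the difference of the Casimir values at [r] and [r - t j]; [regular] says that it is
   nonzero. *)
have k0 : k != 0.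
  have -> : k = B r (t j) *+ 4 - B (t j) (t j).
    rewrite /k !linearBl /= !linearBr /= (Bsym B (t j) r).
    by set x := B r _; set y := B r r; set z := B _ _; ring.
  by rewrite subr_eq0 regular.
have -> : v = (2 / k) *: E.
  by rewrite mulrC -scalerA scaler_nat vE scalerA mulVf ?scale1r.
apply: GenScale; rewrite /E; elim/big_ind: _ => // [x y|i _]; first exact: GenAdd.
apply: GenAct; rewrite /v mulrA -[s _ * _](subrK (c (f j) * s (e i))) sc mulrDl.
rewrite -[_ * s _ * _]mulrA se_wp mulr0 addr0.
have [->|ij] := eqVneq i j; first by rewrite mulrA; apply: GenBase; apply: cH.
have [->|[l [a [lj ->]]]|[l [a [_ ->]]]] := lie_ef ij.
- by rewrite linear0 mul0r.
- by rewrite linearZ /= -scalerAl; apply: GenScale; apply: IH => //;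
    apply: leq_trans lj _.
by rewrite linearZ /= -scalerAl Hp // [c _ * _]mulrA cep mul0r scaler0.
Qed.

(** [c y] passes [s x] at the cost of [c (lie x y)], so only the generators [w * p] remain; there
    the e-part of [y] dies, the h-part stays in [H], and the f-part is [gen_left_f]. *)
Lemma gen_left_c y m : gen_left m -> gen_left (c y * m).
Proof.
move=> gm; elim: gm y => {m} [w Hw|m m' _ IH _ IH'|a m _ IH|x m _ IH] y.
- have G0 := gen_left0 Hw.
  have [a [b [z [zh ->]]]] := g_span y; rewrite !linearD !linear_sum !mulrDl.
  rewrite !mulr_suml; apply: GenAdd; last by rewrite mulrA; apply/GenBase/cH.
  apply: GenAdd; (elim/big_ind: _ => // [m m'|i _]; first exact: GenAdd);
    rewrite linearZ /= -scalerAl.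
    by rewrite Hp // [c _ * _]mulrA cep mul0r scaler0.
  by apply: GenScale; apply: gen_left_f.
- by rewrite mulrDr; apply: GenAdd.
- by rewrite -scalerAr; apply: GenScale.
have -> : c y * (s x * m) = s x * (c y * m) + (-1) *: (c (lie x y) * m).
  by rewrite scaleN1r -sc mulrBl !mulrA opprB addrC subrK.
by apply: GenAdd; [apply: GenAct|apply: GenScale].
Qed.

End Generation.
(** * Clifford algebras *)

Section LinearSpanTheory.
Variables (F : fieldType) (V : vectType F).

Lemma mem_linear_span (S : V -> Prop) x : S x -> x \in linear_span S.
Proof. by have [+ _] := linear_spanP S; apply. Qed.

Lemma linear_span_le (S : V -> Prop) (W : {vspace V}) :
  (forall x, S x -> x \in W) -> (linear_span S <= W)%VS.
Proof. by have [_ +] := linear_spanP S; apply. Qed.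

Lemma linear_span_ind (S P : V -> Prop) : P 0 ->
  (forall a x y, S x -> P y -> P (a *: x + y)) ->
  forall x, x \in linear_span S -> P x.
Proof.
move=> P0 PS.
pose ok d := `[< exists2 s : seq V, (forall x, x \in s -> S x) &
                  \dim <<s>>%VS = d >].
have ex_ok : exists d, ok d.
  by exists (\dim <<[::] : seq V>>%VS); apply/asboolP; exists [::].
have ok_le d : ok d -> (d <= \dim {:V})%N.
  by move=> /asboolP[s _ <-]; rewrite dimvS ?subvf.
have [_ /asboolP[s sS <-] s_max] := ex_maxnP ex_ok ok_le.
have sub : (linear_span S <= <<s>>)%VS.
  apply: linear_span_le => x Sx.
  have := s_max _ (introT (asboolP _) (ex_intro2 _ _ (x :: s) _ erefl)).
  rewrite span_cons => le_dim; rewrite memvE.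
  have /eqP -> : (<<s>> == <[x]> + <<s>>)%VS.
    rewrite eqEdim addvSr le_dim// => y.
    by rewrite inE => /predU1P[->//|/sS].
  exact: addvSl.
move=> x /(subvP sub) {sub s_max}; elim: s sS x => [|y s IH] sS x.
  by rewrite span_nil memv0 => /eqP ->.
rewrite span_cons => /memv_addP[_ /vlineP[a ->] [z zs ->]].
apply: PS; first by apply: sS; rewrite mem_head.
by apply: IH => // w ws; apply: sS; rewrite inE ws orbT.
Qed.

Lemma linear_span_closed (P : V -> Prop) : P 0 ->
  (forall a x y, P x -> P y -> P (a *: x + y)) ->
  forall x, x \in linear_span P <-> P x.
Proof.
by move=> P0 PS x; split; [apply: linear_span_ind|apply: mem_linear_span].
Qed.

End LinearSpanTheory.

Section FinitelySpanned.
Variables (F : fieldType) (W : lmodType F) (n : nat) (S : 'I_n -> W).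
Hypothesis spanS : forall w, exists k : 'rV[F]_n, w = \sum_i k 0 i *: S i.

(** The coefficient rows of elements of [P] form a subspace of the row space; evaluating a basis of
    it gives [T]. *)
Lemma finitely_spanned_sub (P : W -> Prop) : P 0 ->
  (forall a x y, P x -> P y -> P (a *: x + y)) ->
  exists m (T : 'I_m -> W), (forall i, P (T i)) /\
    forall w, P w -> exists k : 'I_m -> F, w = \sum_i k i *: T i.
Proof.
move=> P0 PS; pose ev (k : 'rV[F]_n) := \sum_i k 0 i *: S i.
have evP a k l : ev (a *: k + l) = a *: ev k + ev l.
  rewrite /ev scaler_sumr -big_split; apply: eq_bigr => i _ /=.
  by rewrite !mxE scalerDl scalerA.
have ev0 : ev 0 = 0 by rewrite /ev big1 // => i _; rewrite mxE scale0r.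
pose U := linear_span (fun k => P (ev k)).
have UE k : k \in U <-> P (ev k).
  apply: linear_span_closed => [|a x y Px Py]; first by rewrite ev0.
  by rewrite evP; apply: PS.
exists (\dim U), (fun i => ev (vbasis U)`_i); split.
  by move=> i; apply/UE/vbasis_mem/mem_nth; rewrite size_tuple.
move=> w Pw; have [k wk] := spanS w.
have kU : k \in U by apply/UE; rewrite /ev -wk.
exists (fun i => coord (vbasis U) i k); rewrite wk -/(ev k).
rewrite [in LHS](coord_vbasis kU).
elim/big_rec2: _ => [|i x y _ <-]; [exact: ev0|exact: evP].
Qed.

Lemma finitely_spanned_dep (T : 'I_n.+1 -> W) :
  exists2 k : 'rV[F]_n.+1, k != 0 & \sum_i k 0 i *: T i = 0.
Proof.
have [M ME] : exists M : 'M[F]_(n.+1, n), forall i, T i = \sum_j M i j *: S j.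
  have [f fE] := choice (fun i => spanS (T i)).
  by exists (\matrix_(i, j) f i 0 j) => i; rewrite {1}fE; apply: eq_bigr => j _;
    rewrite mxE.
have ker0 : kermx M != 0.
  rewrite kermx_eq0 /row_free neq_ltn (leq_ltn_trans (rank_leq_col M)) //.
have /rowV0Pn[k /sub_kermxP kM k0] := ker0; exists k => //.
under eq_bigr => l _ do rewrite ME scaler_sumr.
rewrite exchange_big big1 //= => j _.
under eq_bigr => l _ do rewrite scalerA.
rewrite -scaler_suml; move/rowP/(_ j): kM; by rewrite mxE mxE => ->; rewrite scale0r.
Qed.

End FinitelySpanned.

Lemma scale_eq0 (F : fieldType) (W : lmodType F) (a : F) (w : W) :
  a != 0 -> a *: w = 0 -> w = 0.
Proof. by move=> a0 aw; rewrite -[w]scale1r -(mulVf a0) -scalerA aw scaler0. Qed.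

Section CliffordTheory.
Variables (F : numFieldType) (V : vectType F) (B : {symmetric V}).

Local Notation Cl := (clifford B).
Local Notation c := (cl_gen B).

Lemma cl_gen_ind (P : Cl -> Prop) : P 1 ->
  (forall a u, P u -> P (a *: u)) -> (forall u v, P u -> P v -> P (u + v)) ->
  (forall x u, P u -> P (c x * u)) -> forall u, P u.
Proof.
move=> P1 PZ PD PM; elim/cl_ind; elim/tensor_ind => [|a m t Pt].
  by rewrite linear0 -(scale0r 1); apply: PZ.
rewrite linearD linearZ /=; apply: PD => //; apply: PZ; rewrite tmonE rmorph_prod.
by elim/big_rec: _ => // i u _ Pu; apply: PM.
Qed.

Lemma cl_genB x y : c x * c y + c y * c x = (B x y *+ 2)%:A.
Proof. by rewrite cl_gen_anticomm (Bsym B y) mulr2n. Qed.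

Section Extension.
Variables (A : algType F) (f : {linear V -> A}).
Hypothesis fB : forall x, f x * f x = (B x x)%:A.

(** The relation is an argument of the map so that its linear and multiplicative structures can be
    attached to the term. *)
Definition cl_ext & (forall x, f x * f x = (B x x)%:A) : Cl -> A := cl_lift f.
HB.instance Definition _ := GRing.isLinear.Build F Cl A _ (cl_ext fB)
  (cl_lift_is_linear fB).
HB.instance Definition _ := GRing.isMonoidMorphism.Build Cl A (cl_ext fB)
  (cl_lift_is_monoid_morphism fB).

Lemma cl_ext_gen x : cl_ext fB (c x) = f x.
Proof. exact: cl_lift_gen. Qed.

End Extension.

Lemma neg_gen_sqr x : (\- c) x * (\- c) x = (B x x)%:A.
Proof. by rewrite /= mulrNN cl_gen_sqr. Qed.

Definition cl_inv : Cl -> Cl := cl_ext neg_gen_sqr.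
HB.instance Definition _ := GRing.Linear.on cl_inv.
HB.instance Definition _ := GRing.RMorphism.on cl_inv.

Lemma cl_inv_gen x : cl_inv (c x) = - c x.
Proof. exact: cl_ext_gen. Qed.

(** For the converse, split a representative into its words of either parity: the part of the wrong
    parity equals its own negative in the quotient, hence vanishes there as 2 is invertible. *)
Lemma cl_parityP p u : cl_parity B p u <-> cl_inv u = (-1) ^+ p *: u.
Proof.
have inv_mon m : cl_inv (cl_proj B (tmon m)) = (-1) ^+ (size m) *: cl_proj B (tmon m).
  rewrite tmonE !rmorph_prod /=; case: m => m /=.
  elim: m => [|i m IH]; first by rewrite !big_nil scale1r.
  rewrite !big_cons IH -/(cl_gen B _) cl_inv_gen exprS -scalerA scaleN1r.
  by rewrite mulNr -scalerAr.
have inv_proj q (t : tensor_alg V) : (forall m, m \in msupp t -> odd (size m) = q) ->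
    cl_inv (cl_proj B t) = (-1) ^+ q *: cl_proj B t.
  have -> : cl_proj B t = \sum_(m <- msupp t) mcoeff m t *: cl_proj B (tmon m).
    rewrite {1}(tensor_expand t) linear_sum.
    by apply: eq_bigr => m _; rewrite linearZ.
  move=> tq; rewrite linear_sum scaler_sumr !big_seq; apply: eq_bigr => m mt.
  by rewrite !linearZ /= inv_mon -signr_odd tq // !scalerA mulrC.
split=> [[t tp ->]|]; first exact: inv_proj.
have [t ->] : exists t, u = cl_proj B t by exists (repr u); rewrite cl_reprK.
pose part q : tensor_alg V :=
  \sum_(m <- msupp t | odd (size m) == q) mcoeff m t *: tmon m.
have partE q m : m \in msupp (part q) -> odd (size m) = q.
  rewrite -mcoeff_neq0 mcoeff_tensor_sum => /negP mq.
  apply/eqP/negPn/negP => nq; apply: mq; apply/eqP;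
    rewrite big1_seq // => m' /andP[/eqP m'q _].
  rewrite mcoeff_tensorZ mcoeffU; case: eqP => [mm'|]; rewrite ?mulr0 //.
  by rewrite -mm' m'q eqxx in nq.
have tE : t = part p + part (~~ p).
  rewrite [LHS]tensor_expand (bigID (fun m : {fmonom _} => odd (size m) == p)) /=.
  by congr (_ + _); apply: eq_bigl => m; case: (odd _); case: p.
rewrite tE linearD /= !linearD /= !(inv_proj _ _ (@partE _)).
move=> /addrI; rewrite signrN scaleNr => z.
exists (part p); first exact: partE.
suff -> : cl_proj B (part (~~ p)) = 0 by rewrite addr0.
apply: (@scale_eq0 _ _ (2 * (-1) ^+ p)).
  by rewrite mulf_neq0 ?signr_eq0 ?Num.Theory.pnatr_eq0.
by rewrite -scalerA scaler_nat mulr2n -{1}z addNr.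
Qed.

(** Ordered products over the subsequences of [s]. They span because the Clifford relation moves any
    generator into place ([cl_comb_gen]). *)
Fixpoint cl_words (s : seq V) : seq Cl :=
  if s is x :: s' then cl_words s' ++ [seq c x * w | w <- cl_words s'] else [:: 1].

Definition cl_comb (s : seq V) (u : Cl) := exists k : nat -> F,
  u = \sum_(i < size (cl_words s)) k i *: nth 0 (cl_words s) i.

Lemma cl_combP x s u : cl_comb (x :: s) u <->
  exists u1 u2, [/\ cl_comb s u1, cl_comb s u2 & u = u1 + c x * u2].
Proof.
have szE : size (cl_words (x :: s)) = (size (cl_words s) + size (cl_words s))%N.
  by rewrite /= size_cat size_map.
set n := size (cl_words s) in szE *.
split=> [[k ->]|[u1 [u2 [[k1 ->] [k2 ->] ->]]]].
  exists (\sum_(i < n) k i *: nth 0 (cl_words s) i).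
  exists (\sum_(i < n) k (n + i)%N *: nth 0 (cl_words s) i).
  split; [by exists k|by exists (fun i => k (n + i)%N)|].
  rewrite szE big_split_ord /= mulr_sumr; congr (_ + _); apply: eq_bigr => i _.
    by rewrite nth_cat ltn_ord.
  rewrite nth_cat ltnNge leq_addr /= -/n addKn (nth_map 0) ?ltn_ord//.
  by rewrite scalerAr.
exists (fun i => if (i < n)%N then k1 i else k2 (i - n)%N).
rewrite szE big_split_ord /= mulr_sumr; congr (_ + _); apply: eq_bigr => i _.
  by rewrite nth_cat ltn_ord.
rewrite nth_cat ltnNge leq_addr /= -/n addKn (nth_map 0) ?ltn_ord//.
by rewrite scalerAr.
Qed.

Lemma cl_combD s u v : cl_comb s u -> cl_comb s v -> cl_comb s (u + v).
Proof.
move=> [k ->] [l ->]; exists (fun i => k i + l i).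
by rewrite -big_split; apply: eq_bigr => i _; rewrite scalerDl.
Qed.

Lemma cl_combZ s a u : cl_comb s u -> cl_comb s (a *: u).
Proof.
move=> [k ->]; exists (fun i => a * k i).
by rewrite scaler_sumr; apply: eq_bigr => i _; rewrite scalerA.
Qed.

Lemma cl_comb_gen s x u : x \in <<s>>%VS -> cl_comb s u -> cl_comb s (c x * u).
Proof.
elim: s x u => [|y s IH] x u.
  rewrite span_nil memv0 => /eqP -> u0; rewrite linear0 mul0r -(scale0r u).
  exact: cl_combZ.
rewrite span_cons => /memv_addP[_ /vlineP[a ->] [z zs ->]].
move=> /cl_combP[u1 [u2 [s1 s2 ->]]]; rewrite linearD linearZ /= mulrDl -scalerAl.
have sE v1 v2 : cl_comb s v1 -> cl_comb s v2 -> cl_comb (y :: s) (v1 + c y * v2).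
  by move=> sv1 sv2; apply/cl_combP; exists v1, v2.
apply: cl_combD; first apply: cl_combZ.
  rewrite mulrDr mulrA cl_gen_sqr mulr_algl addrC.
  by apply: sE => //; apply: cl_combZ.
rewrite mulrDr mulrA (cl_swap cl_genB) mulrBl mulr_algl addrA -mulrA -mulrN.
apply: sE; first by apply: cl_combD; [apply: IH|apply: cl_combZ].
by rewrite -scaleN1r; apply/cl_combZ/IH.
Qed.

Lemma cl_fin_span : exists n (S : 'I_n -> Cl),
  forall u, exists k : 'rV[F]_n, u = \sum_i k 0 i *: S i.
Proof.
pose s : seq V := vbasis {:V}; exists (size (cl_words s)).
exists (fun i => nth 0 (cl_words s) i) => u.
suff [k ->] : cl_comb s u.
  by exists (\row_i k i); apply: eq_bigr => i _; rewrite mxE.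
elim/cl_gen_ind: u => [|a u IH|u v IHu IHv|x u IH].
- elim: (s) => [|x s' IH]; first by exists (fun=> 1); rewrite big_ord1 scale1r.
  apply/cl_combP; exists 1, (0 *: 1); split=> //; first exact: cl_combZ.
  by rewrite scale0r mulr0 addr0.
- exact: cl_combZ.
- exact: cl_combD.
by apply: cl_comb_gen => //; rewrite (span_basis (vbasisP _)) memvf.
Qed.

End CliffordTheory.

(** * Simplicity of non-degenerate Clifford superalgebras *)

Section CliffordSimple.
Variables (F : numFieldType) (V : vectType F) (B : {symmetric V}).
Variables (I : finType) (u v : I -> V).
Hypothesis uvE : forall x, \sum_a B x (v a) *: u a = x.
Hypothesis vuE : forall x, \sum_a B x (u a) *: v a = x.

Local Notation Cl := (clifford B).
Local Notation c := (cl_gen B).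

(* Up to the factor 2, the contraction by x and the Euler operator.           *)
Definition cl_contr (x : V) (w : Cl) : Cl := c x * w - cl_inv w * c x.
Definition cl_euler (w : Cl) : Cl := \sum_a c (u a) * cl_contr (v a) w.

Lemma cl_contrD x w w' : cl_contr x (w + w') = cl_contr x w + cl_contr x w'.
Proof. by rewrite /cl_contr linearD mulrDl mulrDr opprD addrACA. Qed.

Lemma cl_contrZ x a w : cl_contr x (a *: w) = a *: cl_contr x w.
Proof. by rewrite /cl_contr linearZ -scalerAl -scalerAr -scalerBr. Qed.

Lemma cl_contrC x a : cl_contr x a%:A = 0.
Proof. by rewrite cl_contrZ /cl_contr rmorph1 mulr1 mul1r subrr scaler0. Qed.

Lemma cl_contr_linear w : linear (cl_contr^~ w).
Proof.
move=> a x y; rewrite /cl_contr linearP mulrDl mulrDr -scalerAl -scalerAr.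
by rewrite opprD addrACA scalerBr.
Qed.

Lemma cl_contrM x y w :
  cl_contr x (c y * w) = (B x y *+ 2) *: w - c y * cl_contr x w.
Proof.
rewrite /cl_contr rmorphM /= cl_inv_gen !mulrA (cl_swap (@cl_genB _ _ B)).
by rewrite mulrBl mulr_algl !mulNr opprK mulrBr !mulrA opprB addrAC addrA.
Qed.

Lemma cl_eulerD w w' : cl_euler (w + w') = cl_euler w + cl_euler w'.
Proof.
rewrite /cl_euler -big_split; apply: eq_bigr => a _ /=.
by rewrite cl_contrD mulrDr.
Qed.

Lemma cl_eulerM y w :
  cl_euler (c y * w) = c y * cl_euler w + c y * w *+ 2 - cl_contr y w *+ 2.
Proof.
have E1 : c y * w = \sum_a B y (v a) *: (c (u a) * w).
  rewrite -{1}(uvE y) linear_sum mulr_suml; apply: eq_bigr => a _.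
  by rewrite linearZ -scalerAl.
have E2 : cl_contr y w = \sum_a B y (u a) *: cl_contr (v a) w.
  by rewrite -{1}(vuE y) (lin_sum (cl_contr_linear w)).
rewrite [X in _ + X *+ 2]E1 E2 /cl_euler mulr_sumr -!sumrMnl -sumrN -!big_split /=.
apply: eq_bigr => a _; rewrite cl_contrM mulrBr -scalerAr -scalerMnl.
rewrite [c (u a) * (c y * _)]mulrA (cl_swap (@cl_genB _ _ B) (u a)) mulrBl.
rewrite mulr_algl -scalerMnl opprB -mulrA (Bsym B (v a)) (Bsym B (u a)) /=.
by rewrite addrA; congr (_ - _); rewrite addrC.
Qed.

Inductive cl_filt : nat -> Cl -> Prop :=
| FiltC k a : cl_filt k a%:A
| FiltD k w w' : cl_filt k w -> cl_filt k w' -> cl_filt k (w + w')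
| FiltM k x w : cl_filt k w -> cl_filt k.+1 (c x * w).

Lemma filt0 k : cl_filt k 0.
Proof. by rewrite -(scale0r 1); apply: FiltC. Qed.

Lemma filtZ k a w : cl_filt k w -> cl_filt k (a *: w).
Proof.
elim=> {k w} [k b|k w w' _ IH _ IH'|k x w fw IH].
- by rewrite scalerA; apply: FiltC.
- by rewrite scalerDr; apply: FiltD.
by rewrite scalerAr; apply: FiltM.
Qed.

Lemma filtB k w w' : cl_filt k w -> cl_filt k w' -> cl_filt k (w - w').
Proof. by move=> fw fw'; rewrite -scaleN1r; apply/FiltD/filtZ. Qed.

Lemma filtS k w : cl_filt k w -> cl_filt k.+1 w.
Proof.
elim=> {k w} [k b|k w w' _ IH _ IH'|k x w fw IH]; first exact: FiltC.
  exact: FiltD.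
exact: FiltM.
Qed.

Lemma filt_exhaust w : exists k, cl_filt k w.
Proof.
have le k l w' : (k <= l)%N -> cl_filt k w' -> cl_filt l w'.
  by move=> /subnK <-; elim: (l - k)%N => // i IH /IH; apply: filtS.
elim/cl_gen_ind: w => [|a w [k IH]|w w' [k IH] [k' IH']|x w [k IH]].
- by exists 0%N; rewrite -(scale1r 1); apply: FiltC.
- by exists k; apply: filtZ.
- exists (maxn k k'); apply: FiltD.
    by apply: le IH; apply: leq_maxl.
  by apply: le IH'; apply: leq_maxr.
by exists k.+1; apply: FiltM.
Qed.

Lemma filt_scalar k w : cl_filt k w -> k = 0%N -> exists a, w = a%:A.
Proof.
elim=> {k w} [k a _|k w w' _ IH _ IH' k0|//]; first by exists a.
have [a ->] := IH k0; have [b ->] := IH' k0.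
by exists (a + b); rewrite scalerDl.
Qed.

(** Contraction lowers the degree by one. Degree 0 is stated apart, because [k.-1] is then still
    0. *)
Lemma contr_filt k w : cl_filt k w ->
  forall x, cl_filt k.-1 (cl_contr x w) /\ (k = 0%N -> cl_contr x w = 0).
Proof.
elim=> {k w} [k b|k w w' _ IH _ IH'|k y w fw IH] x.
- by rewrite cl_contrC; split=> //; apply: filt0.
- have [f1 z1] := IH x; have [f2 z2] := IH' x; rewrite cl_contrD.
  by split=> [|k0]; [apply: FiltD|rewrite z1 // z2 // addr0].
split=> //=; rewrite cl_contrM; apply: filtB; first exact: filtZ.
have [f1 z1] := IH x; case: k => [|k] in fw IH f1 z1 *.
  by rewrite z1 // mulr0; apply: filt0.
exact: FiltM.
Qed.

(** In degree k, modulo lower degree, the Euler operator is multiplication by 2k. *)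
Lemma euler_filt k w : cl_filt k w ->
  (k = 0%N -> cl_euler w = 0) /\ cl_filt k.-1 (cl_euler w - w *+ k *+ 2).
Proof.
elim=> {k w} [k b|k w w' _ [z1 f1] _ [z2 f2]|k y w fw [z f]].
- have -> : cl_euler b%:A = 0.
    by rewrite /cl_euler big1 // => a _; rewrite cl_contrC mulr0.
  by split=> //; rewrite sub0r -mulNrn -mulNrn -scaleNr !scalerMnl; apply: FiltC.
- rewrite cl_eulerD; split=> [k0|]; first by rewrite z1 ?z2 ?addr0.
  by rewrite !mulrnDl opprD addrACA; apply: FiltD.
split=> //=; rewrite cl_eulerM.
have -> : c y * cl_euler w + c y * w *+ 2 - cl_contr y w *+ 2
     - c y * w *+ k.+1 *+ 2
   = c y * (cl_euler w - w *+ k *+ 2) - cl_contr y w *+ 2.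
  rewrite mulrBr !mulrnAr addrAC; congr (_ - _).
  by rewrite [c y * w *+ k.+1]mulrS mulrnDl opprD addrA addrK.
have [f2 z2] := contr_filt fw y; case: k => [|k] in fw z f f2 z2 *.
  by rewrite z // z2 // !mul0rn !subr0 mulr0; apply: filt0.
apply: filtB; first exact: FiltM.
by rewrite -scaler_nat; apply/filtZ/filtS.
Qed.

Variable K : Cl -> Prop.
Hypotheses (KD : forall w w', K w -> K w' -> K (w + w'))
  (KZ : forall a w, K w -> K (a *: w)) (KMl : forall w w', K w' -> K (w * w'))
  (KMr : forall w w', K w -> K (w * w')) (Kinv : forall w, K w -> K (cl_inv w)).

(** Induction on the degree: contractions of [w] lie in the ideal and have lower degree, so they
    vanish, hence so does the Euler operator on [w]. By [euler_filt], [w] then has lower degree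
    itself. In degree 0 a nonzero scalar would put 1 in the ideal. *)
Theorem cl_supersimple w : K w -> ~ K 1 -> w = 0.
Proof.
move=> Kw nK1; have [k fw] := filt_exhaust w.
elim: k => [|k IH] in w fw Kw *.
  have [a wa] := filt_scalar fw erefl.
  have [a0|a0] := eqVneq a 0; first by rewrite wa a0 scale0r.
  case: nK1; rewrite -[1]scale1r -(mulVf a0) -scalerA -wa; exact: KZ.
have KN w' : K w' -> K (- w') by move=> ?; rewrite -scaleN1r; apply: KZ.
(* Stability under the parity involution is what places [cl_inv w * c x] in the ideal. *)
have iw0 x : cl_contr x w = 0.
  apply: IH; first by have [] := contr_filt fw x.
  by apply: KD; [apply: KMl|apply/KN/KMr/Kinv].
have [_] := euler_filt fw; rewrite /cl_euler big1 => [|a _]; last by rewrite iw0 mulr0.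
rewrite sub0r /= => fw'; apply: IH => //.
have -> : w = (- (k.+1 * 2)%:R^-1) *: (- (w *+ k.+1 *+ 2)).
  rewrite scalerN scaleNr opprK -mulrnA -scaler_nat scalerA mulVf ?scale1r//.
  by rewrite Num.Theory.pnatr_eq0 muln_eq0.
exact: filtZ.
Qed.

End CliffordSimple.

Section Restrict.
Variables (F : numFieldType) (V : vectType F) (B : {symmetric V}) (U : {vspace V}).

Let gen_val := GRing.Linear.clone _ _ _ _ (cl_gen B \o @vsval F V U) _.
Let gen_val_sqr x : gen_val x * gen_val x = (restr_form B U x x)%:A.
Proof. exact: cl_gen_sqr. Qed.

Definition cl_sub : clifford (restr_form B U) -> clifford B := cl_ext gen_val_sqr.
HB.instance Definition _ := GRing.Linear.on cl_sub.
HB.instance Definition _ := GRing.RMorphism.on cl_sub.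

Lemma cl_sub_incl w : cl_incl w = cl_sub w. Proof. by []. Qed.

Lemma cl_sub_gen x : cl_sub (cl_gen _ x) = cl_gen B (vsval x).
Proof. exact: cl_ext_gen. Qed.

Lemma cl_sub_inv w : cl_sub (cl_inv w) = cl_inv (cl_sub w).
Proof.
elim/cl_gen_ind: w => [|a w IH|w w' IH IH'|x w IH].
- by rewrite !rmorph1.
- by rewrite !linearZ /= IH.
- by rewrite !linearD /= IH IH'.
by rewrite !rmorphM /= IH cl_inv_gen cl_sub_gen linearN /= cl_sub_gen cl_inv_gen.
Qed.

End Restrict.

Section AdjointDerivation.
Variables (F : numFieldType) (g : lieAlgType F) (B : {symmetric g}).

Definition ad (x : g) : g -> g := lie x.
HB.instance Definition _ x := GRing.isLinear.Build F g g _ (ad x) (lie_linearr x).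

Hypothesis Binv : ad_invariant B.
Variable s : g -> clifford B.
Hypothesis sc : forall x y,
  s x * cl_gen B y - cl_gen B y * s x = cl_gen B (lie x y).

(** Two derivations that agree on generators. Hence the invariants are the commutant of the spin
    image. *)
Lemma cl_der_spin x w : cl_der (lie x) w = s x * w - w * s x.
Proof.
have skew y z : B (ad x y) z = - B y (ad x z) by apply: lie_skew.
have derD := cl_der_is_linear skew; have derM := cl_derM skew.
have der1 : cl_der (ad x) (1 : clifford B) = 0.
  by have := derM 1 1; rewrite !mulr1 !mul1r -{1}[cl_der _ _]addr0 => /addrI/esym.
elim/cl_gen_ind: w => [|a w IH|w w' IH IH'|y w IH].
- by rewrite mulr1 mul1r subrr.
- have := derD a w 0; rewrite addr0 => ->.
  have -> : cl_der (ad x) (0 : clifford B) = 0.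
    by have := derD (-1) 0 0; rewrite scaleN1r oppr0 addr0 scaleN1r addNr.
  by rewrite addr0 IH -scalerAl -scalerAr -scalerBr.
- have := derD 1 w w'; rewrite !scale1r => ->.
  by rewrite IH IH' mulrDl mulrDr opprD addrACA.
rewrite [LHS]derM (cl_der_gen skew) IH -[cl_gen B (ad x y)]sc mulrBl mulrBr !mulrA.
by rewrite addrA subrK.
Qed.

End AdjointDerivation.
(** * Triangular bases and the idempotent p *)

(** The interface between the Lie theory and the Clifford computations. As [B (e i) (f i) = 1], the
    element [lie (e i) (f i)] represents the root of [e i] through [B]; [ht] only serves as an
    induction measure on roots. *)
Record triangular_basis (F : numFieldType) (g : lieAlgType F) (B : {symmetric g})
    (h : {vspace g}) (n : nat) (e f : 'I_n -> g) (ht : 'I_n -> nat) : Prop :=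
    TriangularBasis {
  tri_ee : forall i j, B (e i) (e j) = 0;
  tri_ff : forall i j, B (f i) (f j) = 0;
  tri_ef : forall i j, B (e i) (f j) = (i == j)%:R;
  tri_he : forall x i, x \in h -> B x (e i) = 0;
  tri_hf : forall x i, x \in h -> B x (f i) = 0;
  tri_span : forall x, exists a b z,
    z \in h /\ x = \sum_i a i *: e i + \sum_i b i *: f i + z;
  tri_coroot : forall i, lie (e i) (f i) \in h;
  tri_lie_hh : forall x y, x \in h -> y \in h -> lie x y = 0;
  tri_lie_he : forall x i, x \in h ->
    lie x (e i) = B (lie (e i) (f i)) x *: e i;
  tri_lie_hf : forall x i, x \in h ->
    lie x (f i) = - B (lie (e i) (f i)) x *: f i;
  tri_lie_ee : forall i j, exists k l, lie (e i) (e j) = k *: e l;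
  tri_lie_ff : forall i j, exists k l, lie (f i) (f j) = k *: f l;
  tri_lie_ef : forall i j, i != j ->
    [\/ lie (e i) (f j) = 0,
        exists l k, (ht l < ht j)%N /\ lie (e i) (f j) = k *: f l |
        exists l k, (ht l < ht i)%N /\ lie (e i) (f j) = k *: e l];
  tri_reg : forall i, B (lie (e i) (f i)) (lie (e i) (f i)) != 0
}.

Record dual_bases (F : fieldType) (V : vectType F) (B : {symmetric V})
    (h : {vspace V}) (J : finType) (hu hv : J -> V) : Prop := DualBases {
  dual_u : forall j, hu j \in h;
  dual_v : forall j, hv j \in h;
  dual_uE : forall x, x \in h -> \sum_j B x (hv j) *: hu j = x;
  dual_vE : forall x, x \in h -> \sum_j B x (hu j) *: hv j = x
}.

Section Triangular.
Variables (F : numFieldType) (g : lieAlgType F) (B : {symmetric g}).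
Variables (h : {vspace g}) (n : nat) (e f : 'I_n -> g) (ht : 'I_n -> nat).
Variables (J : finType) (hu hv : J -> g).
Hypothesis Binv : ad_invariant B.
Hypothesis T : triangular_basis B h e f ht.
Hypothesis D : dual_bases B h hu hv.

Local Notation Cl := (clifford B).
Local Notation c := (cl_gen B).
Local Notation t i := (lie (e i) (f i)).
Local Notation I := ('I_n + 'I_n + J)%type.

Definition tri_u (a : I) : g :=
  match a with inl (inl i) => e i | inl (inr i) => f i | inr j => hu j end.
Definition tri_v (a : I) : g :=
  match a with inl (inl i) => f i | inl (inr i) => e i | inr j => hv j end.

Lemma tri_sum (W : nmodType) (G : I -> W) : \sum_a G a =
  \sum_i G (inl (inl i)) + \sum_i G (inl (inr i)) + \sum_j G (inr j).
Proof. by rewrite !big_sumType. Qed.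

Lemma Bhe x i : x \in h -> B (e i) x = 0.
Proof. by move=> xh; rewrite (Bsym B) (tri_he T). Qed.
Lemma Bhf x i : x \in h -> B (f i) x = 0.
Proof. by move=> xh; rewrite (Bsym B) (tri_hf T). Qed.

Lemma tri_Be a b z i : z \in h ->
  B (\sum_j a j *: e j + \sum_j b j *: f j + z) (e i) = b i.
Proof.
move=> zh; rewrite !linearDl /= (tri_he T _ zh) addr0 !linear_sumlz /=.
rewrite big1 ?add0r => [|j _]; last by rewrite linearZl_LR /= (tri_ee T) mulr0.
rewrite (bigD1 i) //= big1 => [|j ji].
  by rewrite linearZl_LR /= (Bsym B) (tri_ef T) eqxx mulr1 addr0.
by rewrite linearZl_LR /= (Bsym B) (tri_ef T) eq_sym (negbTE ji) mulr0.
Qed.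

Lemma tri_Bf a b z i : z \in h ->
  B (\sum_j a j *: e j + \sum_j b j *: f j + z) (f i) = a i.
Proof.
move=> zh; rewrite !linearDl /= (tri_hf T _ zh) addr0 !linear_sumlz /=.
rewrite [X in _ + X]big1 ?addr0 => [|j _];
  last by rewrite linearZl_LR /= (tri_ff T) mulr0.
rewrite (bigD1 i) //= big1 => [|j ji].
  by rewrite linearZl_LR /= (tri_ef T) eqxx mulr1 addr0.
by rewrite linearZl_LR /= (tri_ef T) (negbTE ji) mulr0.
Qed.

Lemma tri_Bh a b z y : z \in h -> y \in h ->
  B (\sum_j a j *: e j + \sum_j b j *: f j + z) y = B z y.
Proof.
move=> zh yh; rewrite !linearDl /= !linear_sumlz /= !big1 ?add0r // => i _.
  by rewrite linearZl_LR /= Bhf // mulr0.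
by rewrite linearZl_LR /= Bhe // mulr0.
Qed.

Lemma tri_uvE x : \sum_a B x (tri_v a) *: tri_u a = x.
Proof.
have [a [b [z [zh ->]]]] := tri_span T x; rewrite tri_sum /=.
congr (_ + _ + _).
- by apply: eq_bigr => i _; rewrite tri_Bf.
- by apply: eq_bigr => i _; rewrite tri_Be.
rewrite -[RHS](dual_uE D zh); apply: eq_bigr => j _.
by rewrite tri_Bh // (dual_v D).
Qed.

Lemma tri_vuE x : \sum_a B x (tri_u a) *: tri_v a = x.
Proof.
have [a [b [z [zh ->]]]] := tri_span T x; rewrite tri_sum /=.
congr (_ + _); last first.
  rewrite -[RHS](dual_vE D zh); apply: eq_bigr => j _.
  by rewrite tri_Bh // (dual_u D).
rewrite addrC; congr (_ + _); apply: eq_bigr => i _.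
  by rewrite tri_Bf.
by rewrite tri_Be.
Qed.

Let cB := @cl_genB F g B.

Definition tri_P i : Cl := 2^-1 *: (c (e i) * c (f i)).
Definition tri_p : Cl := \prod_i tri_P i.
Local Notation P := tri_P.
Local Notation p := tri_p.

Lemma Bfe i j : B (f i) (e j) = (i == j)%:R.
Proof. by rewrite (Bsym B) (tri_ef T) eq_sym. Qed.

Lemma gen_pair_comm x i : B x (e i) = 0 -> B x (f i) = 0 -> c x * P i = P i * c x.
Proof.
move=> xe xf; rewrite /P -scalerAr -scalerAl mulrA (cl_swap0 cB xe) mulNr -mulrA.
by rewrite (cl_swap0 cB xf) mulrN opprK mulrA.
Qed.

Lemma P_comm i j : P i * P j = P j * P i.
Proof.
have [->//|ij] := eqVneq i j.
rewrite {1}/P -scalerAl -mulrA gen_pair_comm.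
- rewrite mulrA gen_pair_comm ?(tri_ee T) ?(tri_ef T) ?(negbTE ij) //.
  by rewrite -mulrA scalerAr.
- by rewrite Bfe (negbTE ij).
by rewrite (tri_ff T).
Qed.

Lemma efe i : c (e i) * c (f i) * c (e i) = 2 *: c (e i).
Proof.
rewrite -mulrA (cl_swap cB (f i)) Bfe eqxx mulrBr mulr_algr mulrA cl_gen_sqr.
by rewrite (tri_ee T) scale0r mul0r subr0.
Qed.

Lemma fef i : c (f i) * c (e i) * c (f i) = 2 *: c (f i).
Proof.
rewrite -mulrA (cl_swap cB (e i)) (tri_ef T) eqxx mulrBr mulr_algr mulrA cl_gen_sqr.
by rewrite (tri_ff T) scale0r mul0r subr0.
Qed.

Let nz2 : 2 != 0 :> F. Proof. by rewrite Num.Theory.pnatr_eq0. Qed.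

Lemma P_idem i : P i * P i = P i.
Proof.
rewrite /P -scalerAl -scalerAr mulrA efe -scalerAl [X in _ *: X]scalerA.
by rewrite mulVf // scale1r.
Qed.

Lemma eP i : c (e i) * P i = 0.
Proof. by rewrite /P -scalerAr mulrA cl_gen_sqr (tri_ee T) scale0r mul0r scaler0. Qed.

Lemma Pf i : P i * c (f i) = 0.
Proof. by rewrite /P -scalerAl -mulrA cl_gen_sqr (tri_ff T) scale0r mulr0 scaler0. Qed.

Lemma P_prod i (s : seq 'I_n) : i \in s -> P i * \prod_(j <- s) P j = \prod_(j <- s) P j.
Proof.
elim: s => // j s IH; rewrite inE big_cons mulrA => /predU1P[->|/IH Ei].
  by rewrite P_idem.
by rewrite P_comm -mulrA Ei.
Qed.

Lemma P_prodC i (s : seq 'I_n) :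
  P i * \prod_(j <- s) P j = (\prod_(j <- s) P j) * P i.
Proof.
elim: s => [|j s IH]; first by rewrite big_nil mulr1 mul1r.
by rewrite big_cons mulrA P_comm -mulrA IH mulrA.
Qed.

Lemma Pp i : P i * p = p. Proof. by rewrite P_prod // mem_index_enum. Qed.
Lemma pP i : p * P i = p. Proof. by rewrite -P_prodC Pp. Qed.

Lemma ep i : c (e i) * p = 0.
Proof. by rewrite -(Pp i) mulrA eP mul0r. Qed.
Lemma pf i : p * c (f i) = 0.
Proof. by rewrite -(pP i) -mulrA Pf mulr0. Qed.

Lemma pp : p * p = p.
Proof.
rewrite {1}/p; elim: (index_enum _) => [|i s IH]; first by rewrite big_nil mul1r.
by rewrite big_cons -mulrA IH Pp.
Qed.

Lemma efp i : c (e i) * c (f i) * p = 2 *: p.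
Proof. by rewrite -{2}(Pp i) /P -scalerAl scalerA divff // scale1r. Qed.
Lemma pef i : p * (c (e i) * c (f i)) = 2 *: p.
Proof. by rewrite -{2}(pP i) /P -scalerAr scalerA divff // scale1r. Qed.

Lemma gen_prod_comm x (s : seq 'I_n) :
  (forall i, i \in s -> B x (e i) = 0 /\ B x (f i) = 0) ->
  c x * \prod_(i <- s) P i = (\prod_(i <- s) P i) * c x.
Proof.
elim: s => [|i s IH] xs; first by rewrite big_nil mulr1 mul1r.
have [xe xf] := xs i (mem_head _ _).
rewrite big_cons mulrA gen_pair_comm // -mulrA IH ?mulrA // => j js.
by apply: xs; rewrite inE js orbT.
Qed.

Lemma hp x : x \in h -> c x * p = p * c x.
Proof. by move=> xh; apply: gen_prod_comm => i _; rewrite (tri_he T) ?(tri_hf T). Qed.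

(** Multiply in one factor at a time. If e f q = 0 for the product q of the other factors, then 2 f
    q = f e f q = 0; e and f commute with q, so 2 q = (e f + f e) q = 0. *)
Lemma p_neq0 : p <> 0.
Proof.
rewrite /p; have := index_enum_uniq 'I_n.
elim: (index_enum _) => [_|i s IH]; first by rewrite big_nil; apply/eqP/oner_neq0.
rewrite cons_uniq big_cons => /andP[iNs us]; set q := \prod_(j <- s) _ in IH *.
have eq : c (e i) * q = q * c (e i).
  apply: gen_prod_comm => j js; rewrite (tri_ee T) (tri_ef T).
  by have [ij|] := eqVneq i j; rewrite // -ij (negbTE iNs) in js.
have fq : c (f i) * q = q * c (f i).
  apply: gen_prod_comm => j js; rewrite (tri_ff T) Bfe.
  by have [ij|] := eqVneq i j; rewrite // -ij (negbTE iNs) in js.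
rewrite /P -scalerAl => /(@scale_eq0 _ _ _ _ (invr_neq0 nz2)) efq.
have fq0 : c (f i) * q = 0.
  apply: (@scale_eq0 _ _ 2) => //.
  by rewrite scalerAl -fef -mulrA -mulrA efq mulr0.
have : c (f i) * c (e i) * q + c (e i) * c (f i) * q = 2 *: q.
  by rewrite -mulrDl cB Bfe eqxx mulr_algl.
rewrite efq addr0 -mulrA eq mulrA fq0 mul0r => /esym /(@scale_eq0 _ _ _ _ nz2).
exact: IH.
Qed.

Lemma p_inv : cl_inv p = p.
Proof.
rewrite /p rmorph_prod; apply: eq_bigr => i _.
by rewrite /= /P linearZ /= rmorphM /= !cl_inv_gen mulrNN.
Qed.

Local Notation j := (@cl_sub F g B h).

Lemma jp w : j w * p = p * j w.
Proof.
elim/cl_gen_ind: w => [|a w IH|w w' IH IH'|x w IH].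
- by rewrite rmorph1 mulr1 mul1r.
- by rewrite linearZ /= -scalerAl IH scalerAr.
- by rewrite linearD mulrDl IH IH' mulrDr.
by rewrite rmorphM /= -mulrA IH !mulrA cl_sub_gen hp ?subvsP.
Qed.

Lemma ejp i w : c (e i) * (j w * p) = 0.
Proof. by rewrite jp mulrA ep mul0r. Qed.

End Triangular.

HB.lock Definition tri_spin (F : numFieldType) (g : lieAlgType F)
    (B : {symmetric g}) (n : nat) (e f : 'I_n -> g) (J : finType)
    (hu hv : J -> g) : g -> clifford B :=
  spin (tri_u e f hu) (tri_v e f hv) (cl_gen B).
Canonical tri_spin_unlockable := Unlockable tri_spin.unlock.

Section TriangularSpin.
Variables (F : numFieldType) (g : lieAlgType F) (B : {symmetric g}).
Variables (h : {vspace g}) (n : nat) (e f : 'I_n -> g) (ht : 'I_n -> nat).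
Variables (J : finType) (hu hv : J -> g).
Hypothesis Binv : ad_invariant B.
Hypothesis T : triangular_basis B h e f ht.
Hypothesis D : dual_bases B h hu hv.

Local Notation Cl := (clifford B).
Local Notation c := (cl_gen B).
Local Notation t i := (lie (e i) (f i)).
Local Notation p := (tri_p B e f).
Local Notation j := (@cl_sub F g B h).

Let cB := @cl_genB F g B.
Let u := tri_u e f hu.
Let v := tri_v e f hv.
Let uvE : forall x, \sum_a B x (v a) *: u a = x := tri_uvE T D.
Let vuE : forall x, \sum_a B x (u a) *: v a = x := tri_vuE T D.

Local Notation s := (tri_spin B e f hu hv).
Fact tri_spin_linear : linear s.
Proof. by move=> k x y; rewrite tri_spin.unlock linearP. Qed.
HB.instance Definition _ := GRing.isLinear.Build F g Cl _ s tri_spin_linear.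

(** Represents half the sum of the positive roots through [B]. *)
Definition tri_rho : g := 2^-1 *: \sum_i t i.
Local Notation r := tri_rho.

Lemma tri_spinE x : s x = 4^-1 *: (\sum_i c (lie x (e i)) * c (f i)
  + \sum_i c (lie x (f i)) * c (e i) + \sum_k c (lie x (hu k)) * c (hv k)).
Proof. by rewrite tri_spin.unlock /spin tri_sum. Qed.

Lemma tri_sc x y : s x * c y - c y * s x = c (lie x y).
Proof. rewrite tri_spin.unlock; exact: (spin_comm Binv uvE vuE cB). Qed.

Lemma tri_ss x y : s (lie x y) = s x * s y - s y * s x.
Proof. rewrite tri_spin.unlock; exact: (spin_lie Binv uvE vuE cB). Qed.

(** In every summand some [e] can be brought next to [p]. No scalar arises in the interchanges,
    since the factors are orthogonal: for example [B [e_i, e_k] f_k = B e_i [e_k, f_k] = 0]. *)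
Lemma sp_e i : s (e i) * p = 0.
Proof.
have E1 k : c (lie (e i) (e k)) * c (f k) * p = 0.
  rewrite (cl_swap0 cB) ?Binv ?(Bhe T) ?(tri_coroot T) //.
  have [l [a ->]] := tri_lie_ee T i k.
  by rewrite linearZ /= mulNr -mulrA -scalerAl (ep T) scaler0 mulr0 oppr0.
have E2 k : c (lie (e i) (f k)) * c (e k) * p = 0.
  by rewrite -mulrA (ep T) mulr0.
have E3 k : c (lie (e i) (hu k)) * c (hv k) * p = 0.
  rewrite (lieC (e i)) (tri_lie_he T) ?(dual_u D) // linearN linearZ /= mulNr -scalerAl.
  rewrite (cl_swap0 cB) ?(Bhe T) ?(dual_v D) //.
  by rewrite scalerN opprK -scalerAl -mulrA (ep T) mulr0 scaler0.
rewrite tri_spinE -scalerAl !mulrDl !mulr_suml big1; last by move=> k _; apply: E1.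
rewrite big1; last by move=> k _; apply: E2.
by rewrite big1 ?addr0 ?scaler0 // => k _; apply: E3.
Qed.

Lemma ps_f i : p * s (f i) = 0.
Proof.
have E1 k : p * (c (lie (f i) (e k)) * c (f k)) = 0.
  rewrite (cl_swap0 cB) ?Binv ?(Bhf T) ?(tri_coroot T) //.
  by rewrite mulrN mulrA (pf T) mul0r oppr0.
have E2 k : p * (c (lie (f i) (f k)) * c (e k)) = 0.
  have [l [a ->]] := tri_lie_ff T i k.
  by rewrite linearZ /= mulrA -scalerAr (pf T) scaler0 mul0r.
have E3 k : p * (c (lie (f i) (hu k)) * c (hv k)) = 0.
  rewrite (lieC (f i)) (tri_lie_hf T) ?(dual_u D) // linearN linearZ /=.
  by rewrite mulrA mulrN -scalerAr (pf T) scaler0 oppr0 mul0r.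
rewrite tri_spinE -scalerAr !mulrDr !mulr_sumr big1; last by move=> k _; apply: E1.
rewrite big1; last by move=> k _; apply: E2.
by rewrite big1 ?addr0 ?scaler0 // => k _; apply: E3.
Qed.

Let half_sum (x : g) : 4^-1 *: (\sum_i (B (t i) x * 2) *: p) = B r x *: p.
Proof.
rewrite -scaler_suml scalerA -mulr_suml; congr (_ *: _).
by rewrite /r linearZl_LR linear_sumlz /=; field.
Qed.

Lemma spin_h x : x \in h ->
  s x = 4^-1 *: (\sum_i B (t i) x *: (c (e i) * c (f i) - c (f i) * c (e i))).
Proof.
move=> xh; rewrite tri_spinE [X in _ + X]big1 ?addr0 => [|k _].
  congr (_ *: _); rewrite -big_split; apply: eq_bigr => i _ /=.
  rewrite (tri_lie_he T _ xh) (tri_lie_hf T _ xh) !linearZ /= -!scalerAl scalerBr.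
  by rewrite scaleNr.
by rewrite (tri_lie_hh T) ?(dual_u D) // linear0 mul0r.
Qed.

Lemma sp_h x : x \in h -> s x * p = B r x *: p.
Proof.
move=> xh; rewrite spin_h // -half_sum -scalerAl mulr_suml; congr (_ *: _).
apply: eq_bigr => i _; rewrite -scalerAl mulrBl (efp T) -mulrA (ep T) mulr0 subr0.
by rewrite scalerA.
Qed.

Lemma ps_h x : x \in h -> p * s x = B r x *: p.
Proof.
move=> xh; rewrite spin_h // -half_sum -scalerAr mulr_sumr; congr (_ *: _).
apply: eq_bigr => i _; rewrite -scalerAr mulrBr (pef T) mulrA (pf T) mul0r subr0.
by rewrite scalerA.
Qed.

(* If m_k = s(f)^k p never vanished, s(t) would have infinitely many
   eigenvalues; if m_(k+1) is the first zero, s(e) m_(k+1) = 0 gives the value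
   of rho on t. *)
Lemma tri_regular i : B r (t i) *+ 4 != B (t i) (t i).
Proof.
set a := B (t i) (t i); have a0 : a != 0 by apply: tri_reg T i.
have th := tri_coroot T i; pose m k := s (f i) ^+ k * p.
have s_t k : s (t i) * m k = (B r (t i) - k%:R * a) *: m k.
  elim: k => [|k IH]; first by rewrite /m mul1r mul0r subr0 sp_h.
  rewrite /m exprS -mulrA -/(m k) mulrA -[s (t i) * _](subrK (s (f i) * s (t i))).
  rewrite -tri_ss (tri_lie_hf T _ th) linearZ /= mulrDl -mulrA IH -scalerAl -scalerAr.
  by rewrite -scalerDl -/a; congr (_ *: _); rewrite -natr1; ring.
have s_e k : s (e i) * m k.+1 =
    (k.+1%:R * (B r (t i) - k%:R * a / 2)) *: m k.
  elim: k => [|k IH].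
    rewrite /m expr1 expr0 mul1r mulrA -[s (e i) * _](subrK (s (f i) * s (e i))).
    rewrite -tri_ss mulrDl -mulrA sp_e mulr0 addr0 sp_h //; congr (_ *: _).
    by field.
  rewrite {1}/m exprS -mulrA -/(m k.+1) mulrA -[s (e i) * _](subrK (s (f i) * s (e i))).
  rewrite -tri_ss mulrDl -mulrA IH s_t -scalerAr mulrA -exprS -/(m k.+1) -scalerDl.
  by congr (_ *: _); rewrite -!natr1; field.
have [k mk] : exists k, m k = 0.
  apply: contrapT => m0; have {}m0 k : m k <> 0 by move=> mk; apply: m0; exists k.
  have [N [S SE]] := cl_fin_span B.
  have [q q0 qE] := finitely_spanned_dep SE (fun k => s (t i) ^+ k).
  pose Q : {poly F} := \poly_(k < N.+1) q 0 (inord k).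
  have Q0 : Q != 0.
    have /rV0Pn[k qk] := q0; apply: contraNneq qk => Q0.
    by have := coef_poly N.+1 (fun k => q 0 (inord k)) k;
      rewrite -/Q Q0 coef0 ltn_ord inord_val => /esym/eqP.
  pose mu k := B r (t i) - k%:R * a.
  have rootQ k : root Q (mu k).
    apply/rootP; rewrite horner_poly.
    have pw l : s (t i) ^+ l * m k = mu k ^+ l *: m k.
      elim: l => [|l IHl]; first by rewrite mul1r scale1r.
      by rewrite exprS -mulrA IHl -scalerAr s_t scalerA mulrC -exprS.
    have /(congr1 ( *%R^~ (m k))) := qE; rewrite mul0r mulr_suml.
    under eq_bigr => l _ do rewrite -scalerAl pw scalerA.
    rewrite -scaler_suml => E; apply: contrapT => /eqP nz; apply: (m0 k).
    apply: scale_eq0 E; apply: contraNneq nz => E0; apply/eqP; rewrite -[RHS]E0.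
    by apply: eq_bigr => l _; rewrite inord_val.
  have mu_inj : injective mu.
    move=> k l /addrI/oppr_inj/(mulIf a0)/eqP.
    by rewrite Num.Theory.eqr_nat => /eqP.
  have /(max_poly_roots Q0) : all (root Q) [seq mu k | k <- iota 0 (size Q)].
    by apply/allP => _ /mapP[k _ ->]; apply: rootQ.
  by rewrite map_inj_uniq ?iota_uniq // size_map size_iota ltnn => /(_ isT).
have {k mk} [k [mk mk1]] : exists k, m k <> 0 /\ m k.+1 = 0.
  elim: k mk => [|k IH mk]; first by rewrite /m mul1r => /(p_neq0 T).
  by have [/IH|mk0] := pselect (m k = 0); last by exists k.
have := s_e k; rewrite mk1 mulr0 => /esym E.
have /eqP : k.+1%:R * (B r (t i) - k%:R * a / 2) == 0.
  by apply: contrapT => /negP nz; apply/mk/(scale_eq0 nz E).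
move/eqP; rewrite mulf_eq0 Num.Theory.pnatr_eq0 /= subr_eq0 => /eqP ->.
(* So [B r (t i) *+ 4] is 2k times [a], and 2k is never 1. *)
have -> : (k%:R * a / 2) *+ 4 = (k * 2)%:R * a by rewrite natrM; field.
rewrite -subr_eq0 -{2}[a]mul1r -mulrBl mulf_neq0 // subr_eq0.
by rewrite Num.Theory.pnatr_eq1; case: k {mk mk1 E} => [|k]; rewrite ?mul0n.
Qed.

End TriangularSpin.
(** * The Harish-Chandra isomorphism *)

Section OppositeAlgebra.
Variables (F : fieldType) (A : algType F).

(** The right ideal of p is a left ideal here, so that the generation argument can be reused. *)
Definition opp_alg : Type := A.
HB.instance Definition _ := GRing.Lmodule.on opp_alg.

Let mul (a b : opp_alg) : opp_alg := (b : A) * (a : A).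

Fact opp_mulA : associative mul.
Proof. by move=> a b d; rewrite /mul mulrA. Qed.
Fact opp_mul1 : left_id (1 : A) mul.
Proof. by move=> a; rewrite /mul mulr1. Qed.
Fact opp_mulr1 : right_id (1 : A) mul.
Proof. by move=> a; rewrite /mul mul1r. Qed.
Fact opp_mulDl : left_distributive mul +%R.
Proof. by move=> a b d; rewrite /mul mulrDr. Qed.
Fact opp_mulDr : right_distributive mul +%R.
Proof. by move=> a b d; rewrite /mul mulrDl. Qed.
Fact opp_1neq0 : (1 : A) != 0 :> opp_alg.
Proof. exact: oner_neq0. Qed.
HB.instance Definition _ := GRing.Zmodule_isNzRing.Build opp_alg
  opp_mulA opp_mul1 opp_mulr1 opp_mulDl opp_mulDr opp_1neq0.

Fact opp_scaleAl (k : F) (a b : opp_alg) : k *: mul a b = mul (k *: a) b.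
Proof. exact: (@scalerAr _ A k b a). Qed.
HB.instance Definition _ := GRing.Lmodule_isLalgebra.Build F opp_alg opp_scaleAl.
Fact opp_scaleAr (k : F) (a b : opp_alg) : k *: mul a b = mul a (k *: b).
Proof. exact: (@scalerAl _ A k b a). Qed.
HB.instance Definition _ := GRing.Lalgebra_isAlgebra.Build F opp_alg opp_scaleAr.

Lemma opp_mulE (a b : opp_alg) : a * b = (b : A) * (a : A) :> A.
Proof. by []. Qed.

End OppositeAlgebra.

(** * The left and right ideals of p as spin modules *)

Section TriangularGeneration.
Variables (F : numFieldType) (g : lieAlgType F) (B : {symmetric g}).
Variables (h : {vspace g}) (n : nat) (e f : 'I_n -> g) (ht : 'I_n -> nat).
Variables (J : finType) (hu hv : J -> g).
Hypothesis Binv : ad_invariant B.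
Hypothesis T : triangular_basis B h e f ht.
Hypothesis D : dual_bases B h hu hv.

Local Notation Cl := (clifford B).
Local Notation c := (cl_gen B).
Local Notation t i := (lie (e i) (f i)).
Local Notation p := (tri_p B e f).
Local Notation j := (@cl_sub F g B h).
Local Notation s := (tri_spin B e f hu hv).
Local Notation r := (tri_rho e f).
Let cB := @cl_genB F g B.

Definition in_h (w : Cl) := exists w', w = j w'.

Lemma tri_huv x y : x \in h -> y \in h ->
  \sum_k B x (hu k) * B y (hv k) = B x y.
Proof.
move=> xh yh; rewrite -{2}(dual_uE D yh) linear_sumr /=.
by apply: eq_bigr => k _; rewrite linearZr_LR /= mulrC.
Qed.

Lemma in_h_mul x w : x \in h -> in_h w -> in_h (c x * w).
Proof.
move=> xh [w' ->]; exists (cl_gen _ (vsproj h x) * w').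
by rewrite rmorphM /= cl_sub_gen vsprojK.
Qed.

Lemma tri_casimir_comm y : (\sum_i (s (e i) * s (f i) + s (f i) * s (e i))
  + \sum_k s (hu k) * s (hv k)) * c y =
  c y * (\sum_i (s (e i) * s (f i) + s (f i) * s (e i)) + \sum_k s (hu k) * s (hv k)).
Proof.
have := casimir_comm Binv (tri_uvE T D) (tri_vuE T D) cB y.
by rewrite /casimir tri_sum /= -big_split tri_spin.unlock.
Qed.

Lemma tri_gen_left_aux w : gen_left s in_h p (w * p).
Proof.
have gen1 : gen_left s in_h p p.
  by rewrite -[X in gen_left _ _ _ X]mul1r; apply: GenBase; exists 1; rewrite rmorph1.
elim/cl_gen_ind: w => [|a w IH|w w' IH IH'|x w IH].
- by rewrite mul1r.
- by rewrite -scalerAl; apply: GenScale.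
- by rewrite mulrDl; apply: GenAdd.
rewrite -mulrA; apply: (gen_left_c (B := B) (e := e) (f := f) (ht := ht)
  (h := h) (hu := hu) (hv := hv)).
- exact: dual_u D.
- exact: dual_v D.
- exact: tri_huv.
- exact: tri_coroot T.
- by move=> y i yh; rewrite (tri_lie_hf T).
- exact: tri_lie_ef T.
- exact: tri_span T.
- exact: (tri_sc Binv T D).
- exact: (tri_ss Binv T D).
- exact: tri_casimir_comm.
- by move=> _ [w' ->]; apply: (jp T).
- exact: in_h_mul.
- exact: (ep T).
- exact: (sp_e Binv T D).
- exact: (sp_h T D).
- exact: (tri_regular Binv T D).
- exact: IH.
Qed.

(** The equality Cl(g) p = A Cl(h) p as an induction principle. *)
Lemma tri_gen_left (Q : Cl -> Prop) :
  (forall w, Q (j w * p)) -> (forall m m', Q m -> Q m' -> Q (m + m')) ->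
  (forall a m, Q m -> Q (a *: m)) -> (forall x m, Q m -> Q (s x * m)) ->
  forall w, Q (w * p).
Proof.
move=> QH QD QZ QM w.
elim: (tri_gen_left_aux w) => [_ [w' ->]|m m' _ + _|a m _|x m _]; first exact: QH.
- exact: QD.
- exact: QZ.
exact: QM.
Qed.

Let c' : g -> opp_alg Cl := c.
HB.instance Definition _ := GRing.isLinear.Build F g (opp_alg Cl) _ c'
  (cl_gen_is_linear B).
(** The sign makes it a Lie homomorphism into the opposite algebra. There p has weight [- r], which
    is what [r] becomes when [e] and [f] are exchanged. *)
Definition opp_spin (x : g) : opp_alg Cl := - s x.
Local Notation s' := opp_spin.
Fact opp_spin_linear : linear s'.
Proof. by move=> k x y; rewrite /opp_spin linearP opprD scalerN. Qed.
HB.instance Definition _ := GRing.isLinear.Build F g (opp_alg Cl) _ opp_spin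
  opp_spin_linear.

Let in_h' : opp_alg Cl -> Prop := in_h.
Let p' : opp_alg Cl := p.
Let right_gen (w : Cl) := gen_left s' in_h' p' w.

Let cas : opp_alg Cl := \sum_i (s (e i) * s (f i) + s (f i) * s (e i))
  + \sum_k s (hu k) * s (hv k).

Let r'E : 2^-1 *: \sum_i lie (f i) (e i) = - r.
Proof.
rewrite /r -scalerN -sumrN; congr (_ *: _).
by apply: eq_bigr => i _; rewrite lieC.
Qed.

Let right_gen_mul (m w : Cl) : right_gen m -> right_gen (m * w).
Proof.
elim/cl_gen_ind: w m => [|a w IH|w w' IH IH'|x w IH] m gm.
- by rewrite mulr1.
- by rewrite -scalerAr; apply: (GenScale a (IH _ gm)).
- by rewrite mulrDr; apply: (GenAdd (IH _ gm) (IH' _ gm)).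
rewrite mulrA; apply: IH; rewrite /right_gen.
(* The roles of [e] and [f], and of [hu] and [hv], are exchanged. *)
have := @gen_left_c F g B (opp_alg Cl) c' s' n f e ht h J hv hu in_h' p'.
move=> /(_ (dual_v D) (dual_u D)).
apply; last exact: gm.
- move=> y z yh zh; rewrite (Bsym B y z) -(tri_huv zh yh).
  by apply: eq_bigr => k _; rewrite mulrC.
- by move=> i; rewrite (lieC (f i)) memvN (tri_coroot T).
- by move=> y i yh; rewrite (tri_lie_he T _ yh) (lieC (f i)) linearNl /= opprK.
- move=> i k ik; rewrite lieC; rewrite eq_sym in ik.
  have [->|[l [a [lk ->]]]|[l [a [lk ->]]]] := tri_lie_ef T ik.
  + by apply: Or31; rewrite oppr0.
  + by apply: Or33; exists l, (- a); rewrite scaleNr.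
  by apply: Or32; exists l, (- a); rewrite scaleNr.
- move=> y; have [a [b [z [zh ->]]]] := tri_span T y.
  by exists b, a, z; rewrite [\sum_i b i *: _ + _]addrC.
- by move=> y z; rewrite !opp_mulE /opp_spin /c' mulrN mulNr opprK addrC;
    apply: (tri_sc Binv T D).
- move=> y z; rewrite [LHS](_ : _ = - s (lie y z)) //
    !opp_mulE /opp_spin !mulrNN (tri_ss Binv T D).
  by rewrite opprB.
- move=> y; rewrite [X in X * _ = _](_ : _ = cas) 1?[X in _ = _ * X](_ : _ = cas).
  + by rewrite !opp_mulE /c' tri_casimir_comm.
  + congr (_ + _); apply: eq_bigr => k _; rewrite !opp_mulE /opp_spin !mulrNN //.
  congr (_ + _); apply: eq_bigr => k _; rewrite !opp_mulE /opp_spin !mulrNN //.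
- by move=> _ [w' ->]; rewrite opp_mulE -(jp T).
- move=> y z yh [z' ->]; exists (z' * cl_gen _ (vsproj h y)).
  by rewrite rmorphM /= cl_sub_gen vsprojK.
- exact: (pf T).
- by move=> i; rewrite opp_mulE /opp_spin mulrN (ps_f Binv T D) oppr0.
- by move=> y yh; rewrite opp_mulE /opp_spin mulrN (ps_h T D yh) r'E linearNl /= scaleNr.
move=> i; rewrite r'E (lieC (f i)) !linearNl !linearNr /= !opprK.
exact: (tri_regular Binv T D).
Qed.

Lemma tri_gen_right (Q : Cl -> Prop) :
  (forall w, Q (p * j w)) -> (forall m m', Q m -> Q m' -> Q (m + m')) ->
  (forall a m, Q m -> Q (a *: m)) -> (forall x m, Q m -> Q (m * s x)) ->
  forall w, Q (p * w).
Proof.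
move=> QH QD QZ QM w.
have : right_gen (p * w).
  apply: right_gen_mul; have := @GenBase F g (opp_alg Cl) s' in_h' p' 1.
  by rewrite mul1r; apply; exists 1; rewrite rmorph1.
elim=> [_ [w' ->]|m m' _ IH _ IH'|a m _ IH|x m _ IH].
- exact: QH.
- exact: QD.
- exact: QZ.
by rewrite opp_mulE mulrN -scaleN1r; apply/QZ/QM.
Qed.

End TriangularGeneration.

(** * The commutant of the spin algebra *)

Section TriangularInvariants.
Variables (F : numFieldType) (g : lieAlgType F) (B : {symmetric g}).
Variables (h : {vspace g}) (n : nat) (e f : 'I_n -> g) (ht : 'I_n -> nat).
Variables (J : finType) (hu hv : J -> g).
Hypothesis Binv : ad_invariant B.
Hypothesis T : triangular_basis B h e f ht.
Hypothesis D : dual_bases B h hu hv.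

Local Notation Cl := (clifford B).
Local Notation c := (cl_gen B).
Local Notation t i := (lie (e i) (f i)).
Local Notation p := (tri_p B e f).
Local Notation j := (@cl_sub F g B h).
Local Notation s := (tri_spin B e f hu hv).
Local Notation r := (tri_rho e f).
Let cB := @cl_genB F g B.

Inductive spin_alg : Cl -> Prop :=
| SpinOne : spin_alg 1
| SpinAdd a b : spin_alg a -> spin_alg b -> spin_alg (a + b)
| SpinScale k a : spin_alg a -> spin_alg (k *: a)
| SpinMul x a : spin_alg a -> spin_alg (s x * a).

Lemma spin_algM a b : spin_alg a -> spin_alg b -> spin_alg (a * b).
Proof.
move=> sa sb; elim: sa => {a} [|a a' _ IH _ IH'|k a _ IH|x a _ IH].
- by rewrite mul1r.
- by rewrite mulrDl; apply: SpinAdd.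
- by rewrite -scalerAl; apply: SpinScale.
by rewrite -mulrA; apply: SpinMul.
Qed.

Lemma spin_alg_s x : spin_alg (s x).
Proof. by rewrite -[s x]mulr1; apply: SpinMul SpinOne. Qed.

Inductive lowered : Cl -> Prop :=
| LowP : lowered p
| LowD x y : lowered x -> lowered y -> lowered (x + y)
| LowZ k x : lowered x -> lowered (k *: x)
| LowF i x : lowered x -> lowered (s (f i) * x).

(** The usual highest weight argument: any [s y] can be commuted through the lowering operators to
    [p], on which raising operators vanish and h acts by scalars. *)
Lemma lowered_s y x : lowered x -> lowered (s y * x).
Proof.
have low0 : lowered 0 by rewrite -(scale0r p); apply: LowZ LowP.
move=> lx; elim: lx y => {x} [|x x' _ IH _ IH'|k x _ IH|i x lx IH] y.
- have [a [b [z [zh ->]]]] := tri_span T y.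
  rewrite !linearD /= !linear_sum /= !mulrDl !mulr_suml.
  apply: LowD; last by rewrite (sp_h T D) //; apply: LowZ LowP.
  apply: LowD; (elim/big_ind: _ => // [x x'|i _]; first exact: LowD);
    rewrite linearZ /= -scalerAl; apply: LowZ; last by apply: LowF LowP.
  by rewrite (sp_e Binv T D).
- by rewrite mulrDr; apply: LowD.
- by rewrite -scalerAr; apply: LowZ.
rewrite mulrA -[s y * _](subrK (s (f i) * s y)) -(tri_ss Binv T D) mulrDl.
by apply: LowD; [apply: IH|rewrite -mulrA; apply: LowF].
Qed.

Lemma lowered_p x : lowered x -> exists k, p * x = k *: p.
Proof.
elim=> {x} [|x y _ [k E] _ [l E']|k x _ [l E]|i x _ _].
- by exists 1; rewrite (pp T) scale1r.
- by exists (k + l); rewrite mulrDr E E' scalerDl.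
- by exists (k * l); rewrite -scalerAr E scalerA.
by exists 0; rewrite mulrA (ps_f Binv T D) mul0r scale0r.
Qed.

(** A p is spanned by p and by elements starting with some [s (f i)]; the latter are killed by p on
    the left. *)
Lemma spin_alg_p a : spin_alg a -> exists k, p * a * p = k *: p.
Proof.
move=> sa; rewrite -mulrA; apply: lowered_p.
elim: sa => {a} [|a b _ IH _ IH'|k a _ IH|x a _ IH].
- by rewrite mul1r; apply: LowP.
- by rewrite mulrDl; apply: LowD.
- by rewrite -scalerAl; apply: LowZ.
by rewrite -mulrA; apply: lowered_s.
Qed.

Inductive raised : Cl -> Prop :=
| RaiseP : raised p
| RaiseD x y : raised x -> raised y -> raised (x + y)
| RaiseZ k x : raised x -> raised (k *: x)
| RaiseE i x : raised x -> raised (x * s (e i)).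

Lemma raised_s y x : raised x -> raised (x * s y).
Proof.
have ra0 : raised 0 by rewrite -(scale0r p); apply: RaiseZ RaiseP.
move=> rx; elim: rx y => {x} [|x x' _ IH _ IH'|k x _ IH|i x rx IH] y.
- have [a [b [z [zh ->]]]] := tri_span T y.
  rewrite !linearD /= !linear_sum /= !mulrDr !mulr_sumr.
  apply: RaiseD; last by rewrite (ps_h T D) //; apply: RaiseZ RaiseP.
  apply: RaiseD; (elim/big_ind: _ => // [x x'|i _]; first exact: RaiseD);
    rewrite linearZ /= -scalerAr; apply: RaiseZ; first by apply: RaiseE RaiseP.
  by rewrite (ps_f Binv T D).
- by rewrite mulrDl; apply: RaiseD.
- by rewrite -scalerAl; apply: RaiseZ.
rewrite -mulrA -[s (e i) * _](subrK (s y * s (e i))) -(tri_ss Binv T D) mulrDr.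
by apply: RaiseD; [apply: IH|rewrite mulrA; apply: RaiseE].
Qed.

Lemma raised_alg a x : spin_alg a -> raised x -> raised (x * a).
Proof.
move=> sa; elim: sa x => {a} [|a b _ IH _ IH'|k a _ IH|y a _ IH] x rx.
- by rewrite mulr1.
- by rewrite mulrDr; apply: RaiseD; [apply: IH|apply: IH'].
- by rewrite -scalerAr; apply/RaiseZ/IH.
by rewrite mulrA; apply/IH/raised_s.
Qed.

Lemma raised_kill x w : raised x -> p * w = 0 -> (forall i, s (e i) * w = 0) ->
  x * w = 0.
Proof.
move=> rx pw ew; elim: rx => {x} [//|x y _ IH _ IH'|k x _ IH|i x _ _].
- by rewrite mulrDl IH IH' addr0.
- by rewrite -scalerAl IH scaler0.
by rewrite -mulrA ew mulr0.
Qed.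

Inductive p_ideal : Cl -> Prop :=
| PId a b : p_ideal (a * p * b)
| PIdD x y : p_ideal x -> p_ideal y -> p_ideal (x + y).

(** The ideal generated by [p] is stable under the parity involution, as [p] is even, and contains
    [p], which is nonzero; simplicity puts 1 in it. *)
Lemma p_ideal1 : p_ideal 1.
Proof.
apply: contrapT => n1; apply: (p_neq0 T).
apply: (cl_supersimple (tri_uvE T D) (tri_vuE T D) (K := p_ideal)) n1.
- exact: PIdD.
- move=> k x; elim=> {x} [a b|x y _ IH _ IH'].
    by rewrite scalerAr; apply: PId.
  by rewrite scalerDr; apply: PIdD.
- move=> w x; elim=> {x} [a b|x y _ IH _ IH'].
    by rewrite !mulrA; apply: PId.
  by rewrite mulrDr; apply: PIdD.
- move=> x w; elim=> {x} [a b|x y _ IH _ IH'].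
    by rewrite -mulrA; apply: PId.
  by rewrite mulrDl; apply: PIdD.
- move=> x; elim=> {x} [a b|x y _ IH _ IH'].
    by rewrite !rmorphM /= (p_inv B e f); apply: PId.
  by rewrite linearD; apply: PIdD.
by rewrite -[X in p_ideal X]mulr1 -[X in X * 1]mul1r; apply: PId.
Qed.

Lemma faithful_left w : (forall a, w * a * p = 0) -> w = 0.
Proof.
move=> wp; rewrite -[w]mulr1; elim: p_ideal1 => [a b|x y _ IH _ IH'].
  by rewrite !mulrA wp mul0r.
by rewrite mulrDr IH IH' addr0.
Qed.

Lemma faithful_right w : (forall a, p * a * w = 0) -> w = 0.
Proof.
move=> wp; rewrite -[w]mul1r; elim: p_ideal1 => [a b|x y _ IH _ IH'].
  by rewrite -!mulrA (mulrA p) wp mulr0.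
by rewrite mulrDl IH IH' addr0.
Qed.

(** p Cl(g) is generated by p Cl(h) under right multiplication by A, and Cl(h) can be moved to the
    left of p; so what p A kills is killed by all of p Cl(g). *)
Lemma spin_faithful_right w : (forall a, spin_alg a -> p * a * w = 0) -> w = 0.
Proof.
move=> pw; apply: faithful_right => a; move: w pw.
apply: (tri_gen_right Binv T D (Q := fun m => forall w,
  (forall a, spin_alg a -> p * a * w = 0) -> m * w = 0)) =>
    [m' z pz|m m' IH IH' z pz|k m IH z pz|x m IH z pz].
- by rewrite -(jp T) -mulrA -[p]mulr1 pz ?mulr0 //; apply: SpinOne.
- by rewrite mulrDl IH // IH' // addr0.
- by rewrite -scalerAl IH // scaler0.
rewrite -mulrA IH // => b sb; rewrite mulrA -[p * b * _]mulrA pz //.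
by apply: spin_algM => //; apply: spin_alg_s.
Qed.

Definition commutes_spin (w : Cl) := forall x, s x * w = w * s x.

(** The difference of both sides is killed by p and by every [s (e i)], hence by p A, which is
    spanned by p followed by raising operators. *)
Lemma commutes_wp w : commutes_spin w -> w * p = p * w * p.
Proof.
move=> cw; apply/eqP; rewrite -subr_eq0; apply/eqP.
apply: spin_faithful_right => a sa; apply: raised_kill.
- by apply: raised_alg => //; apply: RaiseP.
- by rewrite mulrBr !mulrA (pp T) subrr.
move=> i; rewrite mulrBr [X in X - _](_ : _ = 0) 1?[X in _ - X](_ : _ = 0) ?subr0 //.
  by rewrite !mulrA (sp_e Binv T D) !mul0r.
by rewrite mulrA cw -mulrA (sp_e Binv T D) mulr0.
Qed.

(** Here w p = 0, and w passes through A, so w kills A Cl(h) p = Cl(g) p. *)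
Lemma commutes_inj w : commutes_spin w -> p * w * p = 0 -> w = 0.
Proof.
move=> cw; rewrite -commutes_wp // => wp; apply: faithful_left => a.
rewrite -mulrA; apply: (tri_gen_left Binv T D (Q := fun m => w * m = 0))
  => [m'|m m' IH IH'|k m IH|x m IH].
- by rewrite (jp T) mulrA wp mul0r.
- by rewrite mulrDr IH IH' addr0.
- by rewrite -scalerAr IH scaler0.
by rewrite mulrA -cw -mulrA IH mulr0.
Qed.

(** A Casimir-type element for the pairing p a a' p on A: with dual families, inserting w p between
    them yields something commuting with A. *)
Lemma commutes_surj w : exists2 u, commutes_spin u & p * u * p = p * j w * p.
Proof.
have [N [S SE]] := cl_fin_span B.
have spin0 : spin_alg 0 by rewrite -(scale0r 1); apply: SpinScale SpinOne.
have spinP k a b : spin_alg a -> spin_alg b -> spin_alg (k *: a + b).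
  by move=> sa sb; apply: SpinAdd => //; apply: SpinScale.
have [m [a [sa aE]]] := finitely_spanned_sub SE spin0 spinP.
have [chi chiE] : exists chi : 'I_m -> 'I_m -> F,
    forall i k, p * (a i * a k) * p = chi i k *: p.
  have h1 i : exists x : 'I_m -> F, forall k, p * (a i * a k) * p = x k *: p.
    have h2 k : exists y : F, p * (a i * a k) * p = y *: p.
      by apply: spin_alg_p; apply: spin_algM.
    by have [y yE] := choice h2; exists y.
  by have [y yE] := choice h1; exists y.
(* The [a i] may be dependent and [G] singular, so a generalized inverse [X] is taken, with G X G =
   G. *)
pose G := \matrix_(i, k) chi i k; pose X := pinvmx G.
have GXG : G *m X *m G = G by apply: mulmxKpV.
have [q qD] : exists q : Cl -> Cl,
    forall w, q w = \sum_i \sum_k X i k *: (a i * w * p * a k) by eexists.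
(* [q 1] fixes A p: left multiplication by [p * a l] turns the difference into an entry of G X G -
   G, and [spin_faithful_right] applies. *)
have q_a k : q 1 * (a k * p) = a k * p.
  have qE : q 1 * (a k * p) = \sum_i (X *m G) i k *: (a i * p).
    rewrite qD mulr_suml; apply: eq_bigr => i _; rewrite mulr_suml.
    rewrite mxE scaler_suml; apply: eq_bigr => l _.
    rewrite mulr1 -scalerAl -!mulrA (mulrA (a l)) (mulrA p) chiE.
    by rewrite -scalerAr scalerA [G l k]mxE.
  apply/eqP; rewrite -subr_eq0; apply/eqP; apply: spin_faithful_right => b sb.
  have [y ->] := aE b sb; rewrite mulr_sumr mulr_suml big1 // => l _.
  rewrite -scalerAr -scalerAl mulrBr qE.
  rewrite mulr_sumr.
  under eq_bigr => i _ do rewrite -scalerAr -mulrA (mulrA (a l)) (mulrA p) chiE scalerA.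
  rewrite -scaler_suml -mulrA (mulrA (a l)) (mulrA p) chiE.
  have -> : \sum_i (X *m G) i k * chi l i = (G *m X *m G) l k.
    by rewrite -mulmxA mxE; apply: eq_bigr => i _; rewrite [G l i]mxE mulrC.
  by rewrite GXG mxE subrr scaler0.
have q_alg b : spin_alg b -> q 1 * (b * p) = b * p.
  move=> /aE[y ->]; rewrite mulr_suml mulr_sumr; apply: eq_bigr => k _.
  by rewrite -scalerAl -scalerAr q_a.
have q1 : q 1 = 1.
  apply/eqP; rewrite -subr_eq0; apply/eqP; apply: faithful_left => b.
  (* A factor [d] of the spin algebra is carried along, to absorb the [s x] met in the induction. *)
  suff /(_ 1 SpinOne) : forall d, spin_alg d -> (q 1 - 1) * (d * (b * p)) = 0.
    by rewrite mul1r mulrA.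
  apply: (tri_gen_left Binv T D (Q := fun z => forall d, spin_alg d ->
    (q 1 - 1) * (d * z) = 0)) => [z d sd|z z' IH IH' d sd|k z IH d sd|x z IH d sd].
  - by rewrite (jp T) !mulrA -!(mulrA _ d) mulrBl q_alg // mul1r subrr mul0r.
  - by rewrite !mulrDr IH // IH' // addr0.
  - by rewrite -!scalerAr IH // scaler0.
  by rewrite (mulrA d); apply: IH; apply: spin_algM => //; apply: spin_alg_s.
have pap k : exists x, p * a k * p = x *: p by apply: spin_alg_p.
have [ch chE] := choice pap.
exists (q (j w)).
  move=> x.
  have [psi psiE] : exists psi : 'I_m -> 'I_m -> F,
      forall i k, p * (a i * s x * a k) * p = psi i k *: p.
    have h1 i : exists y : 'I_m -> F, forall k, p * (a i * s x * a k) * p = y k *: p.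
      have h2 k : exists y : F, p * (a i * s x * a k) * p = y *: p.
        by apply/spin_alg_p/spin_algM => //; apply/spin_algM/spin_alg_s.
      by have [y yE] := choice h2; exists y.
    by have [y yE] := choice h1; exists y.
  (* Insert 1 = [q 1] on the left of one product and on the right of the other: both become the same
     sum, because p a_l s(x) a_i p is a scalar times p and so passes [j w]. *)
  transitivity (\sum_k \sum_l \sum_i \sum_o
     (X k l * X i o * psi l i) *: (a k * j w * p * a o)).
    rewrite -[s x * _]mul1r -q1 qD mulr_suml; apply: eq_bigr => k _.
    rewrite mulr_suml; apply: eq_bigr => l _.
    rewrite qD !mulr_sumr; apply: eq_bigr => i _.
    rewrite !mulr_sumr; apply: eq_bigr => o _.
    rewrite mulr1 -scalerAl -!scalerAr scalerA -[RHS]scalerA; congr (_ *: _).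
    have -> : a k * p * a l * (s x * (a i * j w * p * a o))
        = a k * (p * (a l * s x * a i) * p) * j w * a o.
      by rewrite -!mulrA (mulrA p (j w)) -(jp T) -!mulrA.
    by rewrite psiE -scalerAr -!scalerAl -!mulrA (mulrA p) -(jp T) -!mulrA.
  rewrite -[RHS]mulr1 -q1 !qD !mulr_suml; apply: eq_bigr => k _.
  rewrite !mulr_suml; apply: eq_bigr => l _.
  rewrite mulr_sumr; apply: eq_bigr => i _.
  rewrite mulr_sumr; apply: eq_bigr => o _.
  rewrite mulr1 -!scalerAl -!scalerAr [RHS]scalerA -[LHS]scalerA; congr (_ *: _).
  have -> : a k * j w * p * a l * s x * (a i * p * a o)
      = a k * j w * (p * (a l * s x * a i) * p) * a o.
    by rewrite -!mulrA.
  by rewrite psiE -scalerAr -!scalerAl.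
(* The compression of [q (j z)] is a constant times p [j z]. The value at z = 1, where [q 1 = 1],
   shows that the constant acts on p as 1. *)
have qval z : p * q (j z) * p = (\sum_i \sum_k X i k * (ch i * ch k)) *: (p * j z).
  rewrite qD mulr_sumr mulr_suml scaler_suml; apply: eq_bigr => i _.
  rewrite mulr_sumr mulr_suml scaler_suml; apply: eq_bigr => k _.
  rewrite -scalerAr -scalerAl -[RHS]scalerA; congr (_ *: _).
  have -> : p * (a i * j z * p * a k) * p = p * a i * p * j z * (p * a k * p).
    by rewrite -!mulrA (mulrA p (j z)) -(jp T) -!mulrA (mulrA p p) (pp T).
  rewrite !chE -!scalerAl -scalerAr scalerA; congr (_ *: _).
  by rewrite -mulrA (jp T) mulrA (pp T).
have {}E : (\sum_i \sum_k X i k * (ch i * ch k)) *: p = p.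
  by have := qval 1; rewrite rmorph1 mulr1 q1 mulr1 (pp T).
by rewrite qval -mulrA (jp T) mulrA (pp T) scalerAl E.
Qed.

End TriangularInvariants.

(** * The Harish-Chandra map as compression by p *)

Section HarishChandraIsomorphism.
Variables (F : numFieldType) (g : lieAlgType F) (B : {symmetric g}).
Variables (h b : {vspace g}) (n : nat) (e f : 'I_n -> g) (ht : 'I_n -> nat).
Variables (J : finType) (hu hv : J -> g).
Hypothesis Binv : ad_invariant B.
Hypothesis T : triangular_basis B h e f ht.
Hypothesis D : dual_bases B h hu hv.
Hypothesis e_nplus : forall i, e i \in nplus h b.
Hypothesis f_nminus : forall i, f i \in nminus h b.
Hypothesis nplus_e : forall x, x \in nplus h b -> exists a, x = \sum_i a i *: e i.
Hypothesis nminus_f : forall x, x \in nminus h b -> exists a, x = \sum_i a i *: f i.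

Local Notation Cl := (clifford B).
Local Notation Clh := (clifford (restr_form B h)).
Local Notation c := (cl_gen B).
Local Notation p := (tri_p B e f).
Local Notation j := (@cl_sub F g B h).
Local Notation jn := (@cl_sub F g B (nplus h b)).
Local Notation jm := (@cl_sub F g B (nminus h b)).
Local Notation s := (tri_spin B e f hu hv).
Let cB := @cl_genB F g B.

Lemma nplus_p x : x \in nplus h b -> c x * p = 0.
Proof.
move=> /nplus_e[a ->]; rewrite linear_sum mulr_suml big1 // => i _.
by rewrite linearZ /= -scalerAl (ep T) scaler0.
Qed.

Lemma p_nminus x : x \in nminus h b -> p * c x = 0.
Proof.
move=> /nminus_f[a ->]; rewrite linear_sum mulr_sumr big1 // => i _.
by rewrite linearZ /= -scalerAr (pf T) scaler0.
Qed.

Lemma nplus_isotropic x y : x \in nplus h b -> y \in nplus h b -> B x y = 0.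
Proof.
move=> /nplus_e[a ->] /nplus_e[a' ->]; rewrite linear_sumlz big1 //= => i _.
rewrite linearZl_LR linear_sumr /= big1 ?mulr0 // => k _.
by rewrite linearZr_LR /= (tri_ee T) mulr0.
Qed.

Lemma nminus_isotropic x y : x \in nminus h b -> y \in nminus h b -> B x y = 0.
Proof.
move=> /nminus_f[a ->] /nminus_f[a' ->]; rewrite linear_sumlz big1 //= => i _.
rewrite linearZl_LR linear_sumr /= big1 ?mulr0 // => k _.
by rewrite linearZr_LR /= (tri_ff T) mulr0.
Qed.

Section Augmentation.
Variable U : {vspace g}.
Hypothesis U0 : forall x y, x \in U -> y \in U -> B x y = 0.

Fact aug_sqr (x : subvs_of U) :
  (\0 : {linear subvs_of U -> F^o}) x * (\0 : {linear subvs_of U -> F^o}) x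
  = (restr_form B U x x)%:A.
Proof. by rewrite /restr_form U0 ?subvsP // scale0r mulr0. Qed.

Lemma cl_aug_ext w : @cl_aug F _ (restr_form B U) w = cl_ext aug_sqr w.
Proof. by []. Qed.

Lemma cl_aug_gen x w : @cl_aug F _ (restr_form B U) (cl_gen _ x * w) = 0.
Proof. by rewrite cl_aug_ext rmorphM /= cl_ext_gen mul0r. Qed.

End Augmentation.

Lemma nplus_aug w : jn w * p = (cl_aug w : F) *: p.
Proof.
elim/cl_gen_ind: w => [|a w IH|w w' IH IH'|x w IH].
- by rewrite rmorph1 mul1r (cl_aug_ext nplus_isotropic) rmorph1 scale1r.
- rewrite (cl_aug_ext nplus_isotropic) !linearZ /= -scalerAl IH scalerA.
  by rewrite (cl_aug_ext nplus_isotropic).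
- rewrite (cl_aug_ext nplus_isotropic) !linearD /= mulrDl IH IH' scalerDl.
  by rewrite !(cl_aug_ext nplus_isotropic).
rewrite (cl_aug_gen nplus_isotropic) scale0r rmorphM /= -mulrA IH -scalerAr.
by rewrite cl_sub_gen nplus_p ?subvsP // scaler0.
Qed.

Lemma nminus_aug w : p * jm w = (cl_aug w : F) *: p.
Proof.
elim/cl_gen_ind: w => [|a w IH|w w' IH IH'|x w IH].
- by rewrite rmorph1 mulr1 (cl_aug_ext nminus_isotropic) rmorph1 scale1r.
- rewrite (cl_aug_ext nminus_isotropic) !linearZ /= -scalerAr IH scalerA.
  by rewrite (cl_aug_ext nminus_isotropic).
- rewrite (cl_aug_ext nminus_isotropic) !linearD /= mulrDr IH IH' scalerDl.
  by rewrite !(cl_aug_ext nminus_isotropic).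
rewrite (cl_aug_gen nminus_isotropic) scale0r rmorphM /= mulrA cl_sub_gen.
by rewrite p_nminus ?subvsP // mul0r.
Qed.

(** Those [w] form a two-sided ideal of Cl(h), stable under the parity involution and without 1.
    Since [B] is non-degenerate on h, simplicity of Cl(h) applies. *)
Lemma jp_inj w : j w * p = 0 -> w = 0.
Proof.
move=> wp.
pose u' k := vsproj h (hu k); pose v' k := vsproj h (hv k).
have u'E k : vsval (u' k) = hu k by rewrite vsprojK // (dual_u D).
have v'E k : vsval (v' k) = hv k by rewrite vsprojK // (dual_v D).
apply: (@cl_supersimple F _ (restr_form B h) J u' v' _ _ (fun w => j w * p = 0)).
- move=> x; apply: val_inj; rewrite /= linear_sum -[RHS](dual_uE D (subvsP x)).
  by apply: eq_bigr => k _; rewrite linearZ /= /restr_form u'E v'E.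
- move=> x; apply: val_inj; rewrite /= linear_sum -[RHS](dual_vE D (subvsP x)).
  by apply: eq_bigr => k _; rewrite linearZ /= /restr_form u'E v'E.
- by move=> x y xp yp; rewrite linearD mulrDl xp yp addr0.
- by move=> a x xp; rewrite linearZ /= -scalerAl xp scaler0.
- by move=> x y yp; rewrite rmorphM /= -mulrA yp mulr0.
- by move=> x y xp; rewrite rmorphM /= -mulrA (jp T) mulrA xp mul0r.
- by move=> x xp; rewrite cl_sub_inv -(p_inv B e f) -rmorphM /= xp rmorph0.
- exact: wp.
by rewrite rmorph1 mul1r; apply: p_neq0 T.
Qed.

Inductive fh_span : Cl -> Prop :=
| FhBase w : fh_span (j w * p)
| FhAdd x y : fh_span x -> fh_span y -> fh_span (x + y)
| FhScale a x : fh_span x -> fh_span (a *: x)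
| FhF i x : fh_span x -> fh_span (c (f i) * x).

Lemma fh_span0 : fh_span 0.
Proof. by rewrite -(scale0r (j 1 * p)); apply/FhScale/FhBase. Qed.

Lemma fh_span_sum (I : finType) (G : I -> Cl) :
  (forall i, fh_span (G i)) -> fh_span (\sum_i G i).
Proof. by move=> GI; elim/big_ind: _ => //; [apply: fh_span0|apply: FhAdd]. Qed.

Lemma fh_spanM y x : fh_span x -> fh_span (c y * x).
Proof.
elim=> {x} [w|x x' _ IH _ IH'|a x _ IH|i x fx IH].
- have [a [a' [z [zh ->]]]] := tri_span T y.
  rewrite !linearD !linear_sum /= !mulrDl !mulr_suml.
  apply: FhAdd; first apply: FhAdd; first 1 last.
  + by apply: fh_span_sum => i; rewrite linearZ /= -scalerAl; apply/FhScale/FhF/FhBase.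
  + rewrite mulrA; have -> : c z * j w = j (cl_gen _ (vsproj h z) * w).
      by rewrite rmorphM /= cl_sub_gen vsprojK.
    exact: FhBase.
  apply: fh_span_sum => i; rewrite linearZ /= -scalerAl (ejp T) scaler0.
  exact: fh_span0.
- by rewrite mulrDr; apply: FhAdd.
- by rewrite -scalerAr; apply: FhScale.
rewrite mulrA (cl_swap cB) mulrBl mulr_algl -mulrA.
by apply: FhAdd; [apply: FhScale|rewrite -scaleN1r; apply/FhScale/FhF].
Qed.

(** Cl(g) p is spanned by products of [f]s times Cl(h) p, and p on the left kills every term in
    which an [f] occurs. *)
Lemma hc_exists u : exists w, p * u * p = j w * p.
Proof.
have : fh_span (u * p).
  elim/cl_gen_ind: u => [|a u IH|u u' IH IH'|x u IH].
  - by rewrite -[1](rmorph1 j); apply: FhBase.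
  - by rewrite -scalerAl; apply: FhScale.
  - by rewrite mulrDl; apply: FhAdd.
  by rewrite -mulrA; apply: fh_spanM.
rewrite -mulrA; elim=> {u} [w|x y _ [w E] _ [w' E']|a x _ [w E]|i x _ _].
- by exists w; rewrite mulrA -(jp T) -mulrA (pp T).
- by exists (w + w'); rewrite linearD mulrDl mulrDr E E'.
- by exists (a *: w); rewrite linearZ /= -scalerAl -scalerAr E.
by exists 0; rewrite linear0 mul0r mulrA (pf T) mul0r.
Qed.

Inductive hn_span : Cl -> Prop :=
| HnBase w : hn_span (jn w)
| HnAdd x y : hn_span x -> hn_span y -> hn_span (x + y)
| HnScale a x : hn_span x -> hn_span (a *: x)
| HnH z x : z \in h -> hn_span x -> hn_span (c z * x).

Inductive fhn_span : Cl -> Prop :=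
| FhnBase x : hn_span x -> fhn_span x
| FhnAdd x y : fhn_span x -> fhn_span y -> fhn_span (x + y)
| FhnScale a x : fhn_span x -> fhn_span (a *: x)
| FhnF i x : fhn_span x -> fhn_span (c (f i) * x).

Lemma hn_span_e i x : hn_span x -> hn_span (c (e i) * x).
Proof.
elim=> {x} [w|x x' _ IH _ IH'|a x _ IH|z x zh fx IH].
- have -> : c (e i) * jn w = jn (cl_gen _ (vsproj _ (e i)) * w).
    by rewrite rmorphM /= cl_sub_gen vsprojK.
  exact: HnBase.
- by rewrite mulrDr; apply: HnAdd.
- by rewrite -scalerAr; apply: HnScale.
rewrite mulrA (cl_swap0 cB) ?(Bhe T) // mulNr -scaleN1r -mulrA.
exact/HnScale/HnH.
Qed.

Lemma fhn_spanM y x : fhn_span x -> fhn_span (c y * x).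
Proof.
have fhn0 : fhn_span 0.
  by rewrite -(scale0r (jn 1)); apply/FhnScale/FhnBase/HnBase.
have [a [a' [z [zh ->]]]] := tri_span T y => fx.
rewrite !linearD !linear_sum /= !mulrDl !mulr_suml.
have fM y' : (forall x', hn_span x' -> fhn_span (c y' * x')) -> fhn_span (c y' * x).
  move=> hy'; elim: fx => {x} [x hx|x x' _ IH _ IH'|k x _ IH|i x fx IH].
  - exact: hy'.
  - by rewrite mulrDr; apply: FhnAdd.
  - by rewrite -scalerAr; apply: FhnScale.
  rewrite mulrA (cl_swap cB) mulrBl mulr_algl -mulrA.
  by apply: FhnAdd; [apply: FhnScale|rewrite -scaleN1r; apply/FhnScale/FhnF].
apply: FhnAdd; last by apply: fM => x' hx'; apply/FhnBase/HnH.
apply: FhnAdd; (elim/big_ind: _ => // [m m'|i _]; first exact: FhnAdd);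
  rewrite linearZ /= -scalerAl; apply: FhnScale; last exact: FhnF.
by apply: fM => x' hx'; apply/FhnBase/hn_span_e.
Qed.

(** Surjectivity of the triangular multiplication map. It makes the Harish-Chandra map unique. *)
Lemma triple_ind (Q : Cl -> Prop) :
  (forall x y, Q x -> Q y -> Q (x + y)) -> (forall a x, Q x -> Q (a *: x)) ->
  (forall u v w, Q (jm u * j v * jn w)) -> forall u, Q u.
Proof.
move=> QD QZ Q3 u.
have : fhn_span u.
  elim/cl_gen_ind: u => [|a u IH|u u' IH IH'|x u IH].
  - by rewrite -[1](rmorph1 jn); apply/FhnBase/HnBase.
  - exact: FhnScale.
  - exact: FhnAdd.
  exact: fhn_spanM.
have Q2 x : hn_span x -> forall v w, Q (jm v * j w * x).
  elim=> {x} [w|x x' _ IH _ IH'|a x _ IH|z x zh fx IH] v v'; first exact: Q3.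
  - by rewrite mulrDr; apply: QD.
  - by rewrite -scalerAr; apply: QZ.
  have -> : jm v * j v' * (c z * x) = jm v * j (v' * cl_gen _ (vsproj h z)) * x.
    by rewrite rmorphM /= cl_sub_gen vsprojK // !mulrA.
  exact: IH.
have Q1 x : fhn_span x -> forall v, Q (jm v * x).
  elim=> {x} [x hx|x x' _ IH _ IH'|a x _ IH|i x fx IH] v.
  - by have := Q2 x hx v 1; rewrite rmorph1 mulr1.
  - by rewrite mulrDr; apply: QD.
  - by rewrite -scalerAr; apply: QZ.
  have -> : jm v * (c (f i) * x) = jm (v * cl_gen _ (vsproj _ (f i))) * x.
    by rewrite rmorphM /= cl_sub_gen vsprojK // !mulrA.
  exact: IH.
by move=> /Q1/(_ 1); rewrite rmorph1 mul1r.
Qed.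

Lemma invariant_commutes u : cl_invariant B u <-> @commutes_spin F g B n e f J hu hv u.
Proof.
have sc := tri_sc Binv T D.
split=> iu x; last by rewrite (cl_der_spin Binv sc) iu subrr.
by apply/eqP; rewrite -subr_eq0 -(cl_der_spin Binv sc) iu.
Qed.

Lemma spin_inv x : cl_inv (s x) = s x.
Proof.
rewrite tri_spinE linearZ /=; congr (_ *: _).
rewrite !rmorphD !rmorph_sum /=; congr (_ + _ + _); apply: eq_bigr => i _;
  by rewrite rmorphM /= !cl_inv_gen mulrNN.
Qed.

Theorem harish_chandra_iso :
  exists Phi : {linear clifford B -> clifford (restr_form B h)},
    [/\ is_harish_chandra b Phi,
        (forall Psi : {linear clifford B -> clifford (restr_form B h)},
           is_harish_chandra b Psi -> Psi =1 Phi) &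
        superalgebra_iso_on (cl_parity B) (cl_parity (restr_form B h))
          (cl_invariant B) Phi].
Proof.
have [Phi0 Phi0E] := choice hc_exists.
have uniq w w' : j w * p = j w' * p -> w = w'.
  move=> E; apply/eqP; rewrite -subr_eq0; apply/eqP/jp_inj.
  by rewrite linearB mulrBl E subrr.
have Phi_lin : linear Phi0.
  move=> a x y; apply: uniq; rewrite linearP mulrDl -scalerAl -!Phi0E.
  by rewrite mulrDr mulrDl -scalerAr -scalerAl.
have [Phi PhiE] : exists Phi : {linear Cl -> Clh}, forall u, p * u * p = j (Phi u) * p.
  by exists (HB.pack_for {linear Cl -> Clh} Phi0
               (GRing.isLinear.Build F Cl Clh _ _ Phi_lin)).
have hcPhi : is_harish_chandra b Phi.
  move=> u v w; rewrite !cl_sub_incl; apply: uniq; rewrite -PhiE.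
  rewrite !mulrA nminus_aug -!mulrA nplus_aug -!scalerAl -!scalerAr scalerA.
  by rewrite mulrA -(jp T) -mulrA (pp T) linearZ /= -scalerAl.
have inv_wp u : cl_invariant B u -> u * p = j (Phi u) * p.
  by move=> /invariant_commutes cu; rewrite (commutes_wp Binv T D cu) PhiE.
have Phi_inj u v : cl_invariant B u -> cl_invariant B v -> Phi u = Phi v -> u = v.
  move=> /invariant_commutes cu /invariant_commutes cv E.
  apply/eqP; rewrite -subr_eq0; apply/eqP; apply: (commutes_inj Binv T D).
    by move=> x; rewrite mulrBr mulrBl cu cv.
  by rewrite mulrBr mulrBl !PhiE E subrr.
have Phi_inv u : Phi (cl_inv u) = cl_inv (Phi u).
  apply: uniq; rewrite -PhiE cl_sub_inv -{1 2 3}(p_inv B e f) -!rmorphM /=.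
  by rewrite PhiE.
exists Phi; split=> //.
  move=> Psi hcPsi; apply: triple_ind => [x y Ex Ey|a x Ex|u v w].
  - by rewrite !linearD /= Ex Ey.
  - by rewrite !linearZ /= Ex.
  by have := hcPsi u v w; rewrite !cl_sub_incl => ->; rewrite -hcPhi.
split=> //.
- by apply: uniq; rewrite -PhiE rmorph1 mulr1 (pp T) mul1r.
(* p u v p = p u Phi(v) p = p u p Phi(v) = Phi(u) Phi(v) p, by [inv_wp] for [v]. *)
- move=> u v iu iv; apply: uniq; rewrite -PhiE rmorphM /= mulrA -mulrA.
  by rewrite (inv_wp v iv) (jp T) mulrA PhiE -mulrA -(jp T) mulrA.
(* Phi intertwines the parity involutions. For the converse, [cl_inv u] is again invariant since
   every [s x] is even, so injectivity on invariants applies. *)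
- move=> q u iu; split=> /cl_parityP E; apply/cl_parityP.
    by rewrite -Phi_inv E linearZ.
  have /invariant_commutes cu := iu.
  apply: Phi_inj; last by rewrite Phi_inv E linearZ.
    apply/invariant_commutes => x.
    by rewrite -(spin_inv x) -!rmorphM /= cu.
  by apply/invariant_commutes => x; rewrite -scalerAr -scalerAl cu.
move=> w; have [u cu uE] := commutes_surj Binv T D w.
exists u; first exact/invariant_commutes.
by apply: uniq; rewrite -PhiE uE -(jp T) -mulrA (pp T).
Qed.

End HarishChandraIsomorphism.
(** * Traces and weight spaces *)

Section Trace.
Variable F : fieldType.

Definition vtr (V : vectType F) (T : V -> V) : F :=
  \sum_i coord (vbasis {:V}) i (T (vbasis {:V})`_i).

Lemma vtr_cyclic (V W : vectType F) (S : {linear V -> W}) (T : {linear W -> V}) :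
  vtr (S \o T) = vtr (T \o S).
Proof.
have E (V1 V2 : vectType F) (A : {linear V1 -> V2}) (C : {linear V2 -> V1}) :
    vtr (C \o A) = \sum_(i < \dim {:V1}) \sum_(k < \dim {:V2})
      coord (vbasis {:V2}) k (A (vbasis {:V1})`_i) *
        coord (vbasis {:V1}) i (C (vbasis {:V2})`_k).
  apply: eq_bigr => i _ /=.
  rewrite {1}(coord_vbasis (memvf (A _))) !linear_sum.
  by apply: eq_bigr => k _; rewrite !linearZ.
rewrite !E exchange_big; apply: eq_bigr => i _; apply: eq_bigr => k _.
by rewrite mulrC.
Qed.

Lemma eq_vtr (V : vectType F) (S T : V -> V) : S =1 T -> vtr S = vtr T.
Proof. by move=> E; apply: eq_bigr => i _; rewrite E. Qed.

Lemma vtrD (V : vectType F) (S T : V -> V) : vtr (fun x => S x + T x) = vtr S + vtr T.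
Proof. by rewrite /vtr -big_split; apply: eq_bigr => i _; rewrite linearD. Qed.

Lemma vtrZ (V : vectType F) a (T : V -> V) : vtr (fun x => a *: T x) = a * vtr T.
Proof. by rewrite /vtr mulr_sumr; apply: eq_bigr => i _; rewrite linearZ. Qed.

Lemma vtr_id (V : vectType F) : vtr (fun x : V => x) = (\dim {:V})%:R.
Proof.
rewrite /vtr (eq_bigr (fun=> 1)) => [|i _].
  by rewrite sumr_const card_ord.
by rewrite coord_free ?eqxx // (basis_free (vbasisP _)).
Qed.

Lemma iter_linear (V : vectType F) (T : {linear V -> V}) k : linear (iter k T).
Proof. by elim: k => [|k IH] a x y //=; rewrite IH linearP. Qed.

Definition locally_nilpotent (V : vectType F) (T : V -> V) :=
  forall x, exists k, iter k T x = 0.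

Lemma iter0 (V : vectType F) (T : {linear V -> V}) k : iter k T 0 = 0.
Proof. by elim: k => //= k ->; rewrite linear0. Qed.

Lemma locally_nilpotent_uniform (V : vectType F) (T : {linear V -> V}) :
  locally_nilpotent T -> exists k, forall x, iter k T x = 0.
Proof.
move=> nT; have [k kE] := choice (fun i : 'I_(\dim {:V}) => nT (vbasis {:V})`_i).
exists (\max_i k i)%N => x; rewrite [x](coord_vbasis (memvf x)).
rewrite (lin_sum (iter_linear T _)) big1 // => i _.
by rewrite -(subnK (leq_bigmax i)) iterD kE iter0 scaler0.
Qed.

(** T factors through its image, which is a smaller space; cyclicity of the trace moves the
    computation there. *)
Lemma vtr_nilpotent (V : vectType F) (T : {linear V -> V}) :
  locally_nilpotent T -> vtr T = 0.
Proof.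
have [m] := ubnP (\dim {:V}); elim: m => // m IH in V T * => dimV nT.
have [k kE] := locally_nilpotent_uniform nT.
have [V0|V_gt0] := posnP (\dim {:V}).
  rewrite /vtr big1 // => i _; suff : (i < 0)%N by [].
  by rewrite -[X in (_ < X)%N]V0 ltn_ord.
pose U := limg (linfun T).
have TU x : T x \in U by rewrite /U -(lfunE T) memv_img ?memvf.
pose S : V -> subvs_of U := fun x => vsproj U (T x).
have S_lin : linear S by move=> a x y; rewrite /S !linearP.
pose S' : {linear V -> subvs_of U} := HB.pack_for {linear V -> subvs_of U} S
  (GRing.isLinear.Build F V (subvs_of U) _ _ S_lin).
have -> : vtr T = vtr (@vsval F V U \o S').
  by apply: eq_vtr => x; rewrite /= vsprojK.
rewrite vtr_cyclic; apply: (IH _ (S' \o @vsval F V U)); last first.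
  move=> x; exists k; apply: val_inj; rewrite [RHS]linear0 -[RHS](kE (vsval x)).
  by elim: k {kE} => //= k IHk; rewrite /S vsprojK // IHk.
have -> : \dim {:subvs_of U} = \dim U by rewrite dimvf.
apply: (@leq_trans (\dim {:V})) => //; rewrite ltn_neqAle dimvS ?subvf // andbT.
apply/negP => dimU; have UV : U = fullv by apply/eqP; rewrite eqEdim subvf (eqP dimU) /=.
have surj m' x : exists y, iter m' T y = x.
  elim: m' x => [|m' IHm] x; first by exists x.
  have /memv_imgP[y _ ->] : x \in U by rewrite UV memvf.
  by have [z <-] := IHm y; exists z; rewrite lfunE -iterS.
suff : (fullv : {vspace V}) == 0%VS by rewrite -dimv_eq0 (gtn_eqF V_gt0).
by rewrite -subv0; apply/subvP => x _; have [y <-] := surj k x; rewrite kE mem0v.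
Qed.

Definition rtr (V : vectType F) (U : {vspace V}) (T : V -> V) : F :=
  vtr (fun x : subvs_of U => vsproj U (T (vsval x))).

Section RestrictedTrace.
Variable V : vectType F.
Implicit Types (U W : {vspace V}) (T : {linear V -> V}).

Definition vstable U (T : V -> V) := forall x, x \in U -> T x \in U.

Fact restr_linear U T : linear (fun x : subvs_of U => vsproj U (T (vsval x))).
Proof. by move=> a x y; rewrite !linearP. Qed.

Lemma eq_rtr U (S T : V -> V) : (forall x, x \in U -> S x = T x) -> rtr U S = rtr U T.
Proof. by move=> E; apply: eq_vtr => x; rewrite E ?subvsP. Qed.

Lemma rtrD U (S T : V -> V) : rtr U (fun x => S x + T x) = rtr U S + rtr U T.
Proof. by rewrite -vtrD; apply: eq_vtr => x; rewrite linearD. Qed.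

Lemma rtrZ U a (T : V -> V) : rtr U (fun x => a *: T x) = a * rtr U T.
Proof. by rewrite -vtrZ; apply: eq_vtr => x; rewrite linearZ. Qed.

Lemma rtr_id U : rtr U id = (\dim U)%:R.
Proof.
rewrite /rtr (eq_vtr (T := fun x => x)) => [|x]; last by rewrite vsvalK.
by rewrite vtr_id dimvf.
Qed.

Definition restr U T : {linear subvs_of U -> subvs_of U} :=
  HB.pack_for {linear subvs_of U -> subvs_of U}
    (fun x : subvs_of U => vsproj U (T (vsval x)))
    (GRing.isLinear.Build F (subvs_of U) (subvs_of U) _ _ (@restr_linear U T)).

Lemma rtr_comm U (S : {linear V -> V}) T : vstable U S -> vstable U T ->
  rtr U (fun x => S (T x) - T (S x)) = 0.
Proof.
move=> US UT; rewrite rtrD; have -> : rtr U (fun x => - T (S x)) = - rtr U (T \o S).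
  by rewrite -mulN1r -rtrZ; apply: eq_rtr => x _; rewrite scaleN1r.
apply/eqP; rewrite subr_eq0; apply/eqP.
transitivity (vtr (restr U S \o restr U T)).
  by apply: eq_vtr => x /=; rewrite vsprojK // UT ?subvsP.
rewrite vtr_cyclic.
by apply: eq_vtr => x /=; rewrite vsprojK // US ?subvsP.
Qed.

Lemma rtr_nilpotent U T : vstable U T ->
  (forall x, x \in U -> exists k, iter k T x = 0) -> rtr U T = 0.
Proof.
move=> UT nT; apply: (vtr_nilpotent (T := restr U T)) => x.
have [k kE] := nT _ (subvsP x); exists k; apply: val_inj.
rewrite [RHS]linear0 -[RHS]kE; elim: k {kE} => //= k IH.
rewrite vsprojK ?IH //; elim: k {IH} => [|k IH] /=; last exact: UT.
by apply/UT/subvsP.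
Qed.

Lemma rtr_add U W T : (U :&: W)%VS = 0%VS -> vstable U T -> vstable W T ->
  rtr (U + W) T = rtr U T + rtr W T.
Proof.
move=> UW0 UT WT; pose X := (U + W)%VS.
pose inj Y := fun y : subvs_of Y => vsproj X (vsval y).
pose pi Y Z := fun x : subvs_of X => vsproj Y (daddv_pi Y Z (vsval x)).
have inj_lin Y : linear (inj Y) by move=> a x y; rewrite /inj !linearP.
have pi_lin Y Z : linear (pi Y Z) by move=> a x y; rewrite /pi !linearP.
pose inj' Y := HB.pack_for {linear subvs_of Y -> subvs_of X} (inj Y)
  (GRing.isLinear.Build F (subvs_of Y) (subvs_of X) _ _ (inj_lin Y)).
pose pi' Y Z := HB.pack_for {linear subvs_of X -> subvs_of Y} (pi Y Z)
  (GRing.isLinear.Build F (subvs_of X) (subvs_of Y) _ _ (pi_lin Y Z)).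
have UX : (U <= X)%VS := addvSl U W.
have WX : (W <= X)%VS := addvSr U W.
have part Y Z : (Y :&: Z)%VS = 0%VS -> (Y <= X)%VS -> vstable Y T ->
    vtr ((restr X T \o inj' Y) \o pi' Y Z) = rtr Y T.
  move=> YZ YX YT; rewrite vtr_cyclic; apply: eq_vtr => y.
  rewrite /= /pi /inj !vsprojK ?(subvP YX) ?YT ?subvsP //.
  by rewrite daddv_pi_id ?YT ?subvsP.
rewrite -(part U W) // -(part W U) //; last by rewrite capvC.
rewrite -vtrD; apply: eq_vtr => x /=.
have XU := subvP UX _ (memv_pi U W (vsval x)).
have XW := subvP WX _ (memv_pi W U (vsval x)).
rewrite /inj /pi !vsprojK ?memv_pi //.
by rewrite -linearD -linearD /= daddv_pi_add ?subvsP.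
Qed.

End RestrictedTrace.
End Trace.

(** * Generalized eigenspaces *)

Section GeneralizedEigenvectors.
Variables (F : fieldType) (V : vectType F).

Definition shift (T : V -> V) (a : F) (x : V) : V := T x - a *: x.

Definition gev (T : V -> V) (a : F) (x : V) := exists k, iter k (shift T a) x = 0.

Variable T : {linear V -> V}.

Fact shift_linear a : linear (shift T a).
Proof.
move=> k x y; rewrite /shift linearP scalerDr scalerBr opprD addrACA.
by rewrite !scalerA (mulrC a).
Qed.
HB.instance Definition _ a := GRing.isLinear.Build F V V _ (shift T a) (shift_linear a).

Lemma shiftC a b x : shift T a (shift T b x) = shift T b (shift T a x).
Proof.
rewrite /shift !linearB !linearZ /= !scalerA (mulrC b) -!addrA.
by congr (_ + _); rewrite addrCA.
Qed.

Lemma gev0 a : gev T a 0. Proof. by exists 0%N. Qed.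

Lemma iter_shift_le a k l x : (k <= l)%N ->
  iter k (shift T a) x = 0 -> iter l (shift T a) x = 0.
Proof. by move=> /subnK <- E; rewrite iterD E iter0. Qed.

Lemma gevP a b x y : gev T a x -> gev T a y -> gev T a (b *: x + y).
Proof.
move=> [k kx] [l ly]; exists (maxn k l); rewrite iter_linear.
by rewrite (iter_shift_le _ kx) ?(iter_shift_le _ ly) ?leq_maxl ?leq_maxr ?scaler0 ?addr0.
Qed.

Lemma gev_shift a b x : gev T a x -> gev T a (shift T b x).
Proof.
move=> [k kx]; exists k; rewrite -[RHS](linear0 (shift T b)) -kx.
by elim: k {kx} => //= k ->; rewrite shiftC.
Qed.

Lemma shift_inj a b x : a != b -> gev T a x -> shift T b x = 0 -> x = 0.
Proof.
move=> ab [k]; elim: k x => [//|k IH] x; rewrite iterSr => kx bx.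
have ax : shift T a x = (b - a) *: x.
  by move: bx => /eqP; rewrite subr_eq0 /shift scalerBl => /eqP ->.
have x0 : shift T a x = 0.
  by apply: IH kx _; rewrite ax linearZ /= bx scaler0.
move/eqP: ax; rewrite x0 eq_sym scaler_eq0 subr_eq0 eq_sym (negbTE ab) /=.
by move/eqP.
Qed.

Lemma gev_disjoint a b x : a != b -> gev T a x -> gev T b x -> x = 0.
Proof.
move=> ab ax [k]; elim: k => [//|k IH] /= kx; apply: IH.
apply: shift_inj ab _ kx; elim: k => //= k IH; exact: gev_shift.
Qed.

(** If z' solves (T - b) z' = (T - a) y, then z = (y - z') / (a - b) works, as (T - b) - (T - a) = a
    - b. The solution stays in every stable subspace containing y. *)
Lemma gev_surj a b y : a != b -> gev T a y ->
  exists2 z, gev T a z & shift T b z = y /\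
    forall U : {vspace V}, vstable U T -> y \in U -> z \in U.
Proof.
move=> ab [k]; elim: k y => [|k IH] y.
  by move=> /= ->; exists 0; [apply: gev0|rewrite linear0; split=> // U _ _;
    apply: mem0v].
rewrite iterSr => ky; have [z' az' [bz' zU]] := IH _ ky.
exists ((a - b)^-1 *: (y - z')).
  rewrite -[_ *: _]addr0; apply: gevP (gev0 a).
  rewrite addrC -scaleN1r; apply: gevP => //; by exists k.+1; rewrite iterSr.
have -> : shift T b ((a - b)^-1 *: (y - z')) = (a - b)^-1 *: (shift T b y - shift T a y).
  by rewrite linearZ -bz'; congr (_ *: _); apply: linearB.
split.
  have -> : shift T b y - shift T a y = (a - b) *: y.
    by rewrite /shift opprB [LHS]addrC addrA subrK -scalerBl.
  by rewrite scalerA mulVf ?scale1r // subr_eq0.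
move=> U UT yU; rewrite memvZ // memvB // zU // /shift memvB ?memvZ // UT //.
Qed.

Lemma gev_sum_shift (U : {vspace V}) (b : F) y : vstable U T ->
  y \in linear_span (fun y => y \in U /\ exists a, gev T a y) ->
  exists z w, [/\ z \in linear_span (fun y => y \in U /\ exists a, gev T a y),
     gev T b w, w \in U & y = shift T b z + w].
Proof.
move=> UT; move: y; apply: linear_span_ind.
  by exists 0, 0; split; rewrite ?mem0v ?linear0 ?addr0 //; apply: gev0.
move=> c x y' [xU [a ax]] [z [w [zS bw wU ->]]].
have [ab|ab] := eqVneq a b.
  exists z, (c *: x + w); rewrite memvD ?memvZ // addrCA; split=> //.
  by apply: gevP => //; rewrite -ab.
have [z' az' [bz' zU]] := gev_surj ab ax.
exists (c *: z' + z), w; split=> //.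
  rewrite memvD ?memvZ //; apply: mem_linear_span; split; last by exists a.
  exact: zU.
by rewrite linearP /= bz' addrA.
Qed.

(** Induction on the roots. As (T - b) x is a sum of generalized eigenvectors, it is (T - b) z + w
    with z of the same kind and w of eigenvalue b; then x - z is a generalized b-eigenvector. *)
Lemma gev_span_roots (U : {vspace V}) (r : seq F) x : vstable U T -> x \in U ->
  foldr (fun a y => shift T a y) x r = 0 ->
  x \in linear_span (fun y => y \in U /\ exists a, gev T a y).
Proof.
move=> UT; elim/last_ind: r x => [|r b IH] x xU /=; first by move=> ->; apply: mem0v.
rewrite foldr_rcons => rx.
have sU : shift T b x \in U by rewrite memvB ?memvZ ?UT.
have [z [w [zS bw wU bxE]]] := gev_sum_shift b UT (IH _ sU rx).
have [k kw] := bw.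
have zU : z \in U.
  by move: (z) zS; apply: linear_span_ind => [|c x' y [? _] ?];
    rewrite ?mem0v ?memvD ?memvZ.
rewrite -[x](subrK z) memvD //; apply: mem_linear_span; split; first by rewrite memvB.
by exists b, k.+1; rewrite iterSr linearB /= bxE addrAC subrr add0r.
Qed.

End GeneralizedEigenvectors.

Section PolynomialAction.
Variables (F : closedFieldType) (V : vectType F) (T : {linear V -> V}).

Definition poly_act (p : {poly F}) (x : V) := \sum_(i < size p) p`_i *: iter i T x.

Lemma poly_actE n (p : {poly F}) x : (size p <= n)%N ->
  poly_act p x = \sum_(i < n) p`_i *: iter i T x.
Proof.
move=> le; rewrite /poly_act (big_ord_widen _ (fun i => p`_i *: iter i T x) le).
rewrite big_mkcond; apply: eq_bigr => i _; case: ltnP => // /(nth_default 0) ->.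
by rewrite scale0r.
Qed.

Lemma poly_actXsub a (p : {poly F}) x :
  poly_act (('X - a%:P) * p) x = shift T a (poly_act p x).
Proof.
have le : (size (('X - a%:P) * p)%R <= (size p).+1)%N.
  by apply: leq_trans (size_polyMleq _ _) _; rewrite size_XsubC.
rewrite (poly_actE _ le) /shift.
rewrite [X in _ - a *: X](@poly_actE (size p).+1) // scaler_sumr.
under eq_bigr => i _ do rewrite mulrBl coefB coefXM coefCM scalerBl -scalerA.
rewrite sumrB; congr (_ - _); rewrite big_ord_recl /= scale0r add0r.
by rewrite /poly_act linear_sum; apply: eq_bigr => i _; rewrite linearZ.
Qed.

Lemma annihilating_roots x : exists r : seq F, foldr (fun a y => shift T a y) x r = 0.
Proof.
have spanV (w : V) : exists k : 'rV[F]_(\dim {:V}), w = \sum_i k 0 i *: (vbasis {:V})`_i.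
  exists (\row_i coord (vbasis {:V}) i w).
  rewrite {1}(coord_vbasis (memvf w)); apply: eq_bigr => i _; by rewrite mxE.
have [k k0 kE] := finitely_spanned_dep spanV (fun i => iter i T x).
pose n := (\dim {:V}).+1; pose q : {poly F} := \poly_(i < n) k 0 (inord i).
have q0 : q != 0.
  have /rV0Pn[i ki] := k0; apply: contraNneq ki => q0.
  by have := coef_poly n (fun i => k 0 (inord i)) i;
    rewrite -/q q0 coef0 ltn_ord inord_val => /esym/eqP.
have qx : poly_act q x = 0.
  rewrite (poly_actE _ (size_poly _ _)) -[RHS]kE; apply: eq_bigr => i _.
  by rewrite coef_poly ltn_ord inord_val.
have [r qE] := closed_field_poly_normal q.
exists r; have <- : poly_act (\prod_(z <- r) ('X - z%:P)) x =
  foldr (fun a y => shift T a y) x r.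
  elim: r {qE} => [|a r IH] /=; last by rewrite big_cons poly_actXsub IH.
  by rewrite big_nil (@poly_actE 1) ?size_poly1 // big_ord1 coefC /= scale1r.
have lq : lead_coef q != 0 by rewrite lead_coef_eq0.
apply: (scale_eq0 lq); rewrite -[RHS]qx [in RHS]qE.
rewrite /poly_act size_scale // scaler_sumr; apply: eq_bigr => i _.
by rewrite coefZ scalerA.
Qed.

Lemma gev_span (U : {vspace V}) x : vstable U T -> x \in U ->
  x \in linear_span (fun y => y \in U /\ exists a, gev T a y).
Proof.
by move=> UT xU; have [r rE] := annihilating_roots x; apply: gev_span_roots rE.
Qed.

End PolynomialAction.

Section LieBasics.
Variables (F : numFieldType) (g : lieAlgType F).

Lemma memv_lie_prod (U W : {vspace g}) x y :
  x \in U -> y \in W -> lie x y \in lie_prod U W.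
Proof.
move=> xU yW; rewrite (coord_vbasis xU) (coord_vbasis yW).
rewrite linear_sumlz /= memv_suml // => i _; rewrite linearZl_LR memvZ //.
rewrite linear_sumr /= memv_suml // => k _; rewrite linearZr_LR memvZ //.
by apply/memv_span/allpairs_f; apply: mem_nth; rewrite size_tuple.
Qed.

Lemma lie_prod_le (U W X : {vspace g}) :
  (forall x y, x \in U -> y \in W -> lie x y \in X) -> (lie_prod U W <= X)%VS.
Proof.
move=> UWX; apply/span_subvP => _ /allpairsP[[x y] /= [xU yW ->]].
by apply: UWX; apply: vbasis_mem.
Qed.

Lemma lie_subalgebraP (U : {vspace g}) :
  lie_subalgebra U <-> forall x y : g, x \in U -> y \in U -> lie x y \in U.
Proof.
split=> [/subvP sU x y xU yU|UU]; last exact: lie_prod_le.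
exact/sU/memv_lie_prod.
Qed.

Lemma lie_nilpotent_ad (U : {vspace g}) : lie_nilpotent U ->
  exists k, forall x y : g, x \in U -> y \in U -> iter k (ad x) y = 0.
Proof.
move=> [k Uk]; exists k => x y xU yU; apply/eqP; rewrite -memv0 -Uk.
elim: k {Uk} => //= k IH; exact: memv_lie_prod.
Qed.

Lemma gev_lie (t : g) a b (x y : g) :
  gev (ad t) a x -> gev (ad t) b y -> gev (ad t) (a + b) (lie x y).
Proof.
move=> [k kx] [l ly].
have [m] := ubnP (k + l); elim: m => // m IH in k l x y kx ly *.
case: k kx => [/= ->|k kx]; first by exists 0%N; rewrite /= linear0l.
case: l ly => [/= ->|l ly]; first by exists 0%N; rewrite /= linear0r.
rewrite addSn ltnS => klm.
have E : shift (ad t) (a + b) (lie x y) =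
    lie (shift (ad t) a x) y + lie x (shift (ad t) b y).
  rewrite /shift /ad lie_lie linearBl /= linearBr /= linearZl_LR linearZr_LR /=.
  by rewrite scalerDl opprD addrACA.
have kx' : iter k (shift (ad t) a) (shift (ad t) a x) = 0 by rewrite -iterSr.
have ly' : iter l (shift (ad t) b) (shift (ad t) b y) = 0 by rewrite -iterSr.
have klm' : (k.+1 + l < m)%N by rewrite addSn -addnS.
have [k1 E1] := IH _ _ _ _ kx' ly klm.
have [k2 E2] := IH _ _ _ _ kx ly' klm'.
have [k3 E3] : gev (ad t) (a + b) (shift (ad t) (a + b) (lie x y)).
  by rewrite E -[lie _ y]scale1r; apply: gevP; [exists k1|exists k2].
by exists k3.+1; rewrite iterSr.
Qed.

End LieBasics.

(** * Generalized weight spaces of a nilpotent subalgebra *)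

Section Weights.
Variables (F : numClosedFieldType) (g : lieAlgType F) (h : {vspace g}).
Hypothesis hsub : forall x y : g, x \in h -> y \in h -> lie x y \in h.
Variable N : nat.
Hypothesis hnil : forall x y : g, x \in h -> y \in h -> iter N (ad x) y = 0.

Local Notation weight := 'Hom(subvs_of h, F^o).
Implicit Types al be : weight.

(** Generalized weights, because the diagonalizability of [ad h] is only obtained at the end
    ([wt_weight_vector]). *)
Definition wt al (x : g) := forall t : subvs_of h, gev (ad (vsval t)) (al t) x.

Lemma wt0 al : wt al 0. Proof. by move=> t; apply: gev0. Qed.

Lemma wtP al a x y : wt al x -> wt al y -> wt al (a *: x + y).
Proof. by move=> wx wy t; apply: gevP; [apply: wx|apply: wy]. Qed.

Lemma wtZ al a x : wt al x -> wt al (a *: x).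
Proof. by move=> wx; rewrite -[_ *: _]addr0; apply: wtP => //; apply: wt0. Qed.

Lemma wt_lie al be x y : wt al x -> wt be y -> wt (al + be) (lie x y).
Proof. by move=> wx wy t; rewrite add_lfunE; apply: gev_lie; [apply: wx|apply: wy]. Qed.

Lemma wt_h x : x \in h -> wt 0 x.
Proof.
move=> xh t; exists N; rewrite zero_lfunE -[RHS](hnil (subvsP t) xh).
by apply: eq_iter => y; rewrite /shift scale0r subr0.
Qed.

Lemma wt_shift al (t : subvs_of h) a x : wt al x -> wt al (shift (ad (vsval t)) a x).
Proof.
move=> wx; rewrite /shift addrC -scaleNr; apply: wtP => //.
by have := wt_lie (wt_h (subvsP t)) wx; rewrite add0r.
Qed.

Definition hstable (U : {vspace g}) := forall t : g, t \in h -> vstable U (ad t).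

Definition wt_in (U : {vspace g}) (x : g) := x \in U /\ exists al, wt al x.

Lemma rtr_gev (U : {vspace g}) (t : g) a : vstable U (ad t) ->
  (forall x, x \in U -> gev (ad t) a x) -> rtr U (ad t) = a * (\dim U)%:R.
Proof.
move=> Ut Ua; have E : rtr U (shift (ad t) a) = 0.
  apply: rtr_nilpotent => //; first by move=> x xU; rewrite memvB ?memvZ ?Ut.
transitivity (rtr U (fun x => shift (ad t) a x + a *: id x)).
  by apply: eq_rtr => x _; rewrite subrK.
by rewrite rtrD E rtrZ rtr_id add0r.
Qed.

(** Induction on the dimension. Either every t in h has a single generalized eigenvalue on U, or
    some t splits U into smaller pieces; these are h-stable because elements of h are generalized
    0-eigenvectors of [ad t]. *)
Theorem wt_span (U : {vspace g}) x : hstable U -> x \in U ->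
  x \in linear_span (wt_in U).
Proof.
have [m] := ubnP (\dim U); elim: m => // m IH in U x * => dimU hU xU.
have [U0|U0] := eqVneq U 0%VS.
  by move: xU; rewrite U0 memv0 => /eqP ->; apply: mem0v.
have dim_neq0 : (\dim U)%:R != 0 :> F by rewrite Num.Theory.pnatr_eq0 dimv_eq0.
have [prim|nprim] := pselect (forall t : subvs_of h, exists a,
    forall x, x \in U -> gev (ad (vsval t)) a x).
  (* Written as a normalized trace, the eigenvalue is visibly linear in t. *)
  pose al0 (t : subvs_of h) : F^o := rtr U (ad (vsval t)) / (\dim U)%:R.
  have al_lin : linear al0.
    move=> a s t; rewrite [RHS](_ : _ = a * (rtr U (ad (vsval s)) / (\dim U)%:R) +
      rtr U (ad (vsval t)) / (\dim U)%:R) //.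
    rewrite mulrA -mulrDl -rtrZ -rtrD /al0; congr (_ / _); apply: eq_rtr => y _.
    by rewrite linearP /ad lie_linearl.
  pose al : weight := linfun (HB.pack_for {linear subvs_of h -> F^o} al0
    (GRing.isLinear.Build F (subvs_of h) F^o _ _ al_lin)).
  apply: mem_linear_span; split=> //; exists al => t; rewrite lfunE /= /al0.
  have [a aE] := prim t.
  by rewrite (rtr_gev (hU _ (subvsP t)) aE) mulfK //; apply: aE.
have [t tE] : exists t : subvs_of h, forall a,
    exists2 x, x \in U & ~ gev (ad (vsval t)) a x.
  apply: contrapT => H; apply: nprim => t; apply: contrapT => H1; apply: H.
  exists t => a; apply: contrapT => H2; apply: H1; exists a => y yU.
  by apply: contrapT => H3; apply: H2; exists y.
have := gev_span (hU _ (subvsP t)) xU.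
move: x {xU}; apply: linear_span_ind => [|c x y [xU [a ax]] yS]; first exact: mem0v.
apply: memvD => //; apply: memvZ.
pose Ua := linear_span (fun y => y \in U /\ gev (ad (vsval t)) a y).
have UaE y' : y' \in Ua <-> y' \in U /\ gev (ad (vsval t)) a y'.
  apply: linear_span_closed => [|k z z' [zU az] [zU' az']].
    by split; [apply: mem0v|apply: gev0].
  by split; [rewrite memvD ?memvZ|apply: gevP].
have : x \in linear_span (wt_in Ua).
  apply: IH.
  - apply: (@leq_trans (\dim U)) => //; rewrite ltn_neqAle.
    have UaU : (Ua <= U)%VS by apply/subvP => z /UaE[].
    rewrite dimvS // andbT; have [z zU nz] := tE a.
    by apply/negP => dimE; apply: nz;
      have /UaE[] : z \in Ua by rewrite (eqP (_ : Ua == U)) // eqEdim UaU (eqP dimE) /=.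
  - move=> s sh z /UaE[zU az]; apply/UaE; split; first exact: hU.
    by rewrite -[a]add0r; apply: gev_lie => //; have := wt_h sh t; rewrite zero_lfunE.
  - by apply/UaE.
apply/subvP/linear_span_le => z [/UaE[zU _] wz].
exact: mem_linear_span.
Qed.

End Weights.

Section WeightDecomposition.
Variables (F : numClosedFieldType) (g : lieAlgType F) (h : {vspace g}).
Hypothesis hsub : forall x y : g, x \in h -> y \in h -> lie x y \in h.
Variable N : nat.
Hypothesis hnil : forall x y : g, x \in h -> y \in h -> iter N (ad x) y = 0.

Local Notation weight := 'Hom(subvs_of h, F^o).
Implicit Types al be : weight.

Lemma wt_direct (s : seq weight) (x : weight -> g) : uniq s ->
  (forall al, al \in s -> wt al (x al)) -> \sum_(al <- s) x al = 0 ->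
  forall al, al \in s -> x al = 0.
Proof.
elim: s x => [//|be s IH] x /= /andP[beNs us] wx; rewrite big_cons => sum0.
have zs al : al \in s -> x al = 0.
  move=> als.
  have [t tE] : exists t : subvs_of h, al t != be t.
    apply: contrapT => H; move/negP: beNs; apply.
    suff -> : be = al by [].
    apply/lfunP => t; apply: contrapT => E; apply: H; exists t.
    by apply/eqP => E'; apply: E.
  (* A power [D] of [ad t - be t] kills the term of weight [be] and preserves the other weights, so
     the induction hypothesis gives [D (x al) = 0]. *)
  have [k kE] := wx be (mem_head _ _) t.
  pose D y := iter k (shift (ad (vsval t)) (be t)) y.
  have D_lin : linear D := @iter_linear F g (shift (ad (vsval t)) (be t)) k.
  have Dwt (ga : weight) y : wt ga y -> wt ga (D y).
    move=> wy; rewrite /D; elim: (k) => [|m wm]; first exact: wy.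
    exact (wt_shift hnil t (be t) wm).
  have D0 : D (x al) = 0.
    apply: (IH (fun ga => D (x ga))) als => //.
      by move=> ga gas; apply/Dwt/wx; rewrite inE gas orbT.
    have := congr1 D sum0; rewrite [D 0](_ : _ = 0); last by rewrite /D iter0.
    rewrite -[x be]scale1r D_lin scale1r [D (x be)](kE : D (x be) = 0) add0r => E.
    rewrite -[RHS]E.
    elim: (s) => [|ga s' IHs]; first by rewrite !big_nil /D iter0.
    by rewrite !big_cons -{2}[x ga]scale1r D_lin scale1r IHs.
  apply: (gev_disjoint tE); first by apply: wx; rewrite inE als orbT.
  by exists k.
move=> al; rewrite inE => /predU1P[->|]; last exact: zs.
by move: sum0; rewrite big_seq big1 // addr0.
Qed.

Lemma weights_exist : exists s : seq weight, [/\ uniq s,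
  (forall al, al \in s -> exists2 x, x != 0 & wt al x) &
  forall al x, wt al x -> x != 0 -> al \in s].
Proof.
pose ok k := `[< exists s : seq weight, [/\ size s = k, uniq s &
  forall al, al \in s -> exists2 x, x != 0 & wt al x] >].
have ex_ok : exists k, ok k by exists 0%N; apply/asboolP; exists [::].
have ok_le k : ok k -> (k <= \dim {:g})%N.
  move=> /asboolP[s [<- us nz]]; rewrite leqNgt; apply/negP => big.
  have [x xE] : exists x : weight -> g, forall al, al \in s -> x al != 0 /\ wt al (x al).
    have h1 al : exists x : g, al \in s -> x != 0 /\ wt al x.
      have [/nz[x x0 wx]|_] := boolP (al \in s); first by exists x.
      by exists 0.
    by have [x xE] := choice h1; exists x.
  have spanV (w : g) : exists k : 'rV[F]_(\dim {:g}), w = \sum_i k 0 i *: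
    (vbasis {:g})`_i.
    exists (\row_i coord (vbasis {:g}) i w).
    rewrite {1}(coord_vbasis (memvf w)); apply: eq_bigr => i _; by rewrite mxE.
  pose s' := take (\dim {:g}).+1 s.
  have sz : size s' = (\dim {:g}).+1 by rewrite size_take_min; apply/minn_idPl.
  have us' : uniq s' by apply: take_uniq.
  have ss' al : al \in s' -> al \in s by apply: mem_take.
  have [c c0 cE] := finitely_spanned_dep spanV (fun i => x (nth 0 s' i)).
  pose y al := c 0 (inord (index al s')) *: x al.
  have y0 : forall al, al \in s' -> y al = 0.
    apply: (wt_direct us').
      by move=> al /ss'/xE[_ wx]; apply: wtZ.
    rewrite (big_nth 0) big_mkord sz -[RHS]cE; apply: eq_bigr => i _.
    by rewrite /y index_uniq ?sz // inord_val.
  have /rV0Pn[i ci] := c0; have in_s' : nth 0 s' i \in s' by rewrite mem_nth ?sz.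
  have /eqP := y0 _ in_s'; rewrite /y index_uniq ?sz // inord_val scaler_eq0
    (negbTE ci) /=.
  by have [/negbTE->] := xE _ (ss' _ in_s').
have [k /asboolP[s [sk us nz]] kmax] := ex_maxnP ex_ok ok_le.
exists s; split=> // al x wx x0; apply/negPn/negP => als.
have : ok k.+1.
  apply/asboolP; exists (al :: s); split; rewrite /= ?sk ?als //.
  by move=> be; rewrite inE => /predU1P[->|/nz//]; exists x.
by move/kmax; rewrite ltnn.
Qed.

Definition wt_space al : {vspace g} := linear_span (wt al).

Lemma wt_spaceP al x : x \in wt_space al <-> wt al x.
Proof.
by apply: linear_span_closed => [|a y z]; [apply: wt0|apply: wtP].
Qed.

Lemma sum_wtP (s : seq weight) x : uniq s ->
  x \in (\sum_(al <- s) wt_space al)%VS ->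
  exists2 y : weight -> g, forall al, wt al (y al) & x = \sum_(al <- s) y al.
Proof.
elim: s x => [|al s IH] x /=.
  rewrite big_nil memv0 => _ /eqP ->.
  by exists (fun=> 0) => [?|]; [apply: wt0|rewrite big_nil].
move=> /andP[als us]; rewrite big_cons.
move=> /memv_addP[u /wt_spaceP uE [v /(IH _ us)[y wy ->] ->]].
exists (fun be => if be == al then u else y be).
  by move=> be; case: eqP => // ->.
rewrite big_cons eqxx; congr (_ + _); rewrite !big_seq; apply: eq_bigr => be bes.
by case: eqP => // E; rewrite -E bes in als.
Qed.

Lemma wt_space_cap (s : seq weight) al : uniq (al :: s) ->
  (wt_space al :&: \sum_(be <- s) wt_space be)%VS = 0%VS.
Proof.
move=> us; apply/eqP; rewrite -subv0; apply/subvP => x /memv_capP[/wt_spaceP wx].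
have /andP[alNs us'] := us; move=> /(sum_wtP us')[y wy xE].
rewrite memv0; apply/eqP.
pose z be := if be == al then - x else y be.
have := @wt_direct (al :: s) z us; rewrite /z.
move=> /(_ _ _ al (mem_head _ _)); rewrite eqxx => H.
apply/eqP; rewrite -oppr_eq0; apply/eqP/H.
  move=> be _; case: eqP => // ->; rewrite -scaleN1r; exact: wtZ.
rewrite big_cons eqxx xE big_seq [X in _ + X]big_seq addrC -sumrB big1 // => be bes.
case: eqP => [E|_]; last by rewrite subrr.
by rewrite -E bes in alNs.
Qed.

Lemma rtr_sum_wt (s : seq weight) (T : {linear g -> g}) (c : weight -> F) : uniq s ->
  (forall al, al \in s -> vstable (wt_space al) T) ->
  (forall al, al \in s -> rtr (wt_space al) T = c al) ->
  rtr (\sum_(al <- s) wt_space al) T = \sum_(al <- s) c al.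
Proof.
elim: s => [|al s IH] us st cE.
  rewrite !big_nil; apply: rtr_nilpotent => [x|x].
    by rewrite memv0 => /eqP ->; rewrite linear0 mem0v.
  by rewrite memv0 => /eqP ->; exists 0%N.
have usT : uniq s by case/andP: us.
rewrite !big_cons rtr_add ?wt_space_cap //.
- rewrite cE ?mem_head // IH // => be bes; [apply: st|apply: cE];
    by rewrite inE bes orbT.
- by apply: st; rewrite mem_head.
elim: (s) (st) => [|be s' IHs] st' x.
  by rewrite big_nil memv0 => /eqP ->; rewrite linear0 mem0v.
rewrite big_cons => /memv_addP[u uE [v vE ->]]; rewrite linearD memv_add //.
  by apply: (st' be); rewrite // !inE eqxx orbT.
by apply: IHs => // ga; rewrite inE => /predU1P[->|gs];
  apply: st'; rewrite !inE ?eqxx ?gs ?orbT.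
Qed.

Lemma wt_space_stable al (t : g) : t \in h -> vstable (wt_space al) (ad t).
Proof.
move=> th x /wt_spaceP wx; apply/wt_spaceP.
by have := wt_lie (wt_h hnil th) wx; rewrite add0r.
Qed.

Lemma rtr_wt_space al (t : subvs_of h) :
  rtr (wt_space al) (ad (vsval t)) = al t * (\dim (wt_space al))%:R.
Proof.
apply: rtr_gev; first exact/wt_space_stable/subvsP.
by move=> x /wt_spaceP.
Qed.

Definition nwt al : F := (\dim (wt_space al))%:R.

(** [ad t] is the commutator of [ad x] and [ad y] on a space that both preserve, so its trace there
    is 0. *)
Lemma trace_formula (s : seq weight) (x y : g) (t : subvs_of h) : uniq s ->
  lie x y = vsval t ->
  (forall al z, al \in s -> wt al z ->
     lie x z \in (\sum_(be <- s) wt_space be)%VS /\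
     lie y z \in (\sum_(be <- s) wt_space be)%VS) ->
  \sum_(al <- s) al t * nwt al = 0.
Proof.
move=> us xyt st; set U := (\sum_(be <- s) _)%VS in st.
have Ust (z : g) : (forall al w, al \in s -> wt al w -> lie z w \in U) ->
  vstable U (ad z).
  move=> zU w /(sum_wtP us)[v wv ->]; rewrite linear_sum big_seq memv_suml // => al als.
  exact: (zU _ _ als (wv al)).
have Ux : vstable U (ad x) by apply: Ust => al w als ww; have [] := st al w als ww.
have Uy : vstable U (ad y) by apply: Ust => al w als ww; have [] := st al w als ww.
rewrite -(@rtr_sum_wt s (ad (vsval t)) (fun al => al t * nwt al)) //.
- rewrite -[RHS](rtr_comm Ux Uy); apply: eq_rtr => z _.
  change (lie (vsval t) z = lie x (lie y z) - lie y (lie x z)).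
  by rewrite -xyt lie_lie addrK.
- by move=> al _; apply/wt_space_stable/subvsP.
by move=> al _; rewrite rtr_wt_space.
Qed.

(** With a = [al t], (T - a)(T + a) is nilpotent on the weight space, so T^2 has the trace of
    a^2. *)
Lemma rtr_wt_space2 al (t : subvs_of h) :
  rtr (wt_space al) (ad (vsval t) \o ad (vsval t)) = al t ^+ 2 * nwt al.
Proof.
set T := ad (vsval t); pose S x := shift T (al t) (shift T (- al t) x).
have ST : rtr (wt_space al) S = 0.
  have -> : S = shift T (al t) \o shift T (- al t) by [].
  have wsh a x : x \in wt_space al -> shift T a x \in wt_space al.
    by move=> /wt_spaceP wx; apply/wt_spaceP; exact (wt_shift hnil t a wx).
  apply: rtr_nilpotent => [x xw|x xw]; first by rewrite /= !wsh.
  have /wt_spaceP/(_ t)[k kE] := xw; exists k.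
  have it m : iter m (shift T (al t) \o shift T (- al t)) x =
      iter m (shift T (- al t)) (iter m (shift T (al t)) x).
    have comm m' y : iter m' (shift T (- al t)) (shift T (al t) y)
        = shift T (al t) (iter m' (shift T (- al t)) y).
      by elim: m' => //= m' ->; rewrite shiftC.
    by elim: m => //= m ->; rewrite comm shiftC.
  by rewrite it kE iter0.
transitivity (rtr (wt_space al) (fun x => S x + al t ^+ 2 *: id x)).
  apply: eq_rtr => x _; have -> : S x = T (T x) - al t ^+ 2 *: x.
    have TE : T (T x + al t *: x) = T (T x) + al t *: T x by rewrite /T linearD linearZ.
    rewrite /S /shift !scaleNr !opprK TE scalerDr scalerA -expr2.
    by rewrite opprD addrA addrK.
  by rewrite subrK.
by rewrite rtrD ST rtrZ rtr_id add0r.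
Qed.

Lemma wt_sum_full (s : seq weight) (U : {vspace g}) : uniq s ->
  (forall al x, wt al x -> x != 0 -> al \in s) -> hstable h U ->
  forall x, x \in U -> exists2 y : weight -> g,
    forall al, y al \in U /\ wt al (y al) & x = \sum_(al <- s) y al.
Proof.
move=> us all_s hU x /(wt_span hnil hU); move: x; apply: linear_span_ind.
  exists (fun=> 0); first by split; [apply: mem0v|apply: wt0].
  by rewrite big1.
move=> a x z [xU [al wx]] [y yE ->].
have [x0|x0] := eqVneq x 0; first by exists y => //; rewrite x0 scaler0 add0r.
exists (fun be => (if be == al then a *: x else 0) + y be).
  move=> be; have [yU wy] := yE be; split.
    by rewrite memvD //; case: ifP => _; rewrite ?memvZ ?mem0v.
  rewrite -[X in wt _ (X + _)]scale1r; apply: wtP => //.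
  by case: eqP => [->|_]; [apply: wtZ|apply: wt0].
rewrite big_split; congr (_ + _) => /=.
rewrite (bigD1_seq al) ?(all_s _ _ wx) //= eqxx big1 ?addr0 // => be /negbTE ->.
by [].
Qed.

End WeightDecomposition.
(** * The Killing form and the Cartan subalgebra *)

Section DualBases.
Variables (F : fieldType) (V : vectType F) (B : {symmetric V}).

Lemma nondegenerateP x : nondegenerate B -> (forall y, B x y = 0) -> x = 0.
Proof.
move=> /eqP nd xB; apply/eqP; rewrite -memv0 -nd; apply/mem_orthovP => y _; exact: xB.
Qed.

Lemma dual_bases_exist (U : {vspace V}) :
  (forall x, x \in U -> (forall y, y \in U -> B x y = 0) -> x = 0) ->
  exists hu hv : 'I_(\dim U) -> V, dual_bases B U hu hv.
Proof.
move=> nd; pose b i := (vbasis U)`_i.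
have bU i : (i < \dim U)%N -> b i \in U.
  by move=> iU; rewrite vbasis_mem ?mem_nth ?size_tuple.
have ortho x : x \in U -> (forall i : 'I_(\dim U), B x (b i) = 0) -> x = 0.
  move=> xU xb; apply: nd => // y yU;
    rewrite (coord_vbasis yU) linear_sumr big1 //= => i _.
  by rewrite linearZr_LR /= xb mulr0.
pose G : 'M[F]_(\dim U) := \matrix_(i, k) B (b i) (b k).
have Gu : G \in unitmx.
  rewrite -row_free_unit -kermx_eq0; apply/rowV0P => k /sub_kermxP kG.
  have k0 : \sum_i k 0 i *: b i = 0.
    apply: ortho => [|l]; first by rewrite memv_suml // => i _; rewrite memvZ ?bU.
    move/rowP/(_ l): kG; rewrite !mxE => <-; rewrite linear_sumlz /=.
    by apply: eq_bigr => i _; rewrite linearZl_LR /= mxE.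
  apply/rowP => i; rewrite mxE; have /freeP := basis_free (vbasisP U).
  by move=> /(_ (fun i => k 0 i)); apply.
pose v k := \sum_l invmx G l k *: b l.
have bv i k : B (b (nat_of_ord i)) (v k) = (i == k)%:R.
  rewrite linear_sumr /=; have := mulmxV Gu => /matrixP/(_ i k); rewrite !mxE => <-.
  by apply: eq_bigr => l _; rewrite linearZr_LR /= mxE mulrC.
exists (fun i => b i), v; split=> [i|i|x xU|x xU].
- exact: bU.
- by rewrite memv_suml // => l _; rewrite memvZ ?bU.
- rewrite {2}(coord_vbasis xU); apply: eq_bigr => i _; congr (_ *: _).
  rewrite {1}(coord_vbasis xU) linear_sumlz (bigD1 i) //= linearZl_LR /= bv eqxx.
  rewrite mulr1 big1 ?addr0 // => k ki.
  by rewrite linearZl_LR /= bv (negbTE ki) mulr0.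
apply/eqP; rewrite -subr_eq0; apply/eqP/ortho => [|i].
  by rewrite memvB // memv_suml // => l _; rewrite memvZ // memv_suml // => m _;
    rewrite memvZ ?bU.
rewrite linearBl /= linear_sumlz (bigD1 i) //= linearZl_LR /= (Bsym B (v i)) bv eqxx.
rewrite mulr1 big1 ?addr0 ?subrr // => k ki.
by rewrite linearZl_LR /= (Bsym B (v k)) bv eq_sym (negbTE ki) mulr0.
Qed.

Lemma orthogonal_split (U : {vspace V}) x :
  (forall x, x \in U -> (forall y, y \in U -> B x y = 0) -> x = 0) ->
  exists2 a, a \in U & forall y, y \in U -> B (x - a) y = 0.
Proof.
move=> /dual_bases_exist[hu [hv D]]; exists (\sum_k B x (hv k) *: hu k).
  by rewrite memv_suml // => k _; rewrite memvZ // (dual_u D).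
move=> y yU; rewrite linearBl /= -{1}(dual_vE D yU) linear_sumr linear_sumlz /=.
rewrite -sumrB big1 // => k _.
by rewrite linearZr_LR linearZl_LR /= (Bsym B y) mulrC subrr.
Qed.

End DualBases.

Section InvariantForms.
Variables (F : numClosedFieldType) (g : lieAlgType F) (h : {vspace g}).
Variable K : g -> g -> F.
Hypothesis Kl : forall y, linear (K^~ y : g -> F^o).
Hypothesis Kr : forall x, linear (K x : g -> F^o).
Hypothesis Kinv : forall t x y, K (lie t x) y = - K x (lie t y).

(** Induction on the total nilpotency order: when the shifted terms vanish, invariance leaves (a +
    b) K(x, y) = 0. *)
Lemma form_gev (t : g) a b x y : gev (ad t) a x -> gev (ad t) b y -> a + b != 0 ->
  K x y = 0.
Proof.
move=> [k kx] [l ly] ab.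
have K0l z : K 0 z = 0 := lin0 (Kl z).
have K0r z : K z 0 = 0 := lin0 (Kr z).
have [m] := ubnP (k + l); elim: m => // m IH in k l x y kx ly *.
case: k kx => [/= ->|k kx]; first by rewrite K0l.
case: l ly => [/= ->|l ly]; first by rewrite K0r.
rewrite addSn ltnS => klm.
have kx' : iter k (shift (ad t) a) (shift (ad t) a x) = 0 by rewrite -iterSr.
have ly' : iter l (shift (ad t) b) (shift (ad t) b y) = 0 by rewrite -iterSr.
have klm' : (k.+1 + l < m)%N by rewrite addSn -addnS.
have E1 := IH _ _ _ _ kx' ly klm; have E2 := IH _ _ _ _ kx ly' klm'.
have S1 : K (shift (ad t) a x) y = K (lie t x) y - a * K x y.
  by rewrite /shift addrC -scaleNr Kl addrC /GRing.scale /= mulNr.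
have S2 : K x (shift (ad t) b y) = K x (lie t y) - b * K x y.
  by rewrite /shift addrC -scaleNr Kr addrC /GRing.scale /= mulNr.
move: E1 E2; rewrite S1 S2 Kinv => E1 E2.
have : (a + b) * K x y = 0 by move/eqP: E1; move/eqP: E2;
  rewrite !subr_eq0 mulrDl => /eqP <- /eqP <-; rewrite addNr.
by move/eqP; rewrite mulf_eq0 (negbTE ab) /= => /eqP.
Qed.

Lemma form_wt (al be : 'Hom(subvs_of h, F^o)) x y :
  wt al x -> wt be y -> al + be != 0 -> K x y = 0.
Proof.
move=> wx wy ab; have [t tE] : exists t, (al + be) t != 0.
  apply: contrapT => H; move/negP: ab; apply; apply/eqP/lfunP => t.
  rewrite zero_lfunE; apply: contrapT => /eqP E; apply: H; by exists t.
by apply: form_gev (wx t) (wy t) _; move: tE; rewrite add_lfunE.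
Qed.

End InvariantForms.

Section Engel.
Variables (F : numClosedFieldType) (g : lieAlgType F) (h : {vspace g}).
Hypothesis hcart : cartan_subalgebra h.

Lemma cartan_sub (x y : g) : x \in h -> y \in h -> lie x y \in h.
Proof. by have [/lie_subalgebraP sub _ _] := hcart; apply: sub. Qed.

Lemma cartan_nil : exists N, forall x y : g, x \in h -> y \in h -> iter N (ad x) y = 0.
Proof. by have [_ nil _] := hcart; apply: lie_nilpotent_ad. Qed.

Let lcs k := iter k (lie_prod h) h.

Let lcs_lie k (x y : g) : x \in h -> y \in lcs k -> lie x y \in lcs k.+1.
Proof. exact: memv_lie_prod. Qed.

Let lcs_dec k : (lcs k.+1 <= lcs k)%VS.
Proof.
elim: k => [|k IH].
  by apply: lie_prod_le => x y; apply: cartan_sub.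
apply: lie_prod_le => x y xh yk; apply: lcs_lie => //.
exact: (subvP IH).
Qed.

Let lcs_h k : (lcs k <= h)%VS.
Proof. by elim: k => [|k IH]; [apply: subvv|apply: subv_trans (lcs_dec k) IH]. Qed.

(** An Engel argument. An element of weight 0 outside h is modified until all of h brackets it into
    h, against self-normalization; the lower central series is treated upwards from its zero term
    [lcs M]. *)
Theorem cartan_wt0 (x : g) : wt (0 : 'Hom(subvs_of h, F^o)) x -> x \in h.
Proof.
move=> wx; apply: contrapT => /negP xh.
have [N hnil] := cartan_nil.
have [_ [M lM] selfn] := hcart.
suff H k : exists w, [/\ wt (0 : 'Hom(subvs_of h, F^o)) w, w \notin h &
    forall t, t \in lcs (M - k) -> lie t w \in h].
  have [w [_ wh tw]] := H M; move/negP: wh; apply; apply: selfn => t th.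
  by rewrite lieC memvN; apply: tw; rewrite subnn.
elim: k => [|k [w [ww wh tw]]].
  exists x; split=> // t; rewrite subn0 /lcs lM memv0 => /eqP ->.
  by rewrite linear0l mem0v.
have [kM|Mk] := ltnP k M; last first.
  exists w; split=> // t; rewrite (eqP (_ : M - k.+1 == 0)%N) ?subn_eq0
    ?(leq_trans Mk) //.
  by move=> th; apply: tw; rewrite (eqP (_ : M - k == 0)%N) ?subn_eq0.
set j := (M - k.+1)%N; have jE : (M - k = j.+1)%N by rewrite /j -subSn.
rewrite jE in tw.
pose b i := (vbasis (lcs j))`_i.
(* From [lcs j.+1] to [lcs j], one basis vector of [lcs j] at a time. *)
suff H m : (m <= \dim (lcs j))%N -> exists w, [/\ wt (0 : 'Hom(subvs_of h, F^o)) w,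
    w \notin h, forall t, t \in lcs j.+1 -> lie t w \in h &
    forall i, (i < m)%N -> lie (b i) w \in h].
  have [w' [ww' wh' _ bw']] := H _ (leqnn _); exists w'; split=> // t tj.
  rewrite (coord_vbasis tj) linear_sumlz /= memv_suml // => i _.
  by rewrite linearZl_LR memvZ // bw'.
elim: m => [_|m IHm mj]; first by exists w.
have [w1 [ww1 wh1 tw1 bw1]] := IHm (ltnW mj).
have bmj : b m \in lcs j by rewrite vbasis_mem ?mem_nth ?size_tuple.
have bmh := subvP (lcs_h j) _ bmj.
have it_prop i : [/\ wt (0 : 'Hom(subvs_of h, F^o)) (iter i (ad (b m)) w1),
    forall t, t \in lcs j.+1 -> lie t (iter i (ad (b m)) w1) \in h &
    forall l, (l < m)%N -> lie (b l) (iter i (ad (b m)) w1) \in h].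
  elim: i => [//|i [IH1 IH2 IH3]]; split.
  - by have := wt_lie (wt_h hnil bmh) IH1; rewrite addr0.
  - move=> t tj; rewrite /= /ad lie_lie memvD //.
      apply: IH2; rewrite lieC memvN; apply: (subvP (lcs_dec _)); exact: lcs_lie.
    by apply: cartan_sub => //; apply: IH2.
  move=> l lm; have blj : b l \in lcs j.
    by rewrite vbasis_mem ?mem_nth ?size_tuple // (leq_trans lm) // ltnW.
  rewrite /= /ad lie_lie memvD //; last by apply: cartan_sub => //; apply: IH3.
  by apply: IH2; apply: lcs_lie => //; apply: (subvP (lcs_h j)).
(* [ad (b m)] is nilpotent on elements of weight 0, so some iterate is the last one outside h. By
   [it_prop] the iterates keep the earlier conditions, since [[b_l, b_m]] lies in [lcs j.+1]. *)
have [i [ih i1h]] : exists i, iter i (ad (b m)) w1 \notin h /\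
    iter i.+1 (ad (b m)) w1 \in h.
  have [i iE] := ww1 (vsproj h (b m)).
  have {iE} iE : iter i (ad (b m)) w1 \in h.
    rewrite -(_ : iter i (shift (ad (b m)) 0) w1 = iter i (ad (b m)) w1).
      by move: iE; rewrite zero_lfunE vsprojK // => ->; apply: mem0v.
    by apply: eq_iter => z; rewrite /shift scale0r subr0.
  elim: i iE => [|i IH iE]; first by rewrite /= (negbTE wh1).
  have [/IH//|ih] := boolP (iter i (ad (b m)) w1 \in h); by exists i.
have [H1 H2 H3] := it_prop i; exists (iter i (ad (b m)) w1); split=> // l.
by rewrite ltnS leq_eqVlt => /predU1P[->|]; [exact: i1h|exact: H3].
Qed.

End Engel.

Section KillingForm.
Variables (F : numClosedFieldType) (g : lieAlgType F).

Definition killing (x y : g) : F := rtr fullv (ad x \o ad y).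

Lemma vstable_full (T : g -> g) : vstable fullv T.
Proof. by move=> x _; apply: memvf. Qed.

Lemma killing_sym x y : killing x y = killing y x.
Proof.
apply/eqP; rewrite -subr_eq0 -mulN1r -rtrZ -rtrD; apply/eqP.
rewrite -[RHS](rtr_comm (@vstable_full (ad x)) (@vstable_full (ad y))).
by apply: eq_rtr => z _; rewrite scaleN1r.
Qed.

Lemma killing_linear y : linear (killing^~ y : g -> F^o).
Proof.
move=> a x z; rewrite [RHS](_ : _ = a * killing x y + killing z y) //
   /killing -rtrZ -rtrD.
by apply: eq_rtr => w _; rewrite /= /ad lie_linearl.
Qed.

Lemma killing_linearr x : linear (killing x : g -> F^o).
Proof. by move=> a y z; rewrite !(killing_sym x) killing_linear. Qed.

Lemma killing_inv t x y : killing (lie t x) y = - killing x (lie t y).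
Proof.
apply/eqP; rewrite -subr_eq0 opprK -rtrD; apply/eqP.
pose S := GRing.Linear.clone _ _ _ _ (ad x \o ad y) _.
rewrite -[RHS](rtr_comm (S := ad t) (T := S) (@vstable_full _) (@vstable_full _)).
apply: eq_rtr => z _; rewrite /= /ad.
by rewrite (lie_lie t x) (lie_lie t y) linearDr /= addrA addrK.
Qed.

End KillingForm.

(** * Ideals of a semisimple Lie algebra *)

Section SemisimpleIdeals.
Variables (F : numClosedFieldType) (g : lieAlgType F) (B : {symmetric g}).
Hypotheses (ss : lie_semisimple g) (nd : nondegenerate B) (Binv : ad_invariant B).

Definition is_ideal (I : {vspace g}) := forall x y : g, y \in I -> lie x y \in I.

Lemma lie_ideal_of (I : {vspace g}) : is_ideal I -> lie_ideal I.
Proof. by move=> II; apply: lie_prod_le => x y _; apply: II. Qed.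

Lemma abelian_ideal0 (I : {vspace g}) : is_ideal I ->
  (forall x y : g, x \in I -> y \in I -> lie x y = 0) -> I = 0%VS.
Proof.
move=> II ab; apply: ss; first exact: lie_ideal_of.
exists 1%N; apply/eqP; rewrite /= -subv0; apply: lie_prod_le => x y xI yI.
by rewrite ab // mem0v.
Qed.

(** The radical of [B] on an ideal is an ideal, and it is abelian: B([x, y], z) = B(x, [y, z]) =
    0. *)
Lemma ideal_nondegenerate (I : {vspace g}) : is_ideal I ->
  forall x, x \in I -> (forall y, y \in I -> B x y = 0) -> x = 0.
Proof.
move=> II.
pose J := linear_span (fun x => x \in I /\ forall y, y \in I -> B x y = 0).
have JE x : x \in J <-> x \in I /\ forall y, y \in I -> B x y = 0.
  apply: linear_span_closed => [|a y z [yI yo] [zI zo]].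
    by split=> [|y _]; rewrite ?mem0v // linear0l.
  split=> [|w wI]; first by rewrite memvD ?memvZ.
  by rewrite linearDl linearZl_LR /= yo // zo // mulr0 addr0.
have J0 : J = 0%VS.
  apply: abelian_ideal0 => [x y /JE[yI yo]|x y /JE[xI xo] /JE[yI yo]].
    apply/JE; split=> [|z zI]; first exact: II.
    by rewrite lieC linearNl /= Binv yo ?oppr0 ?II.
  apply: (nondegenerateP nd) => z.
  by rewrite Binv xo // lieC memvN II.
by move=> x xI xo; apply/eqP; rewrite -memv0 -J0; apply/JE.
Qed.

Lemma center0 (x : g) : (forall y, lie x y = 0) -> x = 0.
Proof.
move=> xc; apply/eqP; rewrite -memv0.
suff <- : <[x]>%VS = 0%VS by apply: memv_line.
apply: abelian_ideal0 => [y z /vlineP[a ->]|y z /vlineP[a ->] _].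
  by rewrite linearZr_LR /= lieC xc oppr0 scaler0 mem0v.
by rewrite linearZl_LR /= xc scaler0.
Qed.

(* An element of I orthogonal to [I, I] is central in g. *)
Lemma ideal_perfect (I : {vspace g}) : is_ideal I ->
  forall x, x \in I ->
  x \in linear_span (fun z => exists a b, [/\ a \in I, b \in I & z = lie a b]).
Proof.
move=> II x xI; set C := linear_span _.
have CI z : z \in C -> z \in I.
  move: z; apply/subvP/linear_span_le => _ [a [b [aI bI ->]]]; exact: II.
have IC a b : a \in I -> b \in I -> lie a b \in C.
  by move=> aI bI; apply: mem_linear_span; exists a, b.
have Cideal : is_ideal C.
  move=> y z; move: z; apply: linear_span_ind => [|k _ w [a [b [aI bI ->]]] wC].
    by rewrite linear0r mem0v.
  rewrite linearDr linearZr_LR /= memvD // memvZ // lie_lie memvD // IC //; exact: II.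
have [a aC xa] := orthogonal_split x (ideal_nondegenerate Cideal).
suff /eqP : x - a = 0 by rewrite subr_eq0 => /eqP ->.
set b := x - a in xa *; have bI : b \in I by rewrite memvB // CI.
have bI0 y : y \in I -> lie b y = 0.
  move=> yI; apply: (ideal_nondegenerate II) => [|z zI].
    by rewrite lieC memvN II.
  by rewrite Binv xa // IC.
apply: center0 => y; have [y1 y1I yo] := orthogonal_split y (ideal_nondegenerate II).
rewrite -[y](subrK y1) linearDr /= (bI0 _ y1I) addr0.
apply: (nondegenerateP nd) => z; rewrite lieC linearNl /= Binv yo ?oppr0 //.
by rewrite lieC memvN II.
Qed.

End SemisimpleIdeals.

(** * Weights of a Cartan subalgebra *)

Section CartanTheory.
Variables (F : numClosedFieldType) (g : lieAlgType F) (B : {symmetric g}).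
Variable h : {vspace g}.
Hypotheses (ss : lie_semisimple g) (nd : nondegenerate B) (Binv : ad_invariant B).
Hypothesis hcart : cartan_subalgebra h.
Variable N : nat.
Hypothesis hnil : forall x y : g, x \in h -> y \in h -> iter N (ad x) y = 0.
Local Notation weight := 'Hom(subvs_of h, F^o).
Implicit Types al be ga : weight.
Variable wts : seq weight.
Hypothesis wts_uniq : uniq wts.
Hypothesis wts_nz : forall al, al \in wts -> exists2 x, x != 0 & wt al x.
Hypothesis wts_all : forall al x, wt al x -> x != 0 -> al \in wts.

Local Notation nwt := (@nwt F g h).
Local Notation wt_space := (@wt_space F g h).
Local Notation hval t := (@vsproj F g h t).

Lemma nwt_neq0 al : al \in wts -> (0 < \dim (wt_space al))%N.
Proof.
move=> /wts_nz[x x0 wx]; rewrite lt0n dimv_eq0; apply: contraNneq x0 => w0.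
by rewrite -memv0 -w0; apply/wt_spaceP.
Qed.

Lemma mem_sum_wt (s : seq weight) al x : wt al x -> (x != 0 -> al \in s) ->
  x \in (\sum_(be <- s) wt_space be)%VS.
Proof.
move=> wx als; have [->|x0] := eqVneq x 0; first exact: mem0v.
have {als} := als x0; elim: s => // be s IH; rewrite inE big_cons => /predU1P[E|/IH xs].
  by apply: (subvP (addvSl _ _)); apply/wt_spaceP; rewrite -E.
exact: (subvP (addvSr _ _)).
Qed.

Lemma trace_lie_string al x y t (P : weight -> bool) :
  wt al x -> wt (- al) y -> lie x y = vsval t ->
  (forall be, P be -> P (be + al) /\ P (be - al)) ->
  \sum_(be <- wts | P be) be t * nwt be = 0.
Proof.
move=> wx wy xyt Pal; rewrite -big_filter.
apply: (trace_formula hnil (x := x) (y := y)) => //; first exact: filter_uniq.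
move=> be z; rewrite mem_filter => /andP[Pbe _] wz; have [P1 P2] := Pal _ Pbe.
split.
  apply: (mem_sum_wt (wt_lie wx wz)) => xz0; rewrite mem_filter addrC P1 /=.
  by rewrite addrC; apply: wts_all xz0; apply: wt_lie.
apply: (mem_sum_wt (wt_lie wy wz)) => xz0; rewrite mem_filter addrC P2 /=.
by rewrite addrC; apply: wts_all xz0; apply: wt_lie.
Qed.

(* The trace of [x, y] vanishes on every al-string of weight spaces. *)
Lemma string_rational al x y t : wt al x -> wt (- al) y -> lie x y = vsval t ->
  exists q : weight -> F, q al = 1 /\ forall be, be \in wts ->
    q be \is Num.real /\ be t = q be * al t.
Proof.
move=> wx wy xyt.
have H be : exists q : F, (be == al -> q = 1) /\ (be \in wts ->
  q \is Num.real /\ be t = q * al t).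
  have [->|ne] := eqVneq be al; first by exists 1; rewrite rpred1 mul1r.
  have [bw|_] := boolP (be \in wts); last by exists 0.
  (* The full string [be + Z al]. The trace on it is [be t] times a positive integer plus [al t]
     times an integer, whence the ratio. *)
  pose P (de : weight) := `[< exists k : int, de = be + k%:~R *: al >].
  have Pal de : P de -> P (de + al) /\ P (de - al).
    move=> /asboolP[k ->]; split; apply/asboolP.
      by exists (k + 1); rewrite intrD scalerDl scale1r addrA.
    by exists (k - 1); rewrite intrB scalerBl scale1r addrA.
  have := trace_lie_string wx wy xyt Pal.
  have [kk kkE] : exists kk : weight -> int, forall de, P de ->
    de = be + (kk de)%:~R *: al.
    have h1 de : exists k : int, P de -> de = be + k%:~R *: al.
      have [/asboolP[k kE]|_] := boolP (P de); first by exists k.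
      by exists 0.
    by have [kk kkE] := choice h1; exists kk.
  have -> : \sum_(de <- wts | P de) de t * nwt de =
     be t * (\sum_(de <- wts | P de) nwt de) + al t *
       (\sum_(de <- wts | P de) (kk de)%:~R * nwt de).
    rewrite !mulr_sumr -big_split; apply: eq_bigr => de Pde /=.
    rewrite {1}(kkE _ Pde) add_lfunE scale_lfunE mulrDl mulrA; congr (_ + _ * _).
    by rewrite mulrC.
  set S := \sum_(de <- wts | P de) nwt de; set S' := \sum_(_ <- _ | _) _ * _.
  have S0 : S != 0.
    have Pbe : P be by apply/asboolP; exists 0; rewrite scale0r addr0.
    rewrite /S -big_filter (bigD1_seq be) ?filter_uniq ?mem_filter ?Pbe //=.
    rewrite /nwt -natr_sum -natrD Num.Theory.pnatr_eq0.
    by rewrite addn_eq0 negb_and -lt0n nwt_neq0.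
  move/eqP; rewrite addrC addr_eq0 => /eqP E.
  exists (- S' / S); split=> [//|_].
  split; last by rewrite mulrAC mulNr [S' * _]mulrC E opprK mulfK.
  rewrite rpred_div ?rpredN //; first by rewrite rpred_sum // => de _;
    rewrite rpredM ?rpred_int ?rpred_nat.
  by rewrite rpred_sum // => de _; rewrite rpred_nat.
have [q qE] := choice H; exists q; split; first by apply: (qE al).1.
by move=> be /(qE be).2.
Qed.

Lemma killing_h (t : subvs_of h) :
  killing (vsval t) (vsval t) = \sum_(al <- wts) al t ^+ 2 * nwt al.
Proof.
have E : fullv = (\sum_(al <- wts) wt_space al)%VS.
  apply/esym/eqP; rewrite eqEsubv subvf /=; apply/subvP => x _.
  have [y wy ->] := wt_sum_full hnil wts_uniq wts_all (fun t _ =>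
    @vstable_full _ _ (ad t)) (memvf x).
  by rewrite big_seq memv_suml // => al als; apply: mem_sum_wt (wy al).2 _.
rewrite /killing E.
pose S := GRing.Linear.clone _ _ _ _ (ad (vsval t) \o ad (vsval t)) _.
rewrite (@rtr_sum_wt _ _ _ _ hnil wts S (fun al => al t ^+ 2 * nwt al)) //.
- by move=> al _ x xw; rewrite /=; apply: (wt_space_stable hnil); rewrite ?subvsP //;
    apply: (wt_space_stable hnil); rewrite ?subvsP.
by move=> al _; rewrite (rtr_wt_space2 hnil).
Qed.

Lemma wt0_indep x : wt (0 : weight) x ->
  x \in linear_span (fun v => exists2 be : weight, be != 0 & wt be v) -> x = 0.
Proof.
move=> wx xS; have [y [wy y0 xE]] : exists y : weight -> g,
    [/\ forall al, wt al (y al), y 0 = 0 & x = \sum_(al <- wts) y al].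
  move: (x) xS; apply: linear_span_ind.
    by exists (fun=> 0); split=> [al||]; rewrite ?big1 //; apply: wt0.
  move=> a v w [be be0 wv] [y [wy y0 ->]].
  have [v0|v0] := eqVneq v 0; first by exists y; rewrite v0 scaler0 add0r.
  exists (fun ga => (if ga == be then a *: v else 0) + y ga); split.
  - move=> ga; rewrite -[X in wt _ (X + _)]scale1r; apply: wtP => //.
    by case: eqP => [->|_]; [apply: wtZ|apply: wt0].
  - by rewrite eq_sym (negbTE be0) add0r.
  rewrite big_split; congr (_ + _) => /=.
  rewrite (bigD1_seq be) ?(wts_all wv) //= eqxx big1 ?addr0 // => ga /negbTE ->.
  by [].
have [x0|x0] := eqVneq x 0; first by [].
have w0 := wts_all wx x0.
pose z al := y al - (if al == 0 then x else 0).
have z0 : forall al, al \in wts -> z al = 0.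
  apply: (wt_direct hnil wts_uniq) => [al _|].
    rewrite /z addrC -scaleN1r; apply: wtP => //.
    by case: eqP => [->|_]; [exact: wx|apply: wt0].
  rewrite sumrB -xE (bigD1_seq 0) //= eqxx big1 ?addr0 ?subrr // => al /negbTE ->.
  by [].
by have := z0 _ w0; rewrite /z eqxx y0 sub0r => /eqP; rewrite oppr_eq0 => /eqP.
Qed.

(** By [string_rational] the Killing value is [al t ^+ 2] times a sum of [q be ^+ 2] with positive
    multiplicities; this sum is positive since [q] is real on weights and [q al = 1]. So [al t = 0],
    and all weights follow. *)
Lemma weights_vanish al x y (t : subvs_of h) :
  wt al x -> wt (- al) y -> lie x y = vsval t -> killing (vsval t) (vsval t) = 0 ->
  forall be, be \in wts -> be t = 0.
Proof.
move=> wx wy xyt kt; have [q [q1 qE]] :=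
  string_rational wx wy xyt.
have [x0|x0] := eqVneq x 0.
  move=> be _; have -> : t = 0 by apply: val_inj; rewrite -[LHS]xyt x0 lie0l linear0.
  by rewrite linear0.
have alw := wts_all wx x0.
suff al0 : al t = 0 by move=> be /qE[_ ->]; rewrite al0 mulr0.
move: kt; rewrite killing_h.
have -> : \sum_(be <- wts) be t ^+ 2 * nwt be =
    al t ^+ 2 * \sum_(be <- wts) q be ^+ 2 * nwt be.
  rewrite mulr_sumr big_seq [RHS]big_seq; apply: eq_bigr => be /qE[_ ->].
  by rewrite exprMn mulrAC mulrC.
move/eqP; rewrite mulf_eq0 expf_eq0 /= => /orP[/eqP //|].
rewrite (bigD1_seq al) //= q1 expr1n mul1r => /eqP E.
have : 0 < nwt al by rewrite Num.Theory.ltr0n nwt_neq0.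
rewrite -(Num.Theory.ltrDl (\sum_(be <- wts | be != al) q be ^+ 2 * nwt be)) addrC E.
rewrite -big_filter big_seq; move=> /Order.POrderTheory.lt_geF/negP[];
  apply: Num.Theory.sumr_ge0.
move=> be; rewrite mem_filter => /andP[_ /qE[qr _]].
by rewrite Num.Theory.mulr_ge0 ?Num.Theory.ler0n // Num.Theory.real_exprn_even_ge0.
Qed.

Section Radical.
Variable I : {vspace g}.
Hypothesis II : is_ideal I.
Hypothesis Ik : forall x y, x \in I -> killing x y = 0.

Lemma ideal_hstable : hstable h I.
Proof. by move=> t _ x xI; apply: II. Qed.

(** As I = [I, I], t is a sum of brackets of weight vectors of I. Those of nonzero weight drop out
    by independence, and [weights_vanish] handles those in h. *)
Lemma radical_vanish (t : subvs_of h) : vsval t \in I ->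
  forall be, be \in wts -> be t = 0.
Proof.
move=> tI; pose Q x := exists x0 : subvs_of h, (forall be, be \in wts -> be x0 = 0) /\
  x - vsval x0 \in linear_span (fun v => exists2 be : weight, be != 0 & wt be v).
have Q0 : Q 0.
  exists 0; split=> [be _|]; first by rewrite linear0.
  by rewrite (linear0 (@vsval F g h)) subrr mem0v.
have QD a x y : Q x -> Q y -> Q (a *: x + y).
  move=> [x0 [xb xS]] [y0 [yb yS]]; exists (a *: x0 + y0); split.
    by move=> be bw; rewrite linearP /= xb // yb // scaler0 addr0.
  by rewrite (linearP (@vsval F g h)) opprD addrACA -scalerBr memvD ?memvZ.
have Qlie x y : wt_in h I x -> wt_in h I y -> Q (lie x y).
  move=> [xI [al wx]] [yI [be wy]].
  have [ab|ab] := eqVneq (al + be) 0; last first.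
    exists 0; rewrite (linear0 (@vsval F g h)) subr0; split; first by move=> ga _;
      rewrite linear0.
    by apply: mem_linear_span; exists (al + be) => //; apply: wt_lie.
  have bE : be = - al by apply/eqP; rewrite -addr_eq0 addrC ab.
  have xyh : lie x y \in h by apply: (cartan_wt0 hcart); rewrite -ab; apply: wt_lie.
  exists (vsproj h (lie x y)); rewrite vsprojK // subrr mem0v; split=> //.
  apply: (weights_vanish (x := x) (y := y) (al := al)) => //; rewrite ?vsprojK -?bE //.
  by rewrite Ik // II.
have span_I x : x \in I -> x \in linear_span (wt_in h I) :=
  wt_span hnil ideal_hstable (x := x).
have QI x y : x \in I -> y \in I -> Q (lie x y).
  move=> xI /span_I; move: y; apply: linear_span_ind; first by rewrite lie0.
  move=> a y z yw Qz; rewrite linearDr linearZr_LR /=; apply: (QD) => //.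
  move: (x) (span_I _ xI); apply: linear_span_ind; first by rewrite lie0l.
  move=> b x' w xw Qw; rewrite linearDl linearZl_LR /=; apply: (QD) => //.
  exact: Qlie.
have Qt : Q (vsval t).
  have := ideal_perfect ss nd Binv II tI; move: (vsval t).
  apply: linear_span_ind => // a _ z [x [y [xI yI ->]]] Qz.
  by apply: (QD) => //; apply: QI.
have [x0 [xb xS]] := Qt.
suff -> : t = x0 by [].
apply/eqP; rewrite -subr_eq0; apply/eqP/val_inj; rewrite linear0 linearB.
by apply: wt0_indep => //; apply: (wt_h hnil); rewrite memvB ?subvsP.
Qed.

(** Write t in h as a + b with a in I and b orthogonal to I. A weight occurring in I vanishes on a
    by [radical_vanish], and on b because b commutes with I; so it is 0. *)
Lemma radical_cartan x : x \in I -> x \in h.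
Proof.
move=> xI; have [y yE ->] := wt_sum_full hnil wts_uniq wts_all ideal_hstable xI.
rewrite memv_suml // => al _; have [yI wy] := yE al.
have [->|y0] := eqVneq (y al) 0; first exact: mem0v.
apply: (cartan_wt0 hcart); suff <- : al = 0 by [].
apply/lfunP => t; rewrite zero_lfunE.
have [a aI bo] := orthogonal_split (vsval t) (ideal_nondegenerate ss nd Binv II).
set b := vsval t - a in bo.
have ab_h : a \in h /\ b \in h.
  have dis z : z \in I -> (forall w, w \in I -> B z w = 0) -> z = 0.
    exact: (ideal_nondegenerate ss nd Binv II).
  have comp (s : subvs_of h) k : [/\ iter k (ad (vsval s)) a \in I &
      forall w, w \in I -> B (iter k (ad (vsval s)) b) w = 0].
    elim: k => [//|k [IH1 IH2]]; split=> [|w wI]; first exact: II.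
    by rewrite /= /ad lieC linearNl /= Binv IH2 ?oppr0 ?II.
  (* The N-th powers of [ad s] on a and b cancel, so that on a lies both in I and in its orthogonal,
     hence is 0; thus a has weight 0. *)
  have ha : a \in h.
    apply: (cartan_wt0 hcart) => s; exists N; rewrite zero_lfunE.
    have shE z : iter N (shift (ad (vsval s)) 0) z = iter N (ad (vsval s)) z.
      by apply: eq_iter => w; rewrite /shift scale0r subr0.
    rewrite shE; have [aN bN] := comp s N; apply: dis => // w wI.
    have tN := hnil (subvsP s) (subvsP t).
    have tE : vsval t = 1 *: b + a by rewrite scale1r subrK.
    move: tN; rewrite tE iter_linear scale1r => /(congr1 (fun z => B z w)).
    by rewrite linearDl linear0l /= bN // add0r.
  by rewrite /b memvB ?subvsP.
have [ah bh] := ab_h.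
have tE : t = hval a + hval b by apply: val_inj;
  rewrite linearD /= !vsprojK // addrC subrK.
rewrite tE linearD /= (radical_vanish (t := hval a)) ?vsprojK ?(wts_all wy) //.
rewrite [LHS]add0r; apply: contrapT => /eqP b0; move/eqP: y0; apply.
apply: (gev_disjoint (T := ad b) b0); first by have := wy (hval b); rewrite vsprojK.
exists 1%N; rewrite /= /shift scale0r subr0 /ad.
by apply: (nondegenerateP nd) => z; rewrite Binv bo // lieC memvN II.
Qed.

(** I lies in the nilpotent algebra h, so it is a solvable ideal. *)
Lemma radical0 : I = 0%VS.
Proof.
apply: ss; first exact: lie_ideal_of.
have [_ [k hk] _] := hcart; exists k; apply/eqP; rewrite -subv0 -hk.
have Ih : (I <= h)%VS by apply/subvP => x; apply: radical_cartan.
have lcs_le l : (iter l (lie_prod h) h <= h)%VS.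
  elim: l => [|l IH] /=; first exact: subvv.
  by apply: lie_prod_le => x y xh /(subvP IH) yh; apply: cartan_sub.
elim: k {hk} => [//|k IH] /=; apply: lie_prod_le => x y xk yk.
apply: memv_lie_prod; last exact: (subvP IH).
by apply: (subvP (lcs_le k)); apply: (subvP IH).
Qed.
End Radical.

(** Such a t is in the radical of the Killing form: polarizing [killing_h] makes it orthogonal to h,
    and invariance to the other weight spaces. *)
Lemma weights_separate (t : subvs_of h) : (forall be, be \in wts -> be t = 0) -> t = 0.
Proof.
move=> tb; pose I := linear_span (fun x : g => forall y, killing x y = 0).
have IE x : x \in I <-> forall y, killing x y = 0.
  apply: linear_span_closed => [y|a y z yk zk w].
    exact: (lin0 (killing_linear y)).
  by rewrite killing_linear yk zk scaler0 addr0.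
have II : is_ideal I.
  by move=> x y /IE yk; apply/IE => z; rewrite killing_inv yk oppr0.
have I0 := radical0 II (fun x y xI => (IE x).1 xI y).
apply: val_inj; rewrite linear0; apply/eqP; rewrite -memv0 -I0; apply/IE => y.
have tt (s : subvs_of h) : killing (vsval t + vsval s) (vsval t + vsval s) =
  killing (vsval s) (vsval s).
  rewrite -linearD !killing_h big_seq [RHS]big_seq.
  by apply: eq_bigr => al alw; rewrite linearD /= tb // add0r.
have kD x z w : killing (x + z) w = killing x w + killing z w.
  by have := killing_linear w 1 x z; rewrite !scale1r.
have kDr x z w : killing x (z + w) = killing x z + killing x w.
  by rewrite !(killing_sym x) kD.
have t_h s : s \in h -> killing (vsval t) s = 0.
  move=> sh; have := tt (hval s); rewrite vsprojK // kD !kDr (killing_sym s).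
  have := tt 0; rewrite linear0 addr0 (lin0 (killing_linear 0)) => ->.
  rewrite add0r addrA -[RHS]add0r => /addIr.
  by rewrite -mulr2n => /eqP; rewrite Num.Theory.mulrn_eq0 /= => /eqP.
have [z zE ->] := wt_sum_full hnil wts_uniq wts_all (fun t _ =>
  @vstable_full _ _ (ad t)) (memvf y).
rewrite big_seq; elim/big_rec: _ => [|al w _ IH].
  exact: (lin0 (killing_linearr _)).
rewrite kDr IH addr0; have [_ wz] := zE al.
have [al0|al0] := eqVneq al 0.
  by apply/t_h/(cartan_wt0 hcart); rewrite -al0.
apply: (form_wt (K := @killing F g) (@killing_linear F g) (@killing_linearr F g)
   (@killing_inv F g) (wt_h hnil (subvsP t)) wz).
by rewrite add0r.
Qed.

(** x and y have weight 0, so [string_rational] with al = 0 makes every weight vanish on their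
    bracket. *)
Lemma cartan_abelian x y : x \in h -> y \in h -> lie x y = 0.
Proof.
move=> xh yh; have xyh := cartan_sub hcart xh yh.
rewrite -(vsprojK xyh) (@weights_separate (vsproj h (lie x y))) ?linear0 // => be bew.
have wx := wt_h hnil xh; have wy : wt (- 0 : weight) y by rewrite oppr0;
  exact (wt_h hnil yh).
have [q [_ qE]] := string_rational wx wy
  (esym (vsprojK xyh)).
by have [_ ->] := qE _ bew; rewrite zero_lfunE mulr0.
Qed.

(** * Root spaces *)

Lemma wt_decomp (x : g) : exists2 y : weight -> g,
  forall al, wt al (y al) & x = \sum_(al <- wts) y al.
Proof.
have [y yE xE] := wt_sum_full hnil wts_uniq wts_all (fun t _ =>
  @vstable_full _ _ (ad t)) (memvf x).
by exists y => // al; have [] := yE al.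
Qed.

Lemma form_wt0 al be (x y : g) : wt al x -> wt be y -> al + be != 0 -> B x y = 0.
Proof.
apply: (form_wt (K := B)) => [z a v w|z a v w|t v w].
- by rewrite linearDl linearZl_LR.
- by rewrite linearDr linearZr_LR.
by rewrite lieC linearNl /= Binv.
Qed.

Lemma form_wt_pair al (x : g) : wt al x -> x != 0 ->
  exists2 y, wt (- al) y & B x y = 1.
Proof.
move=> wx x0.
have [y wy Bxy] : exists2 y, wt (- al) y & B x y != 0.
  apply: contrapT => no; move/eqP: x0; apply; apply: (nondegenerateP nd) => z.
  have [y wy ->] := wt_decomp z; rewrite linear_sumr big1 // => be _.
  have [ab|ab] := eqVneq (al + be) 0; last exact: form_wt0 wx (wy be) ab.
  have bE : be = - al by apply/eqP; rewrite -addr_eq0 addrC ab.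
  apply: contrapT => /eqP Bxy; apply: no; exists (y be) => //.
  by rewrite -bE; apply: wy.
exists ((B x y)^-1 *: y); first exact: wtZ.
by rewrite linearZr_LR /= mulVf.
Qed.

Lemma cartan_nondegenerate (x : g) : x \in h -> (forall y, y \in h -> B x y = 0) -> x = 0.
Proof.
move=> xh Bx; apply: (nondegenerateP nd) => z.
have [y wy ->] := wt_decomp z; rewrite linear_sumr big1 // => be _.
have [b0|b0] := eqVneq be 0; last first.
  by apply: form_wt0 (wt_h hnil xh) (wy be) _; rewrite add0r.
by apply: Bx; apply: (cartan_wt0 hcart); rewrite -b0; apply: wy.
Qed.

Lemma coroot_exists al : exists t : subvs_of h, forall s : subvs_of h,
  B (vsval t) (vsval s) = al s.
Proof.
have [hu [hv D]] := dual_bases_exist cartan_nondegenerate.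
exists (hval (\sum_j al (hval (hu j)) *: hv j)) => s.
rewrite vsprojK; last by apply: rpred_sum => j _; rewrite memvZ ?(dual_v D).
rewrite linear_sumlz /=; set X := LHS.
rewrite -[s in RHS](vsvalK s) -(dual_uE D (subvsP s)) linear_sum linear_sum.
apply: eq_bigr => j _; rewrite linearZl_LR !linearZ /= mulrC; congr (_ * _).
exact: (Bsym B).
Qed.

Lemma lie_root_vectors al (t : subvs_of h) (x y : g) :
  (forall s : subvs_of h, B (vsval t) (vsval s) = al s) ->
  wt al x -> weight_vector (- al) y -> lie x y = B x y *: vsval t.
Proof.
move=> tE wx wy; apply/eqP; rewrite -subr_eq0; apply/eqP.
have wy' : wt (- al) y.
  by move=> s; exists 1%N; rewrite /= /shift /ad wy subrr.
have xyh : lie x y \in h.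
  by apply: (cartan_wt0 hcart); rewrite -(subrr al); apply: wt_lie.
apply: cartan_nondegenerate => [|s sh].
  by rewrite memvB // memvZ // subvsP.
rewrite linearBl linearZl_LR /= Binv lieC -(vsprojK sh) wy tE.
by rewrite opp_lfunE scaleNr opprK linearZr_LR /= mulrC subrr.
Qed.

Lemma weight_vector_wt al (x : g) : weight_vector al x -> wt al x.
Proof. by move=> wx s; exists 1%N; rewrite /= /shift /ad wx subrr. Qed.

(** h is abelian, so a common eigenvector is reached one basis element t at a time, replacing x by
    its last nonzero image under powers of [ad t - al t]. *)
Lemma weight_vector_exists al : al \in wts ->
  exists2 x : g, x != 0 & weight_vector al x.
Proof.
move=> alw; have [x [x0 [wx xE]]] : exists x : g, x != 0 /\ (wt al x /\
    forall t, t \in map (vsproj h) (vbasis h) -> lie (vsval t) x = al t *: x).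
  elim: (map _ _) => [|t s [x [x0 [wx xE]]]].
    by have [x x0 wx] := wts_nz alw; exists x.
  have [k kE] := wx t; elim: k x x0 wx xE kE => [|k IH] x x0 wx xE kE.
    by case/eqP: x0; exact: kE.
  have [sx0|sx0] := eqVneq (shift (ad (vsval t)) (al t) x) 0.
    exists x; split=> //; split=> // u; rewrite inE => /predU1P[->|/xE //].
    by apply/eqP; rewrite -subr_eq0; apply/eqP.
  apply: (IH (shift (ad (vsval t)) (al t) x)) => //; last by rewrite -iterSr.
    exact (wt_shift hnil t (al t) wx).
  move=> u us; rewrite /shift /ad linearBr linearZr_LR /= (xE _ us).
  have -> : lie (vsval u) (lie (vsval t) x) = lie (vsval t) (lie (vsval u) x).
    by rewrite lie_lie (cartan_abelian (subvsP u) (subvsP t)) lie0l add0r.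
  rewrite (xE _ us) linearZr_LR /= scalerBr !scalerA.
  by congr (_ - _ *: _); rewrite mulrC.
exists x => // t.
suff E : lie (vsval t) x - al t *: x = 0.
  by apply/eqP; rewrite -subr_eq0; apply/eqP.
rewrite -[in al t](vsvalK t) (coord_vbasis (subvsP t)).
rewrite linear_sum linear_sum scaler_suml linear_sumlz -sumrB big1 // => i _.
rewrite (linearZ_LR (vsproj h)) (linearZ_LR al) linearZl_LR /=
  -[(_ *: al _) *: x]scalerA -scalerBr.
have hi : (vbasis h)`_i \in h by rewrite vbasis_mem ?mem_nth ?size_tuple.
rewrite -[X in lie X x](vsprojK hi) xE ?subrr ?scaler0 //.
by rewrite map_f // mem_nth ?size_tuple.
Qed.

(** If [al t] were 0, all weights would vanish on t by [string_rational], so t and then al would be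
    0. So far only f is known to be a true weight vector. *)
Lemma root_triple al : al \in wts -> al != 0 -> exists t : subvs_of h, exists e f : g,
  [/\ forall s : subvs_of h, B (vsval t) (vsval s) = al s, wt al e,
    weight_vector (- al) f &
  [/\ B e f = 1, lie e f = vsval t & al t != 0]].
Proof.
move=> alw al0; have [t tE] := coroot_exists al.
have [x x0 wx] := wts_nz alw; have [y wy Bxy] := form_wt_pair wx x0.
have y0 : y != 0.
  by apply/eqP => y0; move/eqP: Bxy; rewrite y0 linear0r eq_sym oner_eq0.
have [f f0 wf] := weight_vector_exists (wts_all wy y0).
have [e we Bfe] := form_wt_pair (weight_vector_wt wf) f0.
rewrite opprK in we; rewrite (Bsym B) in Bfe.
have ef : lie e f = vsval t by rewrite (lie_root_vectors tE we wf) Bfe scale1r.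
exists t, e, f; split=> //; split=> //.
have [q [_ qE]] := string_rational we
  (weight_vector_wt wf) ef.
apply: contraNneq al0 => al0; have t0 : t = 0.
  by apply: weights_separate => be bew; have [_ ->] := qE _ bew; rewrite al0 mulr0.
by apply/eqP/lfunP => s; rewrite -tE t0 !linear0 linear0l zero_lfunE.
Qed.

(** Trace of [e, f] on the line of f plus the spaces of weight k al, k natural: the sum of k times
    their dimensions is 1, so the term k = 1 is everything. The space is f-stable because f is a
    true weight vector, so h maps it into its line. *)
Lemma root_dim1 al : al \in wts -> al != 0 -> \dim (wt_space al) = 1%N.
Proof.
move=> alw al0; have [t [e [f [tE we wf [Bef ef alt]]]]] := root_triple alw al0.
have f0 : f != 0.
  by apply/eqP => f0; move/eqP: Bef; rewrite f0 linear0r eq_sym oner_eq0.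
pose P be := `[< exists k : nat, be = al *+ k >].
pose s := filter P wts.
have us : uniq s by apply: filter_uniq.
have sP be z k : wt be z -> be = al *+ k -> z \in (\sum_(ga <- s) wt_space ga)%VS.
  move=> wz bE; apply: (mem_sum_wt wz) => z0; rewrite mem_filter (wts_all wz z0) andbT.
  by apply/asboolP; exists k.
have [kk kkE] : exists kk : weight -> nat, forall be, P be -> be = al *+ kk be.
  have h1 be : exists k : nat, P be -> be = al *+ k.
    by have [/asboolP[k kE]|_] := boolP (P be); [exists k|exists 0%N].
  by have [kk kkE] := choice h1; exists kk.
have Nals : - al \notin s.
  apply/negP; rewrite mem_filter => /andP[/asboolP[k kE] _].
  move/eqP: kE; rewrite -subr_eq0 -opprD oppr_eq0 -mulrS => /eqP/lfunP/(_ t).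
  rewrite zero_lfunE -scaler_nat scale_lfunE => /eqP.
  by rewrite mulf_eq0 (negbTE alt) Num.Theory.pnatr_eq0.
pose W := (<[f]> + \sum_(be <- s) wt_space be)%VS.
have cap : (<[f]> :&: \sum_(be <- s) wt_space be)%VS = 0%VS.
  have sub : (<[f]> <= wt_space (- al))%VS.
    by rewrite -(memvE f); apply/wt_spaceP/weight_vector_wt.
  apply/eqP; rewrite -subv0; apply: (subv_trans (capvS sub (subvv _))).
  by rewrite (wt_space_cap hnil) ?subvv //= Nals.
have fW : f \in W by apply: (subvP (addvSl _ _)); rewrite memv_line.
have sW x : x \in (\sum_(be <- s) wt_space be)%VS -> x \in W.
  by apply: (subvP (addvSr _ _)).
have lin_stable (z : g) : lie z f \in W ->
    (forall be y, be \in s -> wt be y -> lie z y \in W) -> vstable W (ad z).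
  move=> zf zs _ /memv_addP[_ /vlineP[a ->] [x xs ->]].
  rewrite /ad linearDr linearZr_LR /=; apply: rpredD; first exact: memvZ.
  have [y wy ->] := sum_wtP us xs.
  by rewrite linear_sumr big_seq; apply: rpred_sum => be bs;
    exact: (zs be (y be) bs (wy be)).
have eW : vstable W (ad e).
  apply: lin_stable => [|be y bs wy].
    by rewrite ef; apply/sW/(sP 0 _ 0%N) => //; apply: (wt_h hnil); apply: subvsP.
  apply/sW/(sP (al + be) _ (kk be).+1); first exact: wt_lie.
  by rewrite mulrS; congr (_ + _); apply: kkE; move: bs; rewrite mem_filter => /andP[].
have fWs : vstable W (ad f).
  apply: lin_stable => [|be y bs wy]; first by rewrite liexx mem0v.
  have /kkE bE : P be by move: bs; rewrite mem_filter => /andP[].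
  case k: (kk be) bE => [|k'] bE; last first.
    apply/sW/(sP (- al + be) _ k'); first exact: wt_lie (weight_vector_wt wf) wy.
    by rewrite bE mulrS addrA addNr add0r.
  have yh : y \in h by apply: (cartan_wt0 hcart); rewrite -[0]/(al *+ 0) -bE.
  by rewrite lieC -(vsprojK yh) wf memvN memvZ.
have := rtr_comm eW fWs.
rewrite (eq_rtr (T := ad (vsval t))) => [|x _]; last first.
  by apply/eqP; rewrite subr_eq -ef; apply/eqP; exact: lie_lie.
have tW : vstable <[f]>%VS (ad (vsval t)).
  by move=> _ /vlineP[a ->]; rewrite /ad linearZr_LR /= wf !memvZ ?memv_line.
have ts be : be \in s -> vstable (wt_space be) (ad (vsval t)).
  by move=> _; apply: (wt_space_stable hnil); apply: subvsP.
pose T : {linear g -> g} := ad (vsval t).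
rewrite [LHS](rtr_add (T := T) cap) //; last first.
  move=> x xs; have [y wy ->] := sum_wtP us xs.
  rewrite -[T _]/(lie (vsval t) (\sum_(be <- s) y be)) linear_sumr big_seq;
    apply: rpred_sum => be bs.
  apply: (mem_sum_wt (al := be)) => //.
  by apply/wt_spaceP/ts => //; apply/wt_spaceP.
rewrite (rtr_sum_wt (c := fun be => be t * nwt be) hnil us) => //; last first.
  by move=> be _; rewrite (rtr_wt_space hnil).
rewrite (rtr_gev (a := - al t)) // => [|_ /vlineP[a ->]]; last first.
  by exists 1%N; rewrite /= /shift /ad linearZr_LR /=
    wf opp_lfunE scalerA mulrC -scalerA subrr.
rewrite dim_vline f0 mulr1.
have -> : \sum_(be <- s) be t * nwt be = al t *
  (\sum_(be <- s) kk be * \dim (wt_space be))%:R.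
  rewrite natr_sum mulr_sumr big_seq [RHS]big_seq; apply: eq_bigr => be.
  rewrite mem_filter => /andP[/kkE bE _];
    rewrite {1}bE -scaler_nat scale_lfunE natrM mulrA.
  by congr (_ * _); rewrite mulrC.
rewrite -[X in X + _]mulr1 mulNr addrC => /eqP; rewrite subr_eq0.
move=> /eqP/(mulfI alt)/eqP; rewrite Num.Theory.pnatr_eq1.
have Pal : P al by apply/asboolP; exists 1%N.
have kal : kk al = 1%N.
  have /lfunP/(_ t) := kkE _ Pal; rewrite -scaler_nat scale_lfunE -[LHS]mul1r.
  by move=> /(mulIf alt)/esym/eqP; rewrite Num.Theory.pnatr_eq1 => /eqP.
rewrite (bigD1_seq al) //= ?mem_filter ?Pal // kal mul1n.
have := nwt_neq0 alw; case: (\dim _) => // d _.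
by rewrite addSn eqSS addn_eq0 => /andP[/eqP ->].
Qed.

Lemma wt_weight_vector al (x : g) : al != 0 -> wt al x -> weight_vector al x.
Proof.
move=> al0 wx; have [->|x0] := eqVneq x 0; first by move=> s; rewrite lie0 scaler0.
have alw := wts_all wx x0; have [y y0 wy] := weight_vector_exists alw.
have : x \in <[y]>%VS.
  suff <- : wt_space al = <[y]>%VS by apply/wt_spaceP.
  apply/esym/eqP; rewrite eqEdim dim_vline y0 root_dim1 // leqnn andbT -memvE.
  by apply/wt_spaceP/weight_vector_wt.
by move=> /vlineP[a ->] s; rewrite linearZr_LR /= wy scalerA mulrC -scalerA.
Qed.

Lemma root_line al (x y : g) : al != 0 -> wt al x -> x != 0 -> wt al y ->
  exists a, y = a *: x.
Proof.
move=> al0 wx x0 wy; apply/vlineP.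
suff -> : <[x]>%VS = wt_space al by apply/wt_spaceP.
apply/eqP; rewrite eqEdim dim_vline x0 root_dim1 ?(wts_all wx) // leqnn andbT -memvE.
by apply/wt_spaceP.
Qed.

(* Otherwise the trace of [e, f] on the sum of the spaces of weight be - k al *)
(* would be a sum of terms of the same sign as c.                             *)
Lemma root_string_up al be (t : subvs_of h) (e x : g) (c : F) :
  (forall s : subvs_of h, B (vsval t) (vsval s) = al s) ->
  al != 0 -> wt al e -> e != 0 -> wt be x -> x != 0 ->
  al t != 0 -> be t = c * al t -> c < 0 -> lie e x != 0.
Proof.
move=> tE al0 we e0 wx x0 alt bt c0; apply/eqP => ex0.
have be0 : be != 0.
  apply/eqP => E; move/eqP: bt; rewrite E zero_lfunE eq_sym mulf_eq0 (negbTE alt) orbF.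
  by rewrite Order.POrderTheory.lt_eqF.
have [y wy Bey] := form_wt_pair we e0.
have ef : lie e y = vsval t.
  by rewrite (lie_root_vectors tE we) ?Bey ?scale1r //; apply: wt_weight_vector;
    rewrite ?oppr_eq0.
pose P ga := `[< exists k : nat, ga = be - al *+ k >].
pose s := filter P wts.
have us : uniq s by apply: filter_uniq.
have [kk kkE] : exists kk : weight -> nat, forall ga, P ga -> ga = be - al *+ kk ga.
  have h1 ga : exists k : nat, P ga -> ga = be - al *+ k.
    by have [/asboolP[k kE]|_] := boolP (P ga); [exists k|exists 0%N].
  by have [kk kkE] := choice h1; exists kk.
have sP ga z k : wt ga z -> ga = be - al *+ k -> z \in (\sum_(ga <- s) wt_space ga)%VS.
  move=> wz bE; apply: (mem_sum_wt wz) => z0; rewrite mem_filter (wts_all wz z0) andbT.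
  by apply/asboolP; exists k.
have stab ga z : ga \in s -> wt ga z -> lie e z \in (\sum_(de <- s) wt_space de)%VS /\
    lie y z \in (\sum_(de <- s) wt_space de)%VS.
  rewrite mem_filter => /andP[/kkE gE _] wz; split; last first.
    apply: (sP (- al + ga) _ (kk ga).+1); first exact: wt_lie.
    by rewrite {1}gE mulrS opprD addrCA.
  case k: (kk ga) gE => [|k'] gE; last first.
    apply: (sP (al + ga) _ k'); first exact: wt_lie.
    by rewrite gE mulrS opprD addrCA addNKr.
  rewrite mulr0n subr0 in gE; rewrite gE in wz.
  by have [a ->] := root_line be0 wx x0 wz; rewrite linearZr_LR /= ex0 scaler0 mem0v.
have := trace_formula hnil us ef stab.
have -> : \sum_(ga <- s) ga t * nwt ga = al t * \sum_(ga <- s) (c - (kk ga)%:R) * nwt ga.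
  rewrite mulr_sumr big_seq [RHS]big_seq; apply: eq_bigr => ga.
  rewrite mem_filter => /andP[/kkE gE _]; rewrite {1}gE -scaler_nat add_lfunE opp_lfunE.
  by rewrite scale_lfunE bt mulrA -[_ *: _]/(_ * _) -mulrBl [al t * _]mulrC.
move/eqP; rewrite mulf_eq0 (negbTE alt) /= => /eqP S0.
have bes : be \in s.
  by rewrite mem_filter (wts_all wx x0) andbT; apply/asboolP; exists 0%N; rewrite subr0.
have neg ga : ga \in s -> (c - (kk ga)%:R) * nwt ga < 0.
  rewrite mem_filter => /andP[_ gw]; rewrite Num.Theory.nmulr_rlt0.
    by rewrite Num.Theory.ltr0n nwt_neq0.
  rewrite Num.Theory.subr_lt0; apply: Order.POrderTheory.lt_le_trans c0 _.
  exact: Num.Theory.ler0n.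
have : \sum_(ga <- s) (c - (kk ga)%:R) * nwt ga < 0.
  rewrite (bigD1_seq be) //=; apply: Order.POrderTheory.le_lt_trans (neg _ bes).
  rewrite -[leRHS]addr0 Num.Theory.lerD2l -big_filter big_seq.
  apply: Num.Theory.sumr_le0 => ga.
  by rewrite mem_filter => /andP[_ /neg/Order.POrderTheory.ltW].
by rewrite S0 Order.POrderTheory.ltxx.
Qed.
End CartanTheory.
(** * Borel subalgebras and positive roots *)

Section NonnegativeSums.
Variables (Z : zmodType) (S : pred Z).
Implicit Types (x y : Z) (s : seq Z).

Definition sums x := exists s, [/\ s != [::], all S s & x = \sum_(y <- s) y].

Lemma sums1 x : S x -> sums x.
Proof. by move=> Sx; exists [:: x]; rewrite /= Sx big_seq1. Qed.

Lemma sumsD x y : sums x -> sums y -> sums (x + y).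
Proof.
move=> [s [s0 Ss ->]] [r [_ Sr ->]]; exists (s ++ r).
by rewrite all_cat Ss Sr big_cat; split=> //; case: s s0 {Ss}.
Qed.

Lemma sums_mulrn x n : (0 < n)%N -> sums x -> sums (x *+ n).
Proof.
case: n => // n _ Sx; elim: n => // n IH.
by rewrite mulrS; apply: sumsD.
Qed.

Variable r : seq Z.

Definition height x :=
  count (fun y => [&& S y & `[< sums (x - y) >]]) r.

Hypotheses (r_uniq : uniq r) (S0 : ~ sums 0).

(** [height] replaces the height relative to simple roots. Whatever splits off x also splits off y,
    and x itself is counted for y but not for x, as 0 is not a sum. *)
Lemma height_lt x y : S x -> x \in r -> sums (y - x) -> (height x < height y)%N.
Proof.
move=> Sx xr yx; rewrite /height -!size_filter.
set P := fun y : Z => _; set Q := fun y : Z => _.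
apply: (@uniq_leq_size _ (x :: filter P r)) => [/=|z].
  rewrite filter_uniq // andbT mem_filter negb_and; apply/orP; left.
  by rewrite /P Sx /= subrr; apply/asboolP.
rewrite inE !mem_filter => /predU1P[->|/andP[/andP[Sz /asboolP xz] ->]].
  by rewrite /Q Sx xr andbT; apply/asboolP.
rewrite /Q Sz andbT; apply/asboolP.
by rewrite -(subrK x y) -addrA; apply: sumsD.
Qed.
End NonnegativeSums.

Lemma sums_addl (Z : zmodType) (S : pred Z) a x : sums (fun y => S y || (y == a)) x ->
  exists m (s : seq Z), [/\ all S s, x = a *+ m + \sum_(y <- s) y &
    s = [::] -> (0 < m)%N].
Proof.
move=> [s [s0 Ss ->]]; suff: exists m (r : seq Z),
  [/\ all S r, \sum_(y <- s) y = a *+ m + \sum_(y <- r) y & (size s = m + size r)%N].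
  move=> [m [r [Sr rE sE]]]; exists m, r; split=> // r0.
  by move: s0; rewrite -size_eq0 sE r0 addn0 lt0n.
elim: s Ss {s0} => [_|y s IH /= /andP[Sy /IH[m [r [Sr rE sE]]]]].
  by exists 0%N, [::]; rewrite !big_nil addr0.
case/orP: Sy => [Sy|/eqP ->].
  by exists m, (y :: r); rewrite /= Sy !big_cons rE addrCA sE addnS.
by exists m.+1, r; rewrite big_cons rE mulrS addrA sE addSn.
Qed.

Lemma span_lie (F : fieldType) (g : lieAlgType F) (S1 S2 : g -> Prop) (U : {vspace g}) :
  (forall x y, S1 x -> S2 y -> lie x y \in U) ->
  forall x y, x \in linear_span S1 -> y \in linear_span S2 -> lie x y \in U.
Proof.
move=> SU x y xS; move: y; apply: linear_span_ind; first by rewrite linear0r mem0v.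
move=> a y z Sy zU; rewrite linearDr linearZr_LR /=; apply: rpredD => //; apply: rpredZ.
move: x xS {z zU}; apply: linear_span_ind; first by rewrite linear0l mem0v.
move=> c x z Sx zU; rewrite linearDl linearZl_LR /=; apply: rpredD zU.
by apply: rpredZ; apply: SU.
Qed.

Section Borel.
Variables (F : numClosedFieldType) (g : lieAlgType F) (B : {symmetric g}).
Variables (h b : {vspace g}).
Hypotheses (ss : lie_semisimple g) (nd : nondegenerate B) (Binv : ad_invariant B).
Hypothesis hcart : cartan_subalgebra h.
Hypotheses (hborel : borel_subalgebra b) (hb : (h <= b)%VS).
Variable N : nat.
Hypothesis hnil : forall x y : g, x \in h -> y \in h -> iter N (ad x) y = 0.
Local Notation weight := 'Hom(subvs_of h, F^o).
Implicit Types al be ga : weight.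
Variable wts : seq weight.
Hypothesis wts_uniq : uniq wts.
Hypothesis wts_nz : forall al, al \in wts -> exists2 x, x != 0 & wt al x.
Hypothesis wts_all : forall al x, wt al x -> x != 0 -> al \in wts.

Local Notation wt_space := (@wt_space F g h).

Let triple := root_triple ss nd Binv hcart hnil wts_uniq wts_nz wts_all.
Let wvec := wt_weight_vector ss nd Binv hcart hnil wts_uniq wts_nz wts_all.
Let line := root_line ss nd Binv hcart hnil wts_uniq wts_nz wts_all.
Let string_up := root_string_up ss nd Binv hcart hnil wts_uniq wts_nz wts_all.

Definition pos al := [&& al \in wts, al != 0 & (wt_space al <= b)%VS].

Lemma borel_lie (x y : g) : x \in b -> y \in b -> lie x y \in b.
Proof. by have [/lie_subalgebraP bs _ _] := hborel; apply: bs. Qed.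

Lemma pos_intro al (x : g) : al != 0 -> wt al x -> x != 0 -> x \in b -> pos al.
Proof.
move=> al0 wx x0 xb; rewrite /pos al0 (wts_all wx x0) /=; apply/subvP => y /wt_spaceP wy.
by have [a ->] := line al0 wx x0 wy; apply: memvZ.
Qed.

Lemma pos_mem al (x : g) : pos al -> wt al x -> x \in b.
Proof. by move=> /and3P[_ _ /subvP bs] wx; apply: bs; apply/wt_spaceP. Qed.

(** Otherwise e, f and t = [e, f] would survive in every term of the derived series of b, since t
    acts on e and f by nonzero scalars. *)
Lemma pos_opp al : pos al -> ~~ pos (- al).
Proof.
move=> pal; have /and3P[alw al0 _] := pal; apply/negP => pnal.
have [t [e [f [tE we wf [Bef ef alt]]]]] := triple alw al0.
have eb := pos_mem pal we; have fb := pos_mem pnal (weight_vector_wt wf).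
have tb : vsval t \in b by rewrite -ef borel_lie.
have all_in n : let W := iter n (fun W => lie_prod W W) b in
    [/\ e \in W, f \in W & vsval t \in W].
  elim: n => [|n [eW fW tW]] //=; set W := iter _ _ _ in eW fW tW *.
  have te : lie (vsval t) e = al t *: e by apply: wvec.
  have tf : lie (vsval t) f = - al t *: f by rewrite wf opp_lfunE.
  split; last by rewrite -ef; apply: memv_lie_prod.
    by rewrite -(scalerK alt e) -te memvZ // memv_lie_prod.
  have alt' : - al t != 0 by rewrite oppr_eq0.
  by rewrite -(scalerK alt' f) -tf memvZ // memv_lie_prod.
have [_ [n n0] _] := hborel; have [eW _ _] := all_in n.
move: eW; rewrite n0 memv0 => /eqP e0.
by move/eqP: Bef; rewrite e0 linear0l eq_sym oner_eq0.
Qed.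

(* In a shortest vanishing sum some term pairs negatively with the coroot of  *)
(* the first one, and their sum is again a weight of b.                       *)
Lemma pos_sums0 : ~ sums pos 0.
Proof.
move=> [s [s0 ps sE]]; have [n ns] := ubnP (size s).
elim: n s s0 ps sE ns => // n IH [//|al s] _ /= /andP[pal ps] sE ns.
have /and3P[alw al0 _] := pal.
have [t [e [f [tE we wf [Bef ef alt]]]]] := triple alw al0.
have [q [q1 qE]] := string_rational hnil wts_uniq wts_nz wts_all we
  (weight_vector_wt wf) ef.
have e0 : e != 0.
  by apply/eqP => e0; move/eqP: Bef; rewrite e0 linear0l eq_sym oner_eq0.
have sw be : be \in s -> be \in wts by move=> /(allP ps)/and3P[].
have sq : \sum_(be <- s) q be = -1.
  apply: (mulIf alt); move/lfunP/(_ t): sE; rewrite big_cons add_lfunE zero_lfunE.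
  move/esym/eqP; rewrite addrC addr_eq0 => /eqP sE; rewrite mulN1r -sE sum_lfunE.
  by rewrite mulr_suml big_seq [RHS]big_seq; apply: eq_bigr => be /sw/qE[_ ->].
have [/hasP[be bes qbe]|/hasPn qpos] := boolP (has (fun be => q be < 0) s); last first.
  have : 0 <= \sum_(be <- s) q be.
    rewrite big_seq; apply: Num.Theory.sumr_ge0 => be bes.
    have [qr _] := qE _ (sw _ bes).
    by rewrite Num.Theory.real_leNgt ?rpred0 // qpos.
  by rewrite sq Num.Theory.oppr_ge0 Num.Theory.ler10.
have [x x0 wx] := wts_nz (sw _ bes); have [_ bt] := qE _ (sw _ bes).
have ex0 := string_up tE al0 we e0 wx x0 alt bt qbe.
have wex := wt_lie we wx.
have pbe := allP ps _ bes.
have exb : lie e x \in b by apply: borel_lie;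
  [exact: pos_mem pal we|exact: pos_mem pbe wx].
have ab0 : al + be != 0.
  apply/eqP => ab; have bE : be = - al by apply/eqP; rewrite -addr_eq0 addrC ab.
  by have := pos_opp pal; rewrite -bE pbe.
apply: (IH (al + be :: rem be s)) => //=.
- rewrite (pos_intro ab0 wex ex0 exb); apply/allP => ga /mem_rem; exact: (allP ps).
- by rewrite [LHS]sE !big_cons -addrA; congr (_ + _); apply: big_rem.
by rewrite size_rem //; case: (s) bes ns.
Qed.

Section Enlarge.
Variable S : pred weight.
Hypotheses (S0 : ~ sums S 0) (Spos : forall al, pos al -> S al).

(** The roots in the cone generated by [S]. Together with h their spaces span a subalgebra [V];
    [D k] keeps the roots of height at least k. *)
Let C al := [&& al \in wts, al != 0 & `[< sums S al >]].

Let sumsC al : sums C al -> sums S al.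
Proof.
move=> [[|be s] [//= _ /andP[/and3P[_ _ /asboolP Sbe] Cs] ->]].
elim: s be Sbe Cs => [|ga s IH] be Sbe /=; first by rewrite big_seq1.
move=> /andP[/and3P[_ _ /asboolP Sga] Cs]; rewrite !big_cons addrA.
by have := IH (be + ga) (sumsD Sbe Sga) Cs; rewrite big_cons.
Qed.

Let C0 : ~ sums C 0. Proof. by move/sumsC. Qed.

Let V := linear_span (fun x : g => x \in h \/ exists2 al, C al & wt al x).
Let D k := linear_span (fun x : g =>
  exists al, [/\ C al, (k <= height C wts al)%N & wt al x]).

Let C_lie al be (x y : g) : C al -> C be -> wt al x -> wt be y -> lie x y != 0 ->
  C (al + be) /\ (height C wts al < height C wts (al + be))%N.
Proof.
move=> Cal Cbe wx wy xy0; have Cab : sums C (al + be) by apply: sumsD; apply: sums1.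
split; last first.
  apply: height_lt => //; first by case/and3P: Cal.
  by rewrite addrC addKr; apply: sums1.
rewrite /C (wts_all (wt_lie wx wy) xy0) /=; apply/andP; split;
  last by apply/asboolP/sumsC.
by apply/eqP => ab0; apply: C0; rewrite -ab0.
Qed.

Let V_D0 (x y : g) : x \in V -> y \in V -> lie x y \in D 0.
Proof.
have hD (t z : g) al : t \in h -> C al -> wt al z -> lie t z \in D 0.
  move=> th Cal wz; have al0 : al != 0 by case/and3P: Cal.
  rewrite -(vsprojK th) (wvec al0 wz); apply: memvZ.
  by apply: mem_linear_span; exists al.
apply: span_lie => {}x {}y [xh|[al Cal wx]] [yh|[be Cbe wy]].
- by rewrite (cartan_abelian ss nd Binv hcart hnil wts_uniq wts_nz wts_all) ?mem0v.
- exact: hD Cbe wy.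
- by rewrite lieC memvN; apply: hD Cal wx.
have [->|xy0] := eqVneq (lie x y) 0; first exact: mem0v.
have [Cab _] := C_lie Cal Cbe wx wy xy0.
by apply: mem_linear_span; exists (al + be); split=> //; apply: wt_lie.
Qed.

Let D_S k (x y : g) : x \in D k -> y \in D k -> lie x y \in D k.+1.
Proof.
apply: span_lie => {}x {}y [al [Cal kal wx]] [be [Cbe _ wy]].
have [->|xy0] := eqVneq (lie x y) 0; first exact: mem0v.
have [Cab ht_ab] := C_lie Cal Cbe wx wy xy0.
apply: mem_linear_span; exists (al + be); split=> //; last exact: wt_lie.
exact: leq_ltn_trans kal ht_ab.
Qed.

(** [V] contains b and is solvable, because heights grow under brackets; so [V] = b by
    maximality. *)
Lemma borel_enlarge al (x : g) : S al -> al != 0 -> wt al x -> x \in b.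
Proof.
move=> Sal al0 wx; have [->|x0] := eqVneq x 0; first exact: mem0v.
have D0V : (D 0 <= V)%VS.
  apply: linear_span_le => y [be [Cbe _ wy]]; apply: mem_linear_span; right.
  by exists be.
have Vsub : lie_subalgebra V.
  by apply: lie_prod_le => y z yV zV; apply: (subvP D0V); apply: V_D0.
have Vsolv : lie_solvable V.
  have le k : (iter k.+1 (fun W => lie_prod W W) V <= D k)%VS.
    elim: k => [|k /subvP IH]; first by apply: lie_prod_le => y z; apply: V_D0.
    by apply: lie_prod_le => y z /IH yD /IH; apply: D_S.
  (* Heights are at most [size wts], so [D (size wts).+1] is 0; one more derived step leads from [V]
     into [D 0]. *)
  exists (size wts).+2; apply/eqP; rewrite -subv0; apply: subv_trans (le _) _.
  apply: linear_span_le => y [be [_ + _]].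
  by move=> /leq_trans/(_ (count_size _ _)); rewrite ltnn.
have bV : (b <= V)%VS.
  apply/subvP => y yb; have hst : hstable h b.
    by move=> t th z zb; apply: borel_lie => //; apply: (subvP hb).
  have [z zE ->] := wt_sum_full hnil wts_uniq wts_all hst yb.
  apply: memv_suml => be _; have [zb wz] := zE be.
  have [->|z0] := eqVneq (z be) 0; first exact: mem0v.
  apply: mem_linear_span; have [be0|be0] := eqVneq be 0.
    by left; apply: (cartan_wt0 hcart); rewrite -[X in wt X]be0.
  right; exists be => //; rewrite /C be0 (wts_all wz z0); apply/asboolP/sums1/Spos.
  exact: pos_intro wz z0 zb.
have [_ _ bmax] := hborel; rewrite -(bmax V Vsub Vsolv bV).
apply: mem_linear_span; right; exists al => //.
by rewrite /C al0 (wts_all wx x0); apply/asboolP/sums1.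
Qed.
End Enlarge.

(** If neither al nor its opposite is positive, adjoining either one to the positive roots must
    create a vanishing sum, by [borel_enlarge]. So m al + S = 0 and - n al + R = 0 with m, n
    positive and S, R sums of positive roots; then n S + m R = 0, against [pos_sums0]. *)
Lemma pos_total al : al \in wts -> al != 0 -> pos al || pos (- al).
Proof.
move=> alw al0; have [x x0 wx] := wts_nz alw.
have [y wy Bxy] := form_wt_pair nd Binv hnil wts_uniq wts_all wx x0.
have y0 : y != 0.
  by apply/eqP => y0; move/eqP: Bxy; rewrite y0 linear0r eq_sym oner_eq0.
have nal0 : - al != 0 by rewrite oppr_eq0.
have enl be z : be != 0 -> wt be z -> z != 0 -> ~~ pos be ->
    sums (fun ga => pos ga || (ga == be)) 0.
  move=> be0 wz z0 nbe; apply: contrapT => S0; move/negP: nbe; apply.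
  apply: (pos_intro be0 wz z0); apply: (borel_enlarge S0) wz => // [ga ->//|].
  by rewrite eqxx orbT.
have mul0 be m : be != 0 -> (0 < m)%N -> be *+ m != 0.
  by move=> be0 m0; rewrite -scaler_nat scaler_eq0 negb_or be0 Num.Theory.pnatr_eq0
    -lt0n m0.
apply: contrapT => /negP; rewrite negb_or => /andP[pal pnal].
have [m [s [ps sE s_m]]] := sums_addl (enl _ _ al0 wx x0 pal).
have [n [r [pr rE r_n]]] := sums_addl (enl _ _ nal0 wy y0 pnal).
have pos_of be k (u : seq weight) : be != 0 -> all pos u ->
  0 = be *+ k + \sum_(ga <- u) ga ->
    (u = [::] -> (0 < k)%N) -> (0 < k)%N /\ sums pos (\sum_(ga <- u) ga).
  move=> be0 pu uE u_k; have u0 : u != [::].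
    apply/eqP => u0; move: uE; rewrite u0 big_nil addr0 => /esym/eqP; apply/negP.
    by apply: mul0 be0 _; apply: u_k.
  split; last by exists u.
  by case: k {u_k} uE => // uE; case: pos_sums0; exists u; split=> //;
    rewrite [LHS]uE mulr0n add0r.
have [m0 ss0] := pos_of _ _ _ al0 ps sE s_m.
have [n0 rs0] := pos_of _ _ _ nal0 pr rE r_n.
apply: pos_sums0; have := sumsD (sums_mulrn n0 ss0) (sums_mulrn m0 rs0).
have -> : \sum_(ga <- s) ga = - (al *+ m).
  by apply/eqP; rewrite -addr_eq0 addrC; apply/eqP/esym.
have -> : \sum_(ga <- r) ga = al *+ n.
  by apply/eqP; rewrite -subr_eq0 -mulNrn addrC; apply/eqP/esym.
by rewrite mulNrn -!mulrnA mulnC addNr.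
Qed.
End Borel.
Section BorelBasis.
Variables (F : numClosedFieldType) (g : lieAlgType F) (B : {symmetric g}).
Variables (h b : {vspace g}).
Hypotheses (ss : lie_semisimple g) (nd : nondegenerate B) (Binv : ad_invariant B).
Hypothesis hcart : cartan_subalgebra h.
Hypotheses (hborel : borel_subalgebra b) (hb : (h <= b)%VS).
Local Notation weight := 'Hom(subvs_of h, F^o).
Implicit Types al be ga : weight.

(** Enumerate the positive roots and take a triple of [root_triple] for each. Totality gives the
    spanning of g, one-dimensional root spaces turn brackets into multiples of basis vectors, and
    [height] supplies [ht]. *)
Theorem triangular_basis_exists : exists (n : nat) (e f : 'I_n -> g) (ht : 'I_n -> nat),
  [/\ triangular_basis B h e f ht,
      forall i, e i \in nplus h b, forall i, f i \in nminus h b,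
      forall x, x \in nplus h b -> exists a, x = \sum_i a i *: e i &
      forall x, x \in nminus h b -> exists a, x = \sum_i a i *: f i].
Proof.
have [N hnil] := cartan_nil hcart.
have [wts [wts_uniq wts_nz wts_all]] := weights_exist hnil.
have wvec := wt_weight_vector ss nd Binv hcart hnil wts_uniq wts_nz wts_all.
have line := root_line ss nd Binv hcart hnil wts_uniq wts_nz wts_all.
have hab := cartan_abelian ss nd Binv hcart hnil wts_uniq wts_nz wts_all.
have sums0 := pos_sums0 ss nd Binv hcart hborel hnil wts_uniq wts_nz wts_all.
have total := pos_total ss nd Binv hcart hborel hb hnil wts_uniq wts_nz wts_all.
have form0 := form_wt0 (h := h) Binv.
pose posb := pos b wts; rewrite -/posb in sums0 total.
have posP al : posb al -> al \in wts /\ al != 0 by move=> /and3P[].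
pose root_pair al (ef : g * g) := exists t : subvs_of h,
    [/\ forall s : subvs_of h, B (vsval t) (vsval s) = al s,
     wt al ef.1, weight_vector (- al) ef.2 &
    [/\ B ef.1 ef.2 = 1, lie ef.1 ef.2 = vsval t & al t != 0]].
have [ef efP] : exists ef : weight -> g * g, forall al, posb al -> root_pair al (ef al).
  have H al : exists ef : g * g, posb al -> root_pair al ef.
    have [pal|_] := boolP (posb al); last by exists (0, 0).
    have [alw al0] := posP _ pal.
    have [t [e [f H]]] := root_triple ss nd Binv hcart hnil wts_uniq wts_nz wts_all
      alw al0.
    by exists (e, f) => _; exists t.
  by have [ef efE] := choice H; exists ef.
pose ps := filter posb wts; pose n := size ps.
pose r (i : 'I_n) : weight := nth 0 ps i.
have rP i : posb (r i).
  by have := mem_nth 0 (ltn_ord i); rewrite -/ps mem_filter => /andP[].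
have rw i : r i \in wts by have [] := posP _ (rP i).
have r0 i : r i != 0 by have [] := posP _ (rP i).
have r_inj i j : r i = r j -> i = j.
  by move/eqP; rewrite nth_uniq ?filter_uniq // => /eqP/val_inj.
have r_surj al : posb al -> exists i, r i = al.
  move=> pal; have alps : al \in ps by rewrite mem_filter pal; have [] := posP _ pal.
  have ips : (index al ps < n)%N by rewrite index_mem.
  by exists (Ordinal ips); rewrite /r /= nth_index.
pose e i := (ef (r i)).1; pose f i := (ef (r i)).2.
have we i : wt (r i) (e i) by have [t []] := efP _ (rP i).
have wvf i : weight_vector (- r i) (f i) by have [t []] := efP _ (rP i).
have wf i : wt (- r i) (f i) by apply: weight_vector_wt.
have Bef i : B (e i) (f i) = 1 by have [t [_ _ _ []]] := efP _ (rP i).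
have e_neq0 i : e i != 0.
  by apply/eqP => e0; have/eqP := Bef i; rewrite e0 linear0l eq_sym oner_eq0.
have f_neq0 i : f i != 0.
  by apply/eqP => f0; have/eqP := Bef i; rewrite f0 linear0r eq_sym oner_eq0.
have tri i : [/\ lie (e i) (f i) \in h,
    forall x, x \in h -> B (lie (e i) (f i)) x = r i (vsproj h x) &
    B (lie (e i) (f i)) (lie (e i) (f i)) != 0].
  have [t [tE _ _ [_ -> alt]]] := efP _ (rP i).
  split; first exact: subvsP.
    by move=> x xh; rewrite -{1}(vsprojK xh) tE.
  by rewrite tE.
have in_e al x : posb al -> wt al x -> exists l k, r l = al /\ x = k *: e l.
  move=> /r_surj[l <-] wx; have [k ->] := line _ _ _ (r0 l) (we l) (e_neq0 l) wx.
  by exists l, k.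
have in_f al x : posb al -> wt (- al) x -> exists l k, r l = al /\ x = k *: f l.
  move=> /r_surj[l <-] wx.
  have nr0 : - r l != 0 by rewrite oppr_eq0.
  by have [k ->] := line _ _ _ nr0 (wf l) (f_neq0 l) wx; exists l, k.
have s2 al be : posb al -> posb be -> sums posb (al + be).
  by move=> pa pb; apply: sumsD; apply: sums1.
have sum_neq0 al be : posb al -> posb be -> al + be != 0.
  by move=> pa pb; apply/eqP => ab; apply: sums0; rewrite -ab; apply: s2.
have sum_pos al be : posb al -> posb be -> al + be \in wts -> posb (al + be).
  move=> pa pb ab; have := total _ ab (sum_neq0 _ _ pa pb).
  case/orP=> [//|pn]; case: sums0; rewrite -(subrr (al + be)).
  by apply: sumsD; [apply: s2|apply: sums1].
have one (c : 'I_n -> g) l k : \sum_i (if i == l then k else 0) *: c i = k *: c l.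
  by rewrite (bigD1 l) //= eqxx big1 ?addr0 // => i /negbTE ->; rewrite scale0r.
have sumD (u v : 'I_n -> F) (w : 'I_n -> g) :
    \sum_i (u i + v i) *: w i = \sum_i u i *: w i + \sum_i v i *: w i.
  by rewrite -big_split; apply: eq_bigr => i _; rewrite scalerDl.
have posbE al : @positive_root F g h b al -> posb al.
  move=> [[al0 [z z0 wz]] alb]; apply/and3P; split=> //.
    exact: wts_all (weight_vector_wt wz) z0.
  by apply/subvP => x /wt_spaceP wx; apply: alb; apply: wvec.
have span_of (c : 'I_n -> g) (S : g -> Prop) :
    (forall x, S x -> exists l k, x = k *: c l) ->
    forall x, x \in linear_span S -> exists a, x = \sum_i a i *: c i.
  move=> Sc; apply: linear_span_ind => [|a x y /Sc[l [k ->]] [u ->]].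
    by exists (fun=> 0); rewrite big1 // => i _; rewrite scale0r.
  exists (fun i => (if i == l then a * k else 0) + u i).
  by rewrite sumD one scalerA.
exists n, e, f, (fun i => height posb wts (r i)); split.
- split.
  + move=> i j; by apply: form0 (we i) (we j) _; apply: sum_neq0; apply: rP.
  + by move=> i j; apply: form0 (wf i) (wf j) _; rewrite -opprD oppr_eq0 sum_neq0 ?rP.
  + move=> i j; have [->|ij] := eqVneq i j; first exact: Bef.
    apply: form0 (we i) (wf j) _; rewrite subr_eq0.
    by apply: contraNneq ij => /r_inj ->.
  + by move=> x i xh; apply: form0 (wt_h hnil xh) (we i) _; rewrite add0r r0.
  + by move=> x i xh; apply: form0 (wt_h hnil xh) (wf i) _; rewrite add0r oppr_eq0 r0.
  + pose Q x := exists a b z, z \in h /\ x = \sum_i a i *: e i + \sum_i b i *: f i + z.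
    have QD x y : Q x -> Q y -> Q (x + y).
      move=> [a [c [z [zh ->]]]] [a' [c' [z' [zh' ->]]]].
      exists (fun i => a i + a' i), (fun i => c i + c' i), (z + z'); split;
        first exact: memvD.
      by rewrite !sumD addrACA; congr (_ + _); rewrite addrACA.
    have Q0 : Q 0.
      exists (fun=> 0), (fun=> 0), 0; rewrite mem0v; split=> //.
      by rewrite !big1 ?addr0 // => i _; rewrite scale0r.
    have zero (c : 'I_n -> g) : \sum_i 0 *: c i = 0.
      by rewrite big1 // => i _; rewrite scale0r.
    move=> x; rewrite -/(Q x).
    have [y wy ->] := wt_decomp hnil wts_uniq wts_all x.
    elim/big_ind: _ => // al _; have wyal := wy al.
    have [al0|al0] := eqVneq al 0.
      exists (fun=> 0), (fun=> 0), (y al); rewrite !zero !add0r; split=> //.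
      by apply: (cartan_wt0 hcart); rewrite -[X in wt X]al0.
    have [y0|y0] := eqVneq (y al) 0; first by rewrite y0.
    have /orP[pal|pal] := total _ (wts_all _ _ wyal y0) al0.
      have [l [k [_ ->]]] := in_e _ _ pal wyal.
      exists (fun i => if i == l then k else 0), (fun=> 0), 0.
      by rewrite one zero !addr0 mem0v.
    rewrite -[al]opprK in wyal; have [l [k [_ yE]]] := in_f _ _ pal wyal.
    rewrite opprK in yE; rewrite yE.
    exists (fun=> 0), (fun i => if i == l then k else 0), 0.
    by rewrite one zero add0r addr0 mem0v.
  + by move=> i; have [] := tri i.
  + exact: hab.
  + move=> x i xh; have [_ tE _] := tri i; rewrite (tE x xh).
    by rewrite -{1}(vsprojK xh); exact (wvec _ _ (r0 i) (we i) (vsproj h x)).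
  + move=> x i xh; have [_ tE _] := tri i; rewrite (tE x xh).
    by rewrite -{1}(vsprojK xh) wvf opp_lfunE.
  + move=> i j; have [E|E] := eqVneq (lie (e i) (e j)) 0.
      by exists 0, i; rewrite scale0r.
    have w := wt_lie (we i) (we j).
    have [l [k [_ ->]]] := in_e _ _ (sum_pos _ _ (rP i) (rP j) (wts_all _ _ w E)) w.
    by exists k, l.
  + move=> i j; have [E|E] := eqVneq (lie (f i) (f j)) 0.
      by exists 0, i; rewrite scale0r.
    have w := wt_lie (wf i) (wf j); rewrite -opprD in w.
    have ij0 : - (r i + r j) != 0 by rewrite oppr_eq0 sum_neq0 ?rP.
    have pij : posb (r i + r j).
      have := total _ (wts_all _ _ w E) ij0; rewrite opprK => /orP[pn|//].
      case: sums0; rewrite -(subrr (r i + r j)).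
      by apply: sumsD; [apply: s2|apply: sums1].
    by have [l [k [_ ->]]] := in_f _ _ pij w; exists k, l.
  + move=> i j ij; have [E|E] := eqVneq (lie (e i) (f j)) 0; first by constructor 1.
    have w := wt_lie (we i) (wf j).
    have ij0 : r i - r j != 0.
      by rewrite subr_eq0; apply: contraNneq ij => /r_inj ->.
    have /orP[pal|pal] := total _ (wts_all _ _ w E) ij0.
      have [l [k [rl ->]]] := in_e _ _ pal w; constructor 3; exists l, k; split=> //.
      (* Here r_i = r_l + r_j, so r_l is smaller than r_i; in the other case r_j = r_l + r_i. *)
      apply: height_lt => //; rewrite rl opprB addrCA subrr addr0.
      exact: sums1.
    rewrite -[_ - _]opprK in w; have [l [k [rl lE]]] := in_f _ _ pal w.
    constructor 2; exists l, k; split=> //.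
    apply: height_lt => //; rewrite rl opprK addrCA subrr addr0.
    exact: sums1.
  + by move=> i; have [] := tri i.
- move=> i; apply: mem_linear_span; exists (r i); last exact: wvec.
  split; first by split=> //; exists (e i) => //; apply: wvec.
  move=> x wx; exact: pos_mem (rP i) (weight_vector_wt wx).
- move=> i; apply: mem_linear_span; exists (r i); last exact: wvf.
  split; first by split=> //; exists (e i) => //; apply: wvec.
  move=> x wx; exact: pos_mem (rP i) (weight_vector_wt wx).
- apply: span_of => x [al /posbE pal wx].
  by have [l [k [_ ->]]] := in_e _ _ pal (weight_vector_wt wx); exists l, k.
apply: span_of => x [al /posbE pal wx].
by have [l [k [_ ->]]] := in_f _ _ pal (weight_vector_wt wx); exists l, k.
Qed.
End BorelBasis.

Theorem theorem4p1 (R : realType) (g : lieAlgType R[i]) (B : {symmetric g})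
    (h b : {vspace g}) :
  lie_semisimple g -> nondegenerate B -> ad_invariant B ->
  cartan_subalgebra h -> borel_subalgebra b -> (h <= b)%VS ->
  exists Phi : {linear clifford B -> clifford (restr_form B h)},
    [/\ is_harish_chandra b Phi,
        (forall Psi : {linear clifford B -> clifford (restr_form B h)},
           is_harish_chandra b Psi -> Psi =1 Phi) &
        superalgebra_iso_on (cl_parity B) (cl_parity (restr_form B h))
          (cl_invariant B) Phi].
Proof.
move=> ss nd Binv hcart hborel hb.
have [n [e [f [ht [T eP fP plusE minusE]]]]] :=
  triangular_basis_exists ss nd Binv hcart hborel hb.
have [N hnil] := cartan_nil hcart.
have [wts [wts_uniq wts_nz wts_all]] := weights_exist hnil.
have [hu [hv D]] := dual_bases_exist
  (cartan_nondegenerate nd Binv hcart hnil wts_uniq wts_all).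
exact: harish_chandra_iso Binv T D eP fP plusE minusE.
Qed.
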